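(* Suppose $E_Q(\mathbf{X}\cdot\mathbf{u})^2<\infty$. Fix $k\in\mathcal{V}$ and let $\omega_1,\omega_2,\ldots$ be i.i.d. trees sampled from $P_k$. Then $$\frac{1}{N^2}\sum_{n=1}^N \mathbf{f}(\omega_n)\ \xrightarrow{\mathcal{D}}\ \frac{u_k^2\,\xi}{H(\mathbf{u})}\,\mathbf{v},\qquad N\to\infty,$$ where $\xi$ is a real-valued stable random variable with characteristic function $$E[e^{it\xi}]=\exp\{-(1-i\,\mathrm{sign}(t))\sqrt{|t|}\},\qquad t\in\mathbb{R},$$ and $H$ is the function on $\mathbb{C}^V$ given by $$H(\mathbf{z})=E_Q(\mathbf{X}\cdot\mathbf{z})^2-\sum_{s\in\mathcal{V}}v_sz_s^2,\qquad \mathbf{z}=(z_1,\ldots,z_V)\in\mathbb{C}^V.$$ Moreover $H(\mathbf{u})>0$.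
   Context: Setting (critical multi-type Galton–Watson process). Let $V\in\mathbb{N}$, let $\mathcal{V}=\{1,\ldots,V\}$ be the set of particle types, and $\mathcal{V}^*=(\{0\}\cup\mathbb{N})^V$. For each $k\in\mathcal{V}$ let $p_k$ be a probability distribution on $\mathcal{V}^*$: $p_k(\mathbf{n})$ is the probability that a particle of type $k$ produces exactly $n_s$ offspring of type $s$ for every $s\in\mathcal{V}$; all particles reproduce independently. $P_k$ denotes the law of the resulting random family tree $\omega$ whose root is one particle of type $k$, and $E_k$ is expectation under $P_k$. The mean matrix is $M=(M_{kl})_{k,l\in\mathcal{V}}$, $M_{kl}=\sum_{\mathbf{n}\in\mathcal{V}^*}p_k(\mathbf{n})n_l<\infty$. Standing assumptions: $M$ is irreducible in the sense that some power $M^p$, $p\in\mathbb{N}$, has all entries positive; the process is critical, i.e. the largest (Perron–Frobenius) eigenvalue of $M$ is $1$; and trees are finite with probability $1$ under each $P_k$. Vectors are row vectors, $\mathbf{a}\cdot\mathbf{b}=\sum_{s\in\mathcal{V}}a_sb_s$, and $^t$ is transpose. $\mathbf{v},\mathbf{u}\in\mathbb{R}^V$ are the unique vectors with positive entries such that $\mathbf{v}M=\mathbf{v}$, $M\mathbf{u}^t=\mathbf{u}^t$, $\sum_{s}v_s=1$, $\mathbf{v}\cdot\mathbf{u}=1$. $Q$ is the probability measure on $\mathcal{V}^*$ given by $Q(\mathbf{n})=\sum_{s\in\mathcal{V}}v_sp_s(\mathbf{n})$, and $\mathbf{X}$ is the identity map on $\mathcal{V}^*$, so $E_Q(\mathbf{X}\cdot\mathbf{z})^2=\sum_{\mathbf{n}}Q(\mathbf{n})(\mathbf{n}\cdot\mathbf{z})^2$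 (expectation of the square, without complex conjugation). For a tree $\omega$, $f(s;\omega)$ is the number of particles of type $s$ in $\omega$ (including the root), and $\mathbf{f}(\omega)=(f(1;\omega),\ldots,f(V;\omega))$. $\xrightarrow{\mathcal{D}}$ is convergence in distribution. *)

(* Defs.v *)
From HB Require Import structures.
From mathcomp Require Import all_boot all_order all_algebra.
From mathcomp Require Import finmap.
From mathcomp Require Import complex.
From mathcomp Require Import all_classical all_reals all_analysis.
Import numFieldNormedType.Exports.

Set Implicit Arguments.
Unset Strict Implicit.
Unset Printing Implicit Defensive.

Import Order.TTheory GRing.Theory Num.Theory.
Local Open Scope classical_set_scope.
Local Open Scope ring_scope.

(* A positive number of types is written [V.+1]; the set of types is
   ['I_V.+1]. *)

Notation offspring V := {ffun 'I_V.+1 -> nat}.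

(* Ulam-Harris labels: [(s, j)] stands for "the j-th child of type s" (children
   of each type are numbered from 0), and a label is the path of such steps
   leading from the root, [[::]], to the particle. *)
Notation label V := (seq ('I_V.+1 * nat)).

Section FamilyTrees.
Variable V : nat.

Inductive particle (b : label V -> offspring V) : label V -> Prop :=
| particle_root : particle b [::]
| particle_child u s j :
    particle b u -> (j < b u s)%N -> particle b (rcons u (s, j)).

(* [root_type] is the type of the root and [brood u] is the offspring vector of
   the particle [u]. The normalization outside of the tree makes the coding of
   (possibly infinite) family trees unambiguous. *)
Record tree := Tree {
  root_type : 'I_V.+1;
  brood : label V -> offspring V;
  _ : forall u, ~ particle brood u -> brood u = [ffun=> 0%N]
}.

Definition trivial_tree : tree :=
  @Tree ord0 (fun=> [ffun=> 0%N]) (fun u _ => erefl).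

HB.instance Definition _ := gen_eqMixin tree.
HB.instance Definition _ := gen_choiceMixin tree.
HB.instance Definition _ := isPointed.Build tree trivial_tree.

Definition particles (w : tree) : set (label V) :=
  [set u | particle (brood w) u].

Definition particle_type (w : tree) (u : label V) : 'I_V.+1 :=
  last (root_type w) [seq x.1 | x <- u].

(* For an infinite set [fset_set] is empty, so the count has no meaning when
   there are infinitely many particles of type [s]. *)
Definition particle_count (s : 'I_V.+1) (w : tree) : nat :=
  #|` fset_set (particles w `&` [set u | particle_type w u = s]) |%fset.

Definition tree_cylinders : set (set tree) :=
  [set A | (exists s, A = [set w | root_type w = s]) \/
           (exists u n, A = [set w | brood w u = n])].

End FamilyTrees.

Notation measurable_tree V := (g_sigma_algebraType (@tree_cylinders V)).

Section ComplexValues.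
Variable R : realType.
Local Open Scope complex_scope.

Definition cexp (z : R[i]) : R[i] :=
  (expR (complex.Re z) * cos (complex.Im z)) +i*
  (expR (complex.Re z) * sin (complex.Im z)).

Definition cexpectation d (T : measurableType d) (P : probability T R)
    (X : T -> R[i]) : R[i] :=
  (\int[P]_w complex.Re (X w)) +i* (\int[P]_w complex.Im (X w)).

Definition charfun d (T : measurableType d) (P : probability T R)
    (X : T -> R) (t : R) : R[i] :=
  cexpectation P (fun w => cexp (0 +i* (t * X w))).

(* Sums of absolutely summable families. *)
Definition rsum (I : choiceType) (a : I -> R) : R :=
  fine (\esum_(i in setT) (Num.max (a i) 0)%:E) -
  fine (\esum_(i in setT) (Num.max (- a i) 0)%:E).

Definition csum (I : choiceType) (a : I -> R[i]) : R[i] :=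
  rsum (fun i => complex.Re (a i)) +i* rsum (fun i => complex.Im (a i)).

End ComplexValues.

Section GaltonWatson.
Variables (R : realType) (V : nat).
Local Open Scope complex_scope.

Definition is_pmf (q : offspring V -> R) : Prop :=
  (forall n, 0 <= q n) /\ (\esum_(n in setT) (q n)%:E = 1)%E.

Definition emean (p : 'I_V.+1 -> offspring V -> R) (k l : 'I_V.+1) : \bar R :=
  \esum_(n in setT) (p k n * (n l)%:R)%:E.

Definition mean_matrix (p : 'I_V.+1 -> offspring V -> R) : 'M[R]_V.+1 :=
  \matrix_(k, l) fine (emean p k l).

Definition irreducible (M : 'M[R]_V.+1) : Prop :=
  exists2 q : nat, (0 < q)%N & forall k l, 0 < (M ^+ q) k l.

(* The Perron-Frobenius eigenvalue, i.e. the eigenvalue of largest modulus, is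
   1. *)
Definition critical (M : 'M[R]_V.+1) : Prop :=
  eigenvalue (map_mx (real_complex R) M) 1 /\
  forall z : R[i], eigenvalue (map_mx (real_complex R) M) z -> `|z| <= 1.

(* A set [S] of particles of [m] that contains the parent of each of its
   elements prescribes an initial part of the family tree. That the particles
   reproduce independently, those of type [s] according to [p s], determines
   the probability of each such initial part, and these probabilities determine
   the law. *)
Definition is_GW_law (p : 'I_V.+1 -> offspring V -> R) (k : 'I_V.+1)
    (P : probability (measurable_tree V) R) : Prop :=
  forall (m : tree V) (S : seq (label V)),
    root_type m = k -> uniq S ->
    (forall u, u \in S -> particles m u) ->
    (forall u x, rcons u x \in S -> u \in S) ->
    P [set w | root_type w = k /\ forall u, u \in S -> brood w u = brood m u] =
    (\prod_(u <- S) p (particle_type m u) (brood m u))%:E.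

Definition count_vector (w : tree V) : 'rV[R]_V.+1 :=
  \row_s (particle_count s w)%:R.

Definition Qmix (p : 'I_V.+1 -> offspring V -> R) (v : 'rV[R]_V.+1)
    (n : offspring V) : R :=
  \sum_s v 0 s * p s n.

Definition Hfun (p : 'I_V.+1 -> offspring V -> R) (v : 'rV[R]_V.+1)
    (z : 'rV[R[i]]_V.+1) : R[i] :=
  csum (fun n : offspring V =>
          (Qmix p v n)%:C * (\sum_s (n s)%:R * z 0 s) ^+ 2)
  - \sum_s (v 0 s)%:C * z 0 s ^+ 2.

End GaltonWatson.

Definition independent_family (R : realType) d d' (T : measurableType d)
    (T' : measurableType d') (P : probability T R)
    (X : nat -> {mfun T >-> T'}) : Prop :=
  forall (J : seq nat) (A : nat -> set T'),
    uniq J -> (forall n, measurable (A n)) ->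
    P [set w | forall n, n \in J -> A n (X n w)] =
    (\prod_(n <- J) P (X n @^-1` A n))%E.

Definition iid (R : realType) d d' (T : measurableType d)
    (T' : measurableType d') (P : probability T R)
    (mu : probability T' R) (X : nat -> {mfun T >-> T'}) : Prop :=
  independent_family P X /\
  forall n A, measurable A -> distribution P (X n) A = mu A.

(* The random vectors may live on different probability spaces. *)
Definition cvg_in_distribution (R : realType) (m : nat) d d'
    (T : measurableType d) (T' : measurableType d')
    (P : probability T R) (P' : probability T' R)
    (X : nat -> T -> 'rV[R]_m) (Y : T' -> 'rV[R]_m) : Prop :=
  forall g : 'rV[R]_m -> R, continuous g ->
    (exists B : R, forall x, `|g x| <= B) ->
    (fun N => \int[P]_w g (X N w)) @ \oo --> \int[P']_w g (Y w).

(* Main.v *)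
(* For complex weights a_s of modulus at most 1, g_k(a) = E_k \prod_s a_s^f(s)
   satisfies the branching equation g_k(a) = a_k E_k \prod_t g_t(a)^X_t, where X
   is the offspring of the root. Take a_s = exp(- z_s / N^2) with Re z_s >= 0 and
   put h = 1 - g. Expanding the product to second order gives
     (1 - M) h = (1 - a) E(\prod g^X) - (second factorial moment form of h) / 2 + ...
   Since 1 - M is invertible on the vectors annihilated by v, h is proportional to
   u up to terms of order |h|^2 + N^-2; pairing with v kills the left-hand side and
   leaves (v.h)^2 H(u) / 2 ~ v.z / N^2. Hence N h_k tends to u_k zeta, where zeta is
   the square root of 2 (v.z) / H(u) with nonnegative real part, and
   E exp(- z.S_N) = g_k(a)^N tends to exp(- u_k zeta), where S_N is the normalized
   sum of the theorem. For z_s = - i t this is the characteristic function of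
   u_k^2 xi / H(u) at t, so the total |S_N| converges in distribution to this
   variable; for z_s = - i t (1_{s = i} - v_i) one has v.z = 0, so the deviation
   (S_N)_i - v_i |S_N| tends to 0 in probability. Slutsky's argument concludes. *)

Require Import Defs.
From HB Require Import structures.
From mathcomp Require Import all_boot all_order all_algebra.
From mathcomp Require Import finmap complex.
From mathcomp Require Import all_classical all_reals all_analysis.
From mathcomp Require Import measurable_realfun ring lra.
Import numFieldNormedType.Exports.
Import Normc.

Set Implicit Arguments.
Unset Strict Implicit.
Unset Printing Implicit Defensive.

Import Order.TTheory GRing.Theory Num.Theory.
Local Open Scope classical_set_scope.
Local Open Scope ring_scope.
Local Open Scope complex_scope.

(** * Discrete random variables *)

Section DiscreteVariables.
Context d (T : measurableType d) (R : realType).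
Implicit Types (I J : countType) (P : probability T R).

(** Only second moments are finite, so the cubic Taylor remainder is controlled by
    [E (T^2 min(1, T |h|))], with T the number of children, which tends to 0 by dominated
    convergence. The quadratic relation comes with errors that contain |h| itself: the order 1/N of
    h is extracted by a self-improving estimate, started from the mere fact that h tends to 0. The
    root of the relation is then selected by [Re (v.h) >= 0], a consequence of |g| <= 1. The law of
    a tree is given on finite initial parts only. Instead of splitting a tree into subtrees, the
    proof explores it one particle at a time; almost sure finiteness then forces solutions of the
    branching recursion in the unit disk to agree with the generating function. This yields the
    branching equation and also H(u) > 0. Tightness, required by the continuity theorem, comes from
    real z, where the transform is a Laplace transform. Offspring vectors, counts and finite lists
    of them lie in countable types, so measurability and independence are checked on fibers. *)

Definition measurable_fibers I (Y : T -> I) :=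
  forall y, measurable [set x | Y x = y].

(** A preimage is a countable union of fibers, indexed here by the codes of the values. Every
    function of such a variable is therefore measurable. *)
Lemma measurable_fibers_preimage I (Y : T -> I) (A : set I) :
  measurable_fibers Y -> measurable (Y @^-1` A).
Proof.
move=> mY; rewrite (_ : _ @^-1` _ =
   \bigcup_(n in [set n | exists y, A y /\ choice.pickle y = n])
     [set x | choice.pickle (Y x) = n]); last first.
  by apply/seteqP; split=> x /= => [Ax|[n [y [Ay <-]] /(pcan_inj choice.pickleK) ->]//];
    exists (choice.pickle (Y x)) => //; exists (Y x); split.
apply: bigcup_measurable => n [y [_ <-]].
by rewrite (_ : [set x | _] = [set x | Y x = y])//; apply/seteqP; split=> x /=
  => [/(pcan_inj choice.pickleK)|->].
Qed.

Lemma measurable_fibers_comp I J (Y : T -> I) (F : I -> J) :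
  measurable_fibers Y -> measurable_fibers (F \o Y).
Proof.
move=> mY y; exact: (measurable_fibers_preimage [set i | F i = y] mY).
Qed.

Lemma measurable_fibers_fun I d' (T' : measurableType d') (Y : T -> I)
    (F : I -> T') : measurable_fibers Y -> measurable_fun setT (F \o Y).
Proof.
move=> mY _ B _; rewrite setTI; exact: (measurable_fibers_preimage (F @^-1` B) mY).
Qed.

Lemma measurable_fibers_pair I J (Y : T -> I) (Z : T -> J) :
  measurable_fibers Y -> measurable_fibers Z ->
  measurable_fibers (fun x => (Y x, Z x)).
Proof.
move=> mY mZ [y z]; rewrite (_ : [set x | _] =
  [set x | Y x = y] `&` [set x | Z x = z]); first exact: measurableI.
by apply/seteqP; split=> x /= => [[-> ->]|[-> ->]].
Qed.

(** The domain is cut along the codes of [Y]; the integrand is constant on each piece. *)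
Lemma ge0_integral_fibers (mu : {measure set T -> \bar R}) I (Y : T -> I)
    (D : set T) (F : I -> R) :
  measurable_fibers Y -> measurable D -> (forall i, 0 <= F i) ->
  (\int[mu]_(x in D) (F (Y x))%:E =
   \esum_(i in setT) ((F i)%:E * mu (D `&` [set x | Y x = i])))%E.
Proof.
move=> mY mD F0.
pose A n := D `&` [set x | choice.pickle (Y x) = n].
have mA n : measurable (A n).
  by apply: measurableI => //; exact: (measurable_fibers_comp choice.pickle mY).
have DA : D = \bigcup_k A k.
  by apply/seteqP; split=> [x Dx|x [k _ []]]//; exists (choice.pickle (Y x)).
have a0 n : (0 <= \int[mu]_(x in A n) (F (Y x))%:E)%E.
  by apply: integral_ge0 => x _; rewrite lee_fin.
transitivity (\sum_(n <oo) \int[mu]_(x in A n) (F (Y x))%:E)%E.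
  rewrite {1}DA ge0_integral_bigcup//.
  - apply/measurable_EFinP; apply: measurable_funTS.
    exact: (measurable_fibers_fun F mY).
  - by move=> x _; rewrite lee_fin.
  - by move=> i j _ _ [x [[_ /= <-] [_ /= <-]]].
rewrite nneseries_esumT//.
(* A natural number that codes no value has an empty fiber and contributes nothing. *)
transitivity (\esum_(n in choice.pickle @` [set: I]) \int[mu]_(x in A n) (F (Y x))%:E)%E.
  rewrite [RHS]esum_mkcond; apply: eq_esum => n _.
  case: ifPn => // /negP nI; rewrite (_ : A n = set0) ?integral_set0//.
  rewrite -subset0 => x [_ /= Yn]; apply: nI; rewrite inE.
  by exists (Y x).
rewrite (esum_image setT choice.pickle); first last.
- by move=> i j _ _ /(pcan_inj choice.pickleK).
apply: eq_esum => i _.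
have AE : A (choice.pickle i) = D `&` [set x | Y x = i].
  by apply/seteqP; rewrite /A; split=> x [Dx /=] => [/(pcan_inj choice.pickleK)|->].
rewrite AE; transitivity (\int[mu]_(x in D `&` [set x | Y x = i]) (F i)%:E)%E.
  by apply: eq_integral => x /set_mem [_ /= ->].
by rewrite integral_cst//; exact: measurableI.
Qed.

Lemma bounded_integrable P (F : T -> R) (B : R) :
  measurable_fun setT F -> (forall x, `|F x| <= B) ->
  P.-integrable setT (EFin \o F).
Proof.
move=> mF FB; apply: measurable_bounded_integrable => //.
  by rewrite (le_lt_trans (@probability_le1 _ _ _ P setT measurableT))// ltry.
exists B; split; first by rewrite num_real.
by move=> x Bx y _ /=; apply: le_trans (FB y) (ltW Bx).
Qed.

(** Plays the role of conditioning on [Y]: a variable that is centred on each fiber has expectation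
    zero. *)
Lemma Rintegral_fibers0 P I (Y : T -> I) (F : T -> R) :
  measurable_fibers Y -> P.-integrable setT (EFin \o F) ->
  (forall y, \int[P]_(x in [set x | Y x = y]) F x = 0) ->
  \int[P]_x F x = 0.
Proof.
move=> mY iF F0.
pose A n := [set x | choice.pickle (Y x) = n].
have mA n : measurable (A n) by exact: (measurable_fibers_comp choice.pickle mY).
have DA : setT = \bigcup_k A k.
  by apply/seteqP; split=> x // _; exists (choice.pickle (Y x)).
rewrite /Rintegral {1}DA integral_bigcup//; last 2 first.
  - by move=> i j _ _ [x [/= <- /= <-]].
  - by rewrite -DA.
rewrite eseries0// => n _ _.
have [[y yn]|no] := pselect (exists y : I, choice.pickle y = n); last first.
  rewrite (_ : A n = set0) ?integral_set0// -subset0 => x /= xn.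
  by apply: no; exists (Y x).
have iy : P.-integrable [set x | Y x = y] (EFin \o F).
  exact: integrableS iF.
rewrite (_ : A n = [set x | Y x = y]); last first.
  by rewrite /A -yn; apply/seteqP; split=> x /= => [/(pcan_inj choice.pickleK)|->].
by rewrite -[LHS]fineK ?integrable_fin_num//; congr EFin; exact: F0.
Qed.

End DiscreteVariables.

(** On [D] the law of [Z1] is [k] times that of [Z2]. For nonnegative [psi] both sides are the same
    sum over [J]; the bounded case follows by adding a constant. *)
Lemma Rintegral_fibers_same (R : realType) d1 d2 (T1 : measurableType d1)
    (T2 : measurableType d2) (P1 : probability T1 R) (P2 : probability T2 R)
    (J : countType) (Z1 : T1 -> J) (Z2 : T2 -> J) (D : set T1) (psi : J -> R)
    (B k : R) :
  measurable_fibers Z1 -> measurable_fibers Z2 -> measurable D ->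
  (forall j, `|psi j| <= B) -> 0 <= k ->
  (forall j, P1 (D `&` [set x | Z1 x = j]) = k%:E * P2 [set x | Z2 x = j])%E ->
  \int[P1]_(x in D) psi (Z1 x) = k * \int[P2]_x psi (Z2 x).
Proof.
move=> mZ1 mZ2 mD psiB k0 PZ.
have key (phi : J -> R) C : (forall j, 0 <= phi j <= C) ->
    \int[P1]_(x in D) phi (Z1 x) = k * \int[P2]_x phi (Z2 x).
  move=> phi0C; have phi0 j : 0 <= phi j by case/andP: (phi0C j).
  have i2 : P2.-integrable setT (EFin \o (phi \o Z2)).
    apply: (@bounded_integrable _ _ _ _ _ C); first exact: measurable_fibers_fun.
    by move=> x; rewrite ger0_norm//=; case/andP: (phi0C (Z2 x)).
  rewrite -RintegralZl// /Rintegral.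
  rewrite (ge0_integral_fibers _ mZ1)// (ge0_integral_fibers _ mZ2 (F := fun j => k * phi j))//;
    last by move=> j; rewrite mulr_ge0.
  by congr fine; apply: eq_esum => j _; rewrite setTI [X in (_ * X = _)%E](PZ j) mulrC EFinM muleA.
have i1 : P1.-integrable D (EFin \o (psi \o Z1)).
  apply: (@integrableS _ _ _ _ setT) => //.
  by apply: (@bounded_integrable _ _ _ _ _ B) => [|x]; [exact: measurable_fibers_fun|exact: psiB].
have i2 : P2.-integrable setT (EFin \o (psi \o Z2)).
  by apply: (@bounded_integrable _ _ _ _ _ B) => [|x]; [exact: measurable_fibers_fun|exact: psiB].
(* The shift by [|B|] makes [psi] nonnegative; the shift itself is then removed by applying [key] to
   the constant function. *)
have psi0 j : 0 <= psi j + `|B| <= `|B| + `|B|.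
  by have := psiB j; have := ler_norm B; rewrite ler_norml; lra.
have := key _ _ psi0.
rewrite RintegralD//; last exact: finite_measure_integrable_cst.
rewrite RintegralD//; last exact: finite_measure_integrable_cst.
have -> := key (fun=> `|B|) `|B|; last by move=> j; rewrite normr_ge0 lexx.
by rewrite mulrDr => /addIr.
Qed.

(** * Complex-valued expectations *)

Section ComplexModulus.
Variable R : realType.
Implicit Types (x y z : R[i]) (a b : R).

Lemma normc_sqrtE z : normc z = Num.sqrt (complex.Re z ^+ 2 + complex.Im z ^+ 2).
Proof. by case: z. Qed.

Lemma normc_ge0 z : 0 <= normc z.
Proof. by rewrite normc_sqrtE sqrtr_ge0. Qed.

Lemma normc_sqr z : normc z ^+ 2 = complex.Re z ^+ 2 + complex.Im z ^+ 2.
Proof. by rewrite normc_sqrtE sqr_sqrtr// addr_ge0 ?sqr_ge0. Qed.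

Lemma normc_real a : normc a%:C = `|a|.
Proof. by rewrite normc_sqrtE/= expr0n addr0 sqrtr_sqr. Qed.

Lemma normc_nat n : normc n%:R = n%:R :> R.
Proof.
have -> : (n%:R : R[i]) = (n%:R : R)%:C by rewrite rmorph_nat.
by rewrite normc_real ger0_norm.
Qed.

Lemma normc1_le1 : normc (1 : R[i]) <= 1.
Proof. by rewrite normc1. Qed.

Lemma normcB x y : normc (x - y) <= normc x + normc y.
Proof. by rewrite (le_trans (le_normcD x (- y)))// (normcN y). Qed.

Lemma normc_distrC x y : normc (x - y) = normc (y - x).
Proof. by rewrite -(normcN (x - y)) opprB. Qed.

Lemma normc_sum I (r : seq I) (Q : pred I) (F : I -> R[i]) :
  normc (\sum_(i <- r | Q i) F i) <= \sum_(i <- r | Q i) normc (F i).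
Proof.
elim/big_rec2: _ => [|i x y _ xy]; first by rewrite normc0.
by rewrite (le_trans (le_normcD _ _))// lerD2l.
Qed.

Lemma normc_prod I (r : seq I) (Q : pred I) (F : I -> R[i]) :
  normc (\prod_(i <- r | Q i) F i) = \prod_(i <- r | Q i) normc (F i).
Proof. by elim/big_rec2: _ => [|i x y _ <-]; rewrite ?normc1 ?normcM. Qed.

Lemma normcX z n : normc (z ^+ n) = normc z ^+ n.
Proof. by elim: n => [|n IH]; rewrite ?expr0 ?normc1// !exprS normcM IH. Qed.

Lemma normr_Re_le z : `|complex.Re z| <= normc z.
Proof. by rewrite normc_sqrtE -sqrtr_sqr ler_wsqrtr// lerDl sqr_ge0. Qed.

Lemma normr_Im_le z : `|complex.Im z| <= normc z.
Proof. by rewrite normc_sqrtE -sqrtr_sqr ler_wsqrtr// lerDr sqr_ge0. Qed.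

Lemma normc_le_ReIm z : normc z <= `|complex.Re z| + `|complex.Im z|.
Proof.
have h : 0 <= `|complex.Re z| + `|complex.Im z| by rewrite addr_ge0.
rewrite -(ler_pXn2r (n := 2)) ?nnegrE ?normc_ge0// normc_sqr sqrrD !real_normK ?num_real//.
have := mulr_ge0 (normr_ge0 (complex.Re z)) (normr_ge0 (complex.Im z)); lra.
Qed.

Lemma complexReD x y : complex.Re (x + y) = complex.Re x + complex.Re y.
Proof. by case: x y => ? ? []. Qed.
Lemma complexImD x y : complex.Im (x + y) = complex.Im x + complex.Im y.
Proof. by case: x y => ? ? []. Qed.
Lemma complexReM x y : complex.Re (x * y) =
  complex.Re x * complex.Re y - complex.Im x * complex.Im y.
Proof. by case: x y => ? ? []. Qed.
Lemma complexImM x y : complex.Im (x * y) =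
  complex.Re x * complex.Im y + complex.Im x * complex.Re y.
Proof. by case: x y => ? ? []. Qed.
Lemma complexReN x : complex.Re (- x) = - complex.Re x.
Proof. by case: x. Qed.
Lemma complexImN x : complex.Im (- x) = - complex.Im x.
Proof. by case: x. Qed.

Lemma complex_ext x y :
  complex.Re x = complex.Re y -> complex.Im x = complex.Im y -> x = y.
Proof. by case: x y => ? ? [? ?] /= -> ->. Qed.

Lemma complexRe_sum I (r : seq I) (Q : pred I) (F : I -> R[i]) :
  complex.Re (\sum_(i <- r | Q i) F i) = \sum_(i <- r | Q i) complex.Re (F i).
Proof. by elim/big_rec2: _ => [//|i x y _ <-]; rewrite complexReD. Qed.

Lemma complexIm_sum I (r : seq I) (Q : pred I) (F : I -> R[i]) :
  complex.Im (\sum_(i <- r | Q i) F i) = \sum_(i <- r | Q i) complex.Im (F i).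
Proof. by elim/big_rec2: _ => [//|i x y _ <-]; rewrite complexImD. Qed.

Lemma cexpD x y : cexp (x + y) = cexp x * cexp y.
Proof.
case: x y => a b [a' b']; apply: complex_ext;
  rewrite ?complexReM ?complexImM /= expRD ?cosD ?sinD; ring.
Qed.

Lemma cexp0 : cexp (0 : R[i]) = 1.
Proof. by apply: complex_ext; rewrite /= expR0 ?cos0 ?sin0 ?mulr1 ?mulr0. Qed.

Lemma cexp_sum I (r : seq I) (Q : pred I) (F : I -> R[i]) :
  cexp (\sum_(i <- r | Q i) F i) = \prod_(i <- r | Q i) cexp (F i).
Proof. by elim/big_rec2: _ => [|i x y _ <-]; rewrite ?cexp0 ?cexpD. Qed.

Lemma cexpMn x n : cexp (x *+ n) = cexp x ^+ n.
Proof. by elim: n => [|n IH]; rewrite ?mulr0n ?cexp0// mulrS cexpD IH exprS. Qed.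

Lemma normc_cexp z : normc (cexp z) = expR (complex.Re z).
Proof.
case: z => a b /=; rewrite !exprMn -mulrDr cos2Dsin2 mulr1 sqrtr_sqr.
by rewrite ger0_norm// expR_ge0.
Qed.

Lemma normc_cexp_le1 z : complex.Re z <= 0 -> normc (cexp z) <= 1.
Proof. by move=> z0; rewrite normc_cexp -expR0 ler_expR. Qed.

End ComplexModulus.

Section ComplexExpectation.
Context d (T : measurableType d) (R : realType) (P : probability T R).
Implicit Types (X Y : T -> R[i]).

Definition cintegrable X :=
  P.-integrable setT (EFin \o (fun w => complex.Re (X w))) /\
  P.-integrable setT (EFin \o (fun w => complex.Im (X w))).

Lemma integrable_addr (F G : T -> R) : P.-integrable setT (EFin \o F) ->
  P.-integrable setT (EFin \o G) ->
  P.-integrable setT (EFin \o (fun w => F w + G w)).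
Proof.
by move=> iF iG; apply: eq_integrable (integrableD measurableT iF iG).
Qed.

Lemma integrable_scaler (F : T -> R) (k : R) : P.-integrable setT (EFin \o F) ->
  P.-integrable setT (EFin \o (fun w => k * F w)).
Proof. by move=> iF; apply: eq_integrable (integrableZl measurableT k iF). Qed.

Lemma cintegrableD X Y : cintegrable X -> cintegrable Y ->
  cintegrable (fun w => X w + Y w).
Proof.
by move=> [iX jX] [iY jY]; split; rewrite /=;
  [under eq_fun do rewrite complexReD|under eq_fun do rewrite complexImD]; apply: integrable_addr.
Qed.

Lemma cexpectationD X Y : cintegrable X -> cintegrable Y ->
  cexpectation P (fun w => X w + Y w) = cexpectation P X + cexpectation P Y.
Proof.
move=> [iX jX] [iY jY]; apply: complex_ext; rewrite ?complexReD ?complexImD /= -RintegralD//;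
  by apply: eq_Rintegral => w _; rewrite ?complexReD ?complexImD.
Qed.

Lemma cintegrableZ (c : R[i]) X : cintegrable X ->
  cintegrable (fun w => c * X w).
Proof.
move=> [iX jX]; split; rewrite /=;
  [under eq_fun do rewrite complexReM -mulNr|under eq_fun do rewrite complexImM];
  by apply: integrable_addr; exact: integrable_scaler.
Qed.

Lemma cexpectationZ (c : R[i]) X : cintegrable X ->
  cexpectation P (fun w => c * X w) = c * cexpectation P X.
Proof.
move=> [iX jX]; apply: complex_ext; rewrite ?complexReM ?complexImM /=.
  rewrite -!RintegralZl// -RintegralB//; do ?exact: integrable_scaler.
  by apply: eq_Rintegral => w _; rewrite complexReM.
rewrite -!RintegralZl// -RintegralD//; do ?exact: integrable_scaler.
by apply: eq_Rintegral => w _; rewrite complexImM.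
Qed.

Lemma cintegrableB X Y : cintegrable X -> cintegrable Y ->
  cintegrable (fun w => X w - Y w).
Proof.
move=> iX iY; under eq_fun do rewrite -mulN1r.
by apply: cintegrableD => //; exact: cintegrableZ.
Qed.

Lemma cexpectationB X Y : cintegrable X -> cintegrable Y ->
  cexpectation P (fun w => X w - Y w) = cexpectation P X - cexpectation P Y.
Proof.
move=> iX iY; rewrite -mulN1r -cexpectationZ// -cexpectationD//.
  by under eq_fun do rewrite -mulN1r.
exact: cintegrableZ.
Qed.

Lemma cintegrable0 : cintegrable (fun=> 0).
Proof. by split; exact: finite_measure_integrable_cst. Qed.

Lemma cintegrable_cst (c : R[i]) : cintegrable (fun=> c).
Proof. by split; exact: finite_measure_integrable_cst. Qed.

Lemma cexpectation_cst (c : R[i]) : cexpectation P (fun=> c) = c.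
Proof.
by apply: complex_ext; rewrite /= Rintegral_cst// [X in _ * fine X]probability_setT mulr1.
Qed.

Lemma cintegrable_sum I (r : seq I) (F : I -> T -> R[i]) :
  (forall i, cintegrable (F i)) -> cintegrable (fun w => \sum_(i <- r) F i w).
Proof.
move=> iF; elim: r => [|i r IH].
  by under eq_fun do rewrite big_nil; exact: cintegrable0.
by under eq_fun do rewrite big_cons; exact: cintegrableD.
Qed.

Lemma cexpectation_sum I (r : seq I) (F : I -> T -> R[i]) :
  (forall i, cintegrable (F i)) ->
  cexpectation P (fun w => \sum_(i <- r) F i w) =
  \sum_(i <- r) cexpectation P (F i).
Proof.
move=> iF; elim: r => [|i r IH].
  by under eq_fun do rewrite big_nil; rewrite big_nil cexpectation_cst.
under eq_fun do rewrite big_cons.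
by rewrite big_cons cexpectationD// ?IH//; exact: cintegrable_sum.
Qed.

(* Multiplying by the conjugate of the expectation reduces the bound to one of
   a real expectation, with no loss in the constant. *)
Lemma normc_cexpectation X (G : T -> R) : cintegrable X ->
  P.-integrable setT (EFin \o G) -> (forall w, normc (X w) <= G w) ->
  normc (cexpectation P X) <= \int[P]_w G w.
Proof.
move=> iX iG XG; set e := cexpectation P X.
have [->|e0] := eqVneq e 0.
  by rewrite normc0 Rintegral_ge0// => w _; rewrite (le_trans (normc_ge0 _) (XG w)).
have ne0 : 0 < normc e.
  by rewrite lt0r normc_ge0 andbT; apply: contra e0 => /eqP /eq0_normc ->.
rewrite -(ler_pM2l ne0) -RintegralZl//.
pose c := complex.Re e -i* complex.Im e.
have -> : normc e * normc e = complex.Re (c * e).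
  by rewrite -expr2 normc_sqr complexReM /=; ring.
rewrite /e -cexpectationZ//= -/e.
have nc : normc c = normc e by rewrite !normc_sqrtE /= sqrrN.
apply: le_Rintegral => //.
- exact: (cintegrableZ c iX).1.
- exact: integrable_scaler.
- move=> w _; apply: (le_trans (ler_norm _)); apply: (le_trans (normr_Re_le _)).
  by rewrite normcM nc ler_wpM2l// normc_ge0.
Qed.

Lemma cintegrable_bounded X (B : R) :
  measurable_fun setT (fun w => complex.Re (X w)) ->
  measurable_fun setT (fun w => complex.Im (X w)) ->
  (forall w, normc (X w) <= B) -> cintegrable X.
Proof.
move=> mR mI XB; split; apply: (@bounded_integrable _ _ _ _ _ B) => // w.
  exact: le_trans (normr_Re_le _) (XB w).
exact: le_trans (normr_Im_le _) (XB w).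
Qed.

Lemma cintegrable_dominated I (Y : T -> I) (F : I -> R[i]) (G : T -> R)
    (mY : forall A : set I, measurable (Y @^-1` A)) :
  P.-integrable setT (EFin \o G) -> (forall w, normc (F (Y w)) <= G w) ->
  cintegrable (fun w => F (Y w)).
Proof.
move=> iG FG.
have m (H : I -> R) : measurable_fun setT (H \o Y).
  by move=> _ A _; rewrite setTI; exact: (mY (H @^-1` A)).
split.
  apply: (le_integrable measurableT) iG.
    by apply/measurable_EFinP; exact: m (fun i => complex.Re (F i)).
  move=> w _; rewrite /= lee_fin (le_trans (normr_Re_le _))//.
  by rewrite (le_trans (FG w))// ler_norm.
apply: (le_integrable measurableT) iG.
  by apply/measurable_EFinP; exact: m (fun i => complex.Im (F i)).
move=> w _; rewrite /= lee_fin (le_trans (normr_Im_le _))//.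
by rewrite (le_trans (FG w))// ler_norm.
Qed.

End ComplexExpectation.

(** Lets a functional of trees that depends on finitely many broods be treated as a function of a
    countable-valued variable. Off the range of [Y] the value of [F] is the default point. *)
Lemma constant_on_fibers_factor (T I : Type) (U : pointedType) (Y : T -> I)
    (C : T -> U) : (forall w w', Y w = Y w' -> C w = C w') ->
  exists F : I -> U, forall w, C w = F (Y w).
Proof.
move=> CY; exists (fun i => xget point [set c | exists2 w, Y w = i & C w = c]).
move=> w; case: xgetP => [c _ [w' Yw' <-]|/(_ (C w))[]]; last by exists w.
exact: CY.
Qed.

Lemma complex_constant_on_fibers_factor (R : realType) (T I : Type) (Y : T -> I)
    (C : T -> R[i]) : (forall w w', Y w = Y w' -> C w = C w') ->
  exists F : I -> R[i], forall w, C w = F (Y w).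
Proof.
move=> CY.
have [F1 h1] := @constant_on_fibers_factor T I R Y (fun w => complex.Re (C w))
  (fun w w' e => congr1 _ (CY _ _ e)).
have [F2 h2] := @constant_on_fibers_factor T I R Y (fun w => complex.Im (C w))
  (fun w w' e => congr1 _ (CY _ _ e)).
by exists (fun i => F1 i +i* F2 i) => w; apply: complex_ext.
Qed.

Lemma cintegrable_fibers (R : realType) d (T : measurableType d)
    (P : probability T R) (J : countType) (Z : T -> J) (F : J -> R[i]) (B : R) :
  measurable_fibers Z -> (forall j, normc (F j) <= B) ->
  cintegrable P (fun w => F (Z w)).
Proof.
move=> mZ FB; apply: (@cintegrable_bounded _ _ _ _ _ B) => //.
  exact: (measurable_fibers_fun (fun j => complex.Re (F j))).
exact: (measurable_fibers_fun (fun j => complex.Im (F j))).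
Qed.

(** * Factorization of expectations from independence on fibers *)

Section Independence.
Context (R : realType) d1 d2 (T1 : measurableType d1) (T2 : measurableType d2).
Context (P1 : probability T1 R) (P2 : probability T2 R) (I J : countType).
Variables (Y : T1 -> I) (Z1 : T1 -> J) (Z2 : T2 -> J).
Hypotheses (mY : measurable_fibers Y) (mZ1 : measurable_fibers Z1)
  (mZ2 : measurable_fibers Z2).

(** On a fiber of [Y] the factor [C] is constant and [psi (Z1 w) - e] is centred. Independence is
    asked for only on fibers where [C] is nonzero: in the exploration, the next label has the
    offspring law of its type only if it is a particle. *)
Lemma cexpectation_indep (C : T1 -> R[i]) (psi : J -> R[i]) (B B' : R) :
  (forall w, normc (C w) <= B) -> (forall j, normc (psi j) <= B') ->
  (forall w w', Y w = Y w' -> C w = C w') ->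
  (forall w0, C w0 <> 0 -> forall j,
     (P1 ([set w | Y w = Y w0] `&` [set w | Z1 w = j]) =
      P1 [set w | Y w = Y w0] * P2 [set w | Z2 w = j])%E) ->
  cexpectation P1 (fun w => C w * psi (Z1 w)) =
  cexpectation P1 C * cexpectation P2 (fun w => psi (Z2 w)).
Proof.
move=> CB psiB CY ind.
have [F CF] := complex_constant_on_fibers_factor CY.
have iC : cintegrable P1 C.
  apply: (@cintegrable_bounded _ _ _ _ _ B) => //; under eq_fun do rewrite CF.
    exact: (measurable_fibers_fun (fun j => complex.Re (F j))).
  exact: (measurable_fibers_fun (fun j => complex.Im (F j))).
have iZ2 : cintegrable P2 (fun w => psi (Z2 w)).
  exact: cintegrable_fibers psiB.
set e := cexpectation P2 _.
have iZ1 : cintegrable P1 (fun w => C w * psi (Z1 w)).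
  have mYZ := measurable_fibers_pair mY mZ1.
  apply: (@cintegrable_bounded _ _ _ _ _ (B * B')).
  - under eq_fun do rewrite CF.
    exact: (measurable_fibers_fun (fun j => complex.Re (F j.1 * psi j.2)) mYZ).
  - under eq_fun do rewrite CF.
    exact: (measurable_fibers_fun (fun j => complex.Im (F j.1 * psi j.2)) mYZ).
  - by move=> w; rewrite normcM ler_pM ?normc_ge0.
have iD : cintegrable P1 (fun w => C w * (psi (Z1 w) - e)).
  under eq_fun do rewrite mulrBr [C _ * e]mulrC.
  by apply: cintegrableB => //; exact: cintegrableZ.
suff H : cexpectation P1 (fun w => C w * (psi (Z1 w) - e)) = 0.
  apply/eqP; rewrite -subr_eq0 mulrC -cexpectationZ//.
  rewrite -cexpectationB//; last exact: cintegrableZ.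
  by rewrite -[X in _ == X]H; apply/eqP; congr cexpectation; apply/funext => w; ring.
(* Treats the real and the imaginary part at once; only boundedness by the modulus and compatibility
   with expectations are used. *)
have fib (h : R[i] -> R) : (forall x, `|h x| <= normc x) ->
    (forall X, cintegrable P2 X -> \int[P2]_w h (X w) = h (cexpectation P2 X)) ->
    P1.-integrable setT (EFin \o (fun w => h (C w * (psi (Z1 w) - e)))) ->
    \int[P1]_w h (C w * (psi (Z1 w) - e)) = 0.
  move=> hle hE hi; apply: (Rintegral_fibers0 mY) => // y.
  have [[w0 yw0]|no] := pselect (exists w0, Y w0 = y); last first.
    rewrite (_ : [set x | _] = set0) ?Rintegral_set0// -subset0 => w /= wy.
    by apply: no; exists w.
  rewrite -yw0.
  have h0 : h 0 = 0.
    by have := hle 0; rewrite normc0 normr_le0 => /eqP.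
  rewrite (eq_Rintegral _ (g := fun w => h (C w0 * (psi (Z1 w) - e)))); last first.
    by move=> w /set_mem /= Yw; rewrite (CY w w0).
  have [->|/eqP C0] := eqVneq (C w0) 0.
    by under eq_Rintegral do rewrite mul0r h0; rewrite Rintegral_cst// mul0r.
  rewrite (@Rintegral_fibers_same _ _ _ _ _ _ P2 _ _ Z2 _
     (fun j => h (C w0 * (psi j - e))) (B * (B' + normc e)) (fine (P1 [set w | Y w = Y w0])))//.
  - rewrite (hE (fun w => C w0 * (psi (Z2 w) - e))); last first.
      by apply: cintegrableZ; apply: cintegrableB => //; exact: cintegrable_cst.
    rewrite cexpectationZ; last first.
      by apply: cintegrableB => //; exact: cintegrable_cst.
    rewrite cexpectationB//; last exact: cintegrable_cst.
    by rewrite cexpectation_cst subrr mulr0 h0 mulr0.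
  - move=> j; rewrite (le_trans (hle _))// normcM ler_pM ?normc_ge0//.
    by rewrite (le_trans (normcB _ _))// lerD2r.
  - by rewrite fine_ge0.
  - by move=> j; rewrite fineK ?ind// fin_num_measure.
apply: complex_ext.
- apply: (fib (@complex.Re R)) => //; first exact: normr_Re_le.
  exact: iD.1.
- apply: (fib (@complex.Im R)) => //; first exact: normr_Im_le.
  exact: iD.2.
Qed.

End Independence.

(** * Labels, trees and Galton-Watson laws *)

Section Labels.
Variable V : nat.
Implicit Types (b : label V -> offspring V) (u v : label V) (S : seq (label V)).

Lemma particle_rcons b u s j :
  particle b (rcons u (s, j)) <-> particle b u /\ (j < b u s)%N.
Proof.
split=> [H|[pu ju]]; last exact: particle_child.
move E: (rcons u (s, j)) H => l H; case: H E => [|u' s' j' pu' ju'].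
  by case: u.
by move=> /rcons_inj [-> -> ->].
Qed.

(** Emptying the broods outside of the tree changes no particle, since a label is a particle through
    the broods of its ancestors, which are particles themselves. *)
Lemma normalized_brood_subproof b u : let b' := fun v =>
    if `[< particle b v >] then b v else [ffun=> 0%N] in
  (particle b' u <-> particle b u) /\ (~ particle b' u -> b' u = [ffun=> 0%N]).
Proof.
move=> b'; have pb' v : particle b' v <-> particle b v.
  elim/last_ind: v => [|v [s j] IH]; first by split=> _; exact: particle_root.
  rewrite !particle_rcons; split=> -[/IH pv].
    by rewrite /b'; move: pv => /IH /IH pv; case: asboolP.
  by rewrite /b'; have /IH pv' := pv; case: asboolP.
split=> [|npu]; first exact: pb'.
by rewrite /b'; case: asboolP => // /pb'.
Qed.

Definition normalized_tree (k : 'I_V.+1) b : tree V :=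
  @Tree V k _ (fun u => (normalized_brood_subproof b u).2).

Lemma particle_normalized_tree k b u :
  particle (brood (normalized_tree k b)) u <-> particle b u.
Proof. exact: (normalized_brood_subproof b u).1. Qed.

Lemma brood_normalized_tree k b u : particle b u ->
  brood (normalized_tree k b) u = b u.
Proof. by rewrite /=; case: asboolP. Qed.

Lemma brood_outside (w : tree V) u :
  ~ particle (brood w) u -> brood w u = [ffun=> 0%N].
Proof. by case: w => r b h; exact: h. Qed.

(** Finite sets of labels containing the parents of their elements, generated one child at a time so
    that inductions follow the exploration. The labels are fixed in advance and need not be
    particles of a given tree. *)
Inductive closed_labels : seq (label V) -> Prop :=
| closed_labels_root : closed_labels [:: [::]]
| closed_labels_cons S u x : closed_labels S -> u \in S -> rcons u x \notin S ->
    closed_labels (rcons u x :: S).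

Lemma closed_labels_nil S : closed_labels S -> [::] \in S.
Proof. by elim=> [//|S' u x _ IH _ _]; rewrite inE IH orbT. Qed.

Lemma closed_labels_uniq S : closed_labels S -> uniq S.
Proof. by elim=> [//|S' u x _ IH _ n] /=; rewrite n. Qed.

Lemma closed_labels_parent S u x : closed_labels S -> rcons u x \in S -> u \in S.
Proof.
elim=> [|S' u' x' _ IH u'S _]; first by rewrite inE; case: u.
by rewrite !inE => /orP[/eqP /rcons_inj [-> _]|/IH ->]; rewrite ?u'S orbT.
Qed.

Lemma closed_labels_exist (L : seq (label V)) :
  exists2 S, closed_labels S & {subset L <= S}.
Proof.
have add S u : closed_labels S ->
    exists S', [/\ closed_labels S', {subset S <= S'} & u \in S'].
  elim/last_ind: u S => [|u x IH] S cS.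
    by exists S; split=> //; exact: closed_labels_nil.
  have [S' [cS' SS' uS']] := IH _ cS.
  have [xS|xS] := boolP (rcons u x \in S'); first by exists S'.
  exists (rcons u x :: S'); split; first exact: closed_labels_cons.
    by move=> v /SS' vS; rewrite inE vS orbT.
  by rewrite mem_head.
elim: L => [|u L [S cS LS]].
  by exists [:: [::]] => //; exact: closed_labels_root.
have [S' [cS' SS' uS']] := add S u cS.
by exists S' => // v; rewrite inE => /orP[/eqP ->//|/LS /SS'].
Qed.

(** Being a particle depends only on the broods of the ancestors, all of which lie in [S]. Agreement
    is demanded on the particles of [b] only, which suffices as the induction climbs down from the
    root. *)
Lemma particle_agree S b b' u : closed_labels S -> u \in S ->
  {in S, forall v, particle b v -> b' v = b v} ->
  particle b' u <-> particle b u.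
Proof.
move=> cS + bb'; elim/last_ind: u => [|u [s j] IH] uS.
  by split=> _; exact: particle_root.
have uS' := closed_labels_parent cS uS; have {}IH := IH uS'.
rewrite !particle_rcons; split=> -[/IH pu]; first by rewrite bb'.
by have /IH pu' := pu; rewrite bb'.
Qed.

Definition label_type (k : 'I_V.+1) u : 'I_V.+1 := last k [seq x.1 | x <- u].

Lemma label_type_rcons k u s j : label_type k (rcons u (s, j)) = s.
Proof. by rewrite /label_type map_rcons last_rcons. Qed.

End Labels.

(** * Measurability of the functionals of a tree *)

Section TreeMeasurability.
Variable V : nat.
Local Notation mtree := (measurable_tree V).

Lemma measurable_root_type s :
  measurable ([set w | root_type w = s] : set mtree).
Proof. by apply: sub_sigma_algebra; left; exists s. Qed.

Lemma measurable_fibers_brood (u : label V) :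
  measurable_fibers (fun w : mtree => brood w u).
Proof. by move=> n; apply: sub_sigma_algebra; right; exists u, n. Qed.

Lemma measurable_fibers_map d (T : measurableType d) (I : eqType) (J : countType)
    (f : I -> T -> J) (s : seq I) : (forall i, measurable_fibers (f i)) ->
  measurable_fibers (fun w => [seq f i w | i <- s]).
Proof.
move=> mf; elim: s => [|i s IH] /=.
  move=> y; have [->|yn] := eqVneq y [::].
    by rewrite (_ : [set _ | _] = setT)//; apply/seteqP; split.
  rewrite (_ : [set _ | _] = set0)//; apply/seteqP; split=> // x /= yE.
  by rewrite yE eqxx in yn.
exact: (measurable_fibers_comp (fun p => p.1 :: p.2) (measurable_fibers_pair (mf i) IH)).
Qed.

Lemma measurable_particle (u : label V) :
  measurable ([set w | particle (brood w) u] : set mtree).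
Proof.
elim/last_ind: u => [|u [s j] IH].
  rewrite (_ : [set _ | _] = setT)//; apply/seteqP; split=> // w _ /=.
  exact: particle_root.
rewrite (_ : [set _ | _] = [set w : mtree | particle (brood w) u] `&`
  (fun w : mtree => brood w u) @^-1` [set n | (j < n s)%N]).
  apply: measurableI => //.
  exact: measurable_fibers_preimage (measurable_fibers_brood u).
by apply/seteqP; split=> w /=; rewrite particle_rcons.
Qed.

(** Equality of [A w] with a given finite set is a countable intersection of membership
    conditions. *)
Lemma measurable_fibers_fset_set d (T : measurableType d) (L : countType)
    (A : T -> set L) : (forall u, measurable [set w | A w u]) ->
  measurable_fibers (fun w => fset_set (A w)).
Proof.
move=> mA.
have mE (X : {fset L}) : measurable [set w | A w = [set` X]].
  pose B i := if choice.unpickle i is Some u then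
     (if u \in X then [set w | A w u] else ~` [set w | A w u]) else setT.
  rewrite (_ : [set w | _] = \bigcap_i B i).
    apply: bigcapT_measurable => i; rewrite /B.
    case: choice.unpickle => [u|//]; case: ifPn => // _.
    exact: measurableC.
  apply/seteqP; split=> [w /= AX i _|w wB].
    rewrite /B; case: choice.unpickle => [u|//].
    by case: ifPn => uX /=; rewrite AX /= ?(negbTE uX).
  apply/seteqP; split=> u; have := wB (choice.pickle u) I;
    by rewrite /B choice.pickleK; case: ifPn => /= [->|/negbTE ->].
have mnz : forall X : {fset L}, X <> fset0 -> measurable [set w | fset_set (A w) = X].
  move=> X X0; rewrite (_ : [set w | _] = [set w | A w = [set` X]])//.
  apply/seteqP; split=> w /=; last by move=> ->; rewrite set_fsetK.
  have [fA|nfA] := pselect (finite_set (A w)).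
    by move=> <-; rewrite fset_setK.
  by rewrite /fset_set; case: pselect => // _ X0'; rewrite -X0' in X0.
(* Infinite sets are also sent to [fset0], so this fiber is obtained as the complement of all the
   others. *)
move=> X; have [->|/eqP] := eqVneq X fset0; last exact: mnz.
rewrite (_ : [set w | _] = ~` \bigcup_(i in setT) (if choice.unpickle i is Some Y
   then if Y == fset0 then set0 else [set w | fset_set (A w) = Y] else set0)).
  apply: measurableC; apply: bigcupT_measurable => i.
  case: choice.unpickle => [Y|//]; case: eqP => // Y0; exact: mnz.
apply/seteqP; split=> w /=.
  move=> wX [i _]; case: choice.unpickle => [Y|//]; case: eqP => // Y0 /=.
  by rewrite wX => /esym.
move=> h; apply: contrapT => wX; apply: h; exists (choice.pickle (fset_set (A w))) => //.
by rewrite choice.pickleK; case: eqP.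
Qed.

(** The counts are stored as an element of [offspring V], a countable type, to which the fiber
    lemmas apply. *)
Definition tree_counts (w : tree V) : offspring V := [ffun s => particle_count s w].

Lemma measurable_fibers_ffun d (T : measurableType d) (I : finType) (J : countType)
    (f : T -> {ffun I -> J}) : (forall i, measurable_fibers (fun w => f w i)) ->
  measurable_fibers f.
Proof.
move=> mf y; rewrite (_ : [set _ | _] =
   [set w | [seq f w i | i <- enum I] = [seq y i | i <- enum I]]).
  exact: (measurable_fibers_map (f := fun i w => f w i) (enum I) mf).
apply/seteqP; split=> w /=; first by move=> ->.
by move=> /eq_in_map fy; apply/ffunP => i; apply: fy; rewrite mem_enum.
Qed.

Lemma measurable_fibers_tree_counts :
  measurable_fibers (tree_counts : mtree -> offspring V).
Proof.
apply: measurable_fibers_ffun => s; under eq_fun do rewrite ffunE.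
rewrite /particle_count.
apply: (measurable_fibers_comp (fun X : {fset label V} => #|` X|)).
apply: measurable_fibers_fset_set => u.
rewrite (_ : [set _ | _] = [set w : mtree | particle (brood w) u] `&`
   \bigcup_(r in [set r | label_type r u = s]) [set w | root_type w = r]).
  apply: measurableI; first exact: measurable_particle.
  apply: fin_bigcup_measurable => [|r _]; last exact: measurable_root_type.
  exact: finite_finset.
apply/seteqP; split=> w /= [pu].
  by move=> tu; split=> //; exists (root_type w).
by move=> [r /= <- <-].
Qed.

End TreeMeasurability.

Lemma probability_setI_full d (T : measurableType d) (R : realType)
    (P : probability T R) (A B : set T) : measurable A -> measurable B ->
  P B = 1%E -> P (B `&` A) = P A.
Proof.
move=> mA mB PB; apply/eqP; rewrite eq_le le_measure ?inE//=; last exact: measurableI.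
  have PCB : P (~` B) = 0%E by rewrite probability_setC// PB subee.
  have AE : A `<=` (B `&` A) `|` ~` B by move=> x Ax; case: (pselect (B x)); [left|right].
  have mBA := measurableI _ _ mB mA; have mCB := measurableC mB.
  apply: (le_trans (le_measure P _ _ AE)); rewrite ?inE//; first exact: measurableU.
  by rewrite (le_trans (measureU2 _ _ _))//= PCB adde0.
Qed.

(** * Consequences of the Galton-Watson law for finitely many broods *)

Section GaltonWatsonLaw.
Variables (R : realType) (V : nat) (p : 'I_V.+1 -> offspring V -> R).
Variable Ptree : 'I_V.+1 -> probability (measurable_tree V) R.
Hypothesis hlaw : forall k, is_GW_law p k (Ptree k).

(** The law applied to an empty list of particles, where the product is 1. *)
Lemma GW_root_type k : Ptree k [set w | root_type w = k] = 1%E.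
Proof.
have := hlaw (m := normalized_tree k (fun=> [ffun=> 0%N])) (S := [::]) erefl erefl.
rewrite big_nil => <-//; congr (Ptree k _).
by apply/seteqP; split=> w //= [].
Qed.

Lemma measurable_brood_agree (b : label V -> offspring V) (S : seq (label V)) :
  measurable ([set w | forall v, v \in S -> brood w v = b v] : set (measurable_tree V)).
Proof.
have mS := measurable_fibers_map S (@measurable_fibers_brood V).
rewrite (_ : [set w | _] = [set w | [seq brood w v | v <- S] = [seq b v | v <- S]]).
  exact: mS.
by apply/seteqP; split=> w /= /eq_in_map.
Qed.

(** The law with the prescribing tree replaced by an arbitrary function [b], through normalization,
    and with the almost sure event on the root type removed. *)
Lemma GW_brood_agree k (b : label V -> offspring V) (S : seq (label V)) :
  uniq S -> (forall u, u \in S -> particle b u) ->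
  (forall u x, rcons u x \in S -> u \in S) ->
  Ptree k [set w | forall u, u \in S -> brood w u = b u] =
  (\prod_(u <- S) p (label_type k u) (b u))%:E.
Proof.
move=> uS pS cS; pose m := normalized_tree k b.
have mE u : u \in S -> brood m u = b u.
  by move=> /pS; exact: brood_normalized_tree.
have := hlaw (m := m) (S := S) erefl uS.
move=> /(_ (fun u uS => (particle_normalized_tree k b u).2 (pS u uS)) cS).
rewrite [in X in _ = X -> _]big_seq_cond; under eq_bigr => u /andP[uS' _] do rewrite mE//.
rewrite -big_seq_cond => <-.
rewrite -[LHS](probability_setI_full _ (measurable_root_type k) (GW_root_type k)).
  congr (Ptree k _); apply/seteqP; split=> w /= -[wk wS]; split=> // u uS'.
    by rewrite (wS _ uS'); exact/esym/mE.
  by rewrite (wS _ uS'); exact: mE.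
exact: measurable_brood_agree.
Qed.

Lemma GW_root_brood k n :
  Ptree k [set w | brood w [::] = n] = (p k n)%:E.
Proof.
have := @GW_brood_agree k (fun=> n) [:: [::]] erefl.
rewrite big_seq1 => <-.
- by congr (Ptree k _); apply/seteqP; split=> w /= => [? u|->//]; rewrite inE => /eqP ->.
- by move=> u; rewrite inE => /eqP ->; exact: particle_root.
- by case=> [|? ?] x; rewrite inE.
Qed.

(** Given the broods on [S], a new particle reproduces according to the law of its type: adding it
    to the prescribed initial part multiplies the product by one factor [p s n]. *)
Lemma GW_brood_indep k (w0 : tree V) S u s j n : closed_labels S -> u \in S ->
  rcons u (s, j) \notin S -> particle (brood w0) (rcons u (s, j)) ->
  Ptree k ([set w | [seq brood w v | v <- S] = [seq brood w0 v | v <- S]] `&`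
           [set w | brood w (rcons u (s, j)) = n]) =
  (Ptree k [set w | [seq brood w v | v <- S] = [seq brood w0 v | v <- S]] *
   Ptree s [set w | brood w [::] = n])%E.
Proof.
set l := rcons u (s, j) => cS uS lS pl.
pose S0 := [seq v <- S | `[< particle (brood w0) v >]].
have S0P v : v \in S0 <-> v \in S /\ particle (brood w0) v.
  by rewrite mem_filter; split=> [/andP[/asboolP]|[vS /asboolP ->]].
have uS0 : uniq S0 by rewrite filter_uniq// closed_labels_uniq.
have [pu ju] : particle (brood w0) u /\ (j < brood w0 u s)%N.
  by apply/particle_rcons.
have E1 : [set w | [seq brood w v | v <- S] = [seq brood w0 v | v <- S]] =
    [set w | forall v, v \in S0 -> brood w v = brood w0 v].
  apply/seteqP; split=> w /=; first by move=> /eq_in_map wS v /S0P [/wS].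
  move=> wS; apply/eq_in_map => v vS.
  have [pv|npv] := pselect (particle (brood w0) v); first by apply/wS/S0P.
  rewrite [RHS]brood_outside// brood_outside// => pv; apply: npv.
  by apply/(particle_agree cS vS (b' := brood w)) => // t tS pt; apply/wS/S0P.
(* Since [l] is not in [S], this change affects no particle of [S]. *)
pose b' v := if v == l then n else brood w0 v.
have E2 : [set w | forall v, v \in S0 -> brood w v = brood w0 v] `&`
    [set w | brood w l = n] = [set w | forall v, v \in l :: S0 -> brood w v = b' v].
  have neq v : v \in S0 -> (v == l) = false.
    by move=> /S0P [vS _]; apply: contraNF lS => /eqP <-.
  apply/seteqP; split=> w /=.
    move=> [wS wl] v; rewrite inE /b'; case: eqP => [->//|_ /=]; exact: wS.
  move=> wS; split=> [v vS0|]; last by rewrite wS ?mem_head// /b' eqxx.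
  by rewrite wS ?inE ?vS0 ?orbT// /b' neq.
have b'S v : v \in S -> b' v = brood w0 v.
  by rewrite /b'; case: eqP => // ->; rewrite (negbTE lS).
have pb' v : v \in S -> particle b' v <-> particle (brood w0) v.
  by move=> vS; apply: (particle_agree cS vS) => t tS _; exact: b'S.
have c0 v x : rcons v x \in S0 -> v \in S0.
  case: x => t i /S0P [vS /particle_rcons [pv _]]; apply/S0P; split=> //.
  exact: closed_labels_parent vS.
have uinS0 : u \in S0 by apply/S0P.
rewrite E1 E2 GW_brood_agree; first last.
- move=> v [t i]; rewrite inE => /orP[/eqP /rcons_inj [-> _]|/c0 vS0].
    by rewrite inE uinS0 orbT.
  by rewrite inE vS0 orbT.
- move=> v; rewrite inE => /orP[/eqP ->|/S0P [vS pv]]; last by apply/pb'.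
  by apply/particle_rcons; split; [apply/pb'|rewrite b'S].
- by rewrite /= uS0 andbT; apply/negP => /S0P [lS' _]; rewrite lS' in lS.
rewrite [X in (_ = X * _)%E]GW_brood_agree//; last by move=> v /S0P [].
rewrite GW_root_brood big_cons label_type_rcons /b' eqxx -EFinM mulrC.
congr ((_ * _)%:E); rewrite big_seq [RHS]big_seq; apply: eq_bigr => v /S0P [vS _].
by rewrite -/(b' v) b'S.
Qed.

End GaltonWatsonLaw.

(** * The branching equation, by exploration of the tree *)

Section Exploration.
Variables (R : realType) (V : nat) (k : 'I_V.+1).
Variables (alpha gamma : nat -> 'I_V.+1 -> R[i]).
Implicit Types (b : label V -> offspring V) (S : seq (label V)) (u v : label V).

(* [alpha] weighs the particles of [S] and [gamma] their children outside of
   [S]; both may depend on the generation and on the type. *)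
Definition label_weight S b v : R[i] :=
  alpha (size v) (label_type k v) *
  \prod_s \prod_(i < b v s | rcons v (s, val i) \notin S) gamma (size v).+1 s.

Definition explored_weight S b : R[i] :=
  \prod_(v <- S | `[< particle b v >]) label_weight S b v.

Lemma label_weight_leaf S b u : (forall x, rcons u x \notin S) ->
  label_weight S b u = alpha (size u) (label_type k u) *
    \prod_s gamma (size u).+1 s ^+ b u s.
Proof.
move=> uS; rewrite /label_weight; congr (_ * _); apply: eq_bigr => s _.
under eq_bigl do rewrite uS.
by rewrite prodr_const card_ord.
Qed.

Lemma label_weight_other S b u x v : v <> u ->
  label_weight (rcons u x :: S) b v = label_weight S b v.
Proof.
move=> vu; rewrite /label_weight; congr (_ * _); apply: eq_bigr => s _.
apply: eq_bigl => i; rewrite inE.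
by case: eqP => // /rcons_inj [].
Qed.

Lemma label_weight_parent S b u s j : rcons u (s, j) \notin S ->
  label_weight S b u = (if (j < b u s)%N then gamma (size u).+1 s else 1) *
    label_weight (rcons u (s, j) :: S) b u.
Proof.
move=> uS; rewrite /label_weight mulrCA; congr (_ * _).
rewrite (bigD1 s)//= [in RHS](bigD1 s)//= mulrA; congr (_ * _); last first.
  apply: eq_bigr => t ts; apply: eq_bigl => i; rewrite inE.
  by case: eqP => // /rcons_inj [] ts'; rewrite ts' eqxx in ts.
case: ifPn => [jb|jb].
  rewrite (bigD1 (Ordinal jb))//=; congr (_ * _); apply: eq_bigl => i.
  rewrite inE negb_or andbC; congr (_ && _); rewrite -(inj_eq val_inj) /=.
  by congr (~~ _); apply/eqP/eqP => [->//|/rcons_inj []].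
rewrite mul1r; apply: eq_bigl => i; rewrite inE.
case: eqP => // /rcons_inj [] ij; have := ltn_ord i.
by rewrite ij (negbTE jb).
Qed.

(** Exploring [l] takes its factor [gamma] away from the weight of its parent and adds the weight of
    [l] itself, all of whose children are unexplored. Everything else is collected in [C], common to
    both. *)
Lemma explored_weight_cons S b u s j : closed_labels S -> u \in S ->
  rcons u (s, j) \notin S ->
  let l := rcons u (s, j) in
  let C := \prod_(v <- S | `[< particle b v >]) label_weight (l :: S) b v in
  explored_weight (l :: S) b = (if `[< particle b l >] then
     alpha (size l) s * \prod_t gamma (size l).+1 t ^+ b l t else 1) * C /\
  explored_weight S b = (if `[< particle b l >] then gamma (size l) s else 1) * C.
Proof.
move=> cS uS lS l C; split.
  rewrite /explored_weight big_cons; case: ifP => _; last by rewrite mul1r.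
  rewrite label_weight_leaf ?label_type_rcons// => x.
  rewrite inE negb_or; apply/andP; split.
    by apply/eqP => /(congr1 size); rewrite size_rcons => /esym /n_Sn.
  by apply: contra lS; exact: closed_labels_parent.
rewrite /explored_weight /C [LHS]big_mkcond [in RHS]big_mkcond/=.
rewrite (bigD1_seq u)//=; last exact: closed_labels_uniq.
rewrite [in RHS](bigD1_seq u)//=; last exact: closed_labels_uniq.
rewrite mulrA; congr (_ * _); last first.
  apply: eq_bigr => v /eqP vu; case: ifP => // _.
  by rewrite label_weight_other.
have [pu|npu] := pselect (particle b u); last first.
  have npl : ~ particle b l by move=> /particle_rcons [].
  by rewrite (asboolF npu) (asboolF npl) mul1r.
rewrite (asboolT pu) (label_weight_parent _ lS) size_rcons.
congr (_ * _).
by case: ifPn => jb; [rewrite asboolT//|rewrite asboolF//];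
  apply/particle_rcons; rewrite ?(negbTE jb); [split|case].
Qed.

Lemma explored_weight_agree S b b' : closed_labels S ->
  {in S, forall v, b v = b' v} -> explored_weight S b = explored_weight S b'.
Proof.
move=> cS bb'; rewrite /explored_weight big_seq_cond [RHS]big_seq_cond.
rewrite (eq_bigl (fun v => (v \in S) && `[< particle b' v >])).
  by apply: eq_bigr => v /andP[vS _]; rewrite /label_weight bb'.
move=> v; case: (boolP (v \in S)) => //= vS.
by apply: asbool_equiv_eq; apply: (particle_agree cS vS) => t tS _; rewrite bb'.
Qed.

End Exploration.

Lemma normc_prod_le1 (R : realType) (I : Type) (r : seq I) (Q : pred I)
    (F : I -> R[i]) : (forall i, Q i -> normc (F i) <= 1) ->
  normc (\prod_(i <- r | Q i) F i) <= 1.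
Proof.
move=> F1; rewrite normc_prod.
suff /andP[] : 0 <= \prod_(i <- r | Q i) normc (F i) <= 1 by [].
apply: (@big_rec _ (fun x => 0 <= x <= 1)); first by rewrite ler01 lexx.
move=> i x Qi /andP[x0 x1]; rewrite mulr_ge0 ?normc_ge0//=.
by rewrite mulr_ile1 ?normc_ge0 ?F1.
Qed.

Lemma normcX_le1 (R : realType) (z : R[i]) n : normc z <= 1 -> normc (z ^+ n) <= 1.
Proof. by move=> z1; rewrite normcX exprn_ile1 ?normc_ge0. Qed.

Lemma normcM_le1 (R : realType) (x y : R[i]) :
  normc x <= 1 -> normc y <= 1 -> normc (x * y) <= 1.
Proof. by move=> x1 y1; rewrite normcM mulr_ile1 ?normc_ge0. Qed.

Section ExpectedWeight.
Variables (R : realType) (V : nat) (p : 'I_V.+1 -> offspring V -> R).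
Variable Ptree : 'I_V.+1 -> probability (measurable_tree V) R.
Hypothesis hlaw : forall k, is_GW_law p k (Ptree k).
Variables (alpha gamma : nat -> 'I_V.+1 -> R[i]).
Hypotheses (alpha1 : forall d s, normc (alpha d s) <= 1)
  (gamma1 : forall d s, normc (gamma d s) <= 1).
Hypothesis rec : forall d s, gamma d s = cexpectation (Ptree s)
  (fun w => alpha d s * \prod_t gamma d.+1 t ^+ brood w [::] t).
Variable k : 'I_V.+1.

Lemma normc_label_weight_le1 S b v : normc (label_weight k alpha gamma S b v) <= 1.
Proof.
apply: normcM_le1 => //; apply: normc_prod_le1 => s _.
exact: normc_prod_le1.
Qed.

Lemma normc_explored_weight_le1 S b : normc (explored_weight k alpha gamma S b) <= 1.
Proof. by apply: normc_prod_le1 => v _; exact: normc_label_weight_le1. Qed.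

(* Exploring one more particle replaces its factor [gamma d s] by
   [alpha d s * \prod_t gamma d.+1 t ^+ n t], [n] being its offspring; the two have
   the same conditional expectation by [rec]. *)
Lemma cexpectation_explored_weight S : closed_labels S ->
  cexpectation (Ptree k) (fun w => explored_weight k alpha gamma S (brood w)) =
  gamma 0 k.
Proof.
elim=> [|{}S u [s j] cS IH uS lS].
  rewrite rec; congr cexpectation; apply/funext => w.
  rewrite /explored_weight big_mkcond big_seq1 asboolT; last exact: particle_root.
  by rewrite label_weight_leaf// => x; rewrite inE; case: x.
rewrite -{}IH; set l := rcons u (s, j).
pose C (w : measurable_tree V) := \prod_(v <- S | `[< particle (brood w) v >])
  label_weight k alpha gamma (l :: S) (brood w) v.
(* [C1] lives where [l] is a particle, so that its brood has law [p s]; on the complement, carried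
   by [C2], the exploration changes nothing. *)
pose C1 w := if `[< particle (brood w) l >] then C w else 0.
pose C2 w := if `[< particle (brood w) l >] then 0 else C w.
pose psi (n : offspring V) := alpha (size l) s * \prod_t gamma (size l).+1 t ^+ n t.
have E1 : (fun w : measurable_tree V => explored_weight k alpha gamma (l :: S) (brood w)) =
    (fun w => C1 w * psi (brood w l) + C2 w).
  apply/funext => w.
  have [-> _] := explored_weight_cons k alpha gamma (brood w) cS uS lS.
  rewrite /C1 /C2; case: ifP => _; first by rewrite addr0 mulrC.
  by rewrite mul0r add0r mul1r.
have E2 : (fun w : measurable_tree V => explored_weight k alpha gamma S (brood w)) =
    (fun w => gamma (size l) s * C1 w + C2 w).
  apply/funext => w.
  have [_ ->] := explored_weight_cons k alpha gamma (brood w) cS uS lS.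
  rewrite /C1 /C2; case: ifP => _; first by rewrite addr0.
  by rewrite mulr0 add0r mul1r.
rewrite {}E1 {}E2.
pose Y (w : measurable_tree V) := [seq brood w v | v <- S].
have mY : measurable_fibers Y.
  exact: measurable_fibers_map S (@measurable_fibers_brood V).
have Yb w w' : Y w = Y w' -> {in S, forall v, brood w v = brood w' v}.
  by move=> /eq_in_map.
have CY w w' : Y w = Y w' -> C w = C w'.
  move=> /Yb bb'; rewrite /C big_seq_cond [RHS]big_seq_cond.
  rewrite (eq_bigl (fun v => (v \in S) && `[< particle (brood w') v >])).
    by apply: eq_bigr => v /andP[vS _]; rewrite /label_weight bb'.
  move=> v; case: (boolP (v \in S)) => //= vS.
  by apply: asbool_equiv_eq; apply: (particle_agree cS vS) => t tS _; rewrite bb'.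
have lY w w' : Y w = Y w' -> `[< particle (brood w) l >] = `[< particle (brood w') l >].
  move=> /Yb bb'; apply: asbool_equiv_eq; rewrite !particle_rcons bb'//.
  have H : particle (brood w) u <-> particle (brood w') u.
    by apply: (particle_agree cS uS) => t tS _; rewrite bb'.
  by split=> -[/H].
have nC w : normc (C w) <= 1.
  by apply: normc_prod_le1 => v _; exact: normc_label_weight_le1.
have nC1 w : normc (C1 w) <= 1 by rewrite /C1; case: ifP; rewrite ?normc0.
have nC2 w : normc (C2 w) <= 1 by rewrite /C2; case: ifP; rewrite ?normc0.
have C1Y w w' : Y w = Y w' -> C1 w = C1 w'.
  by move=> Yw; rewrite /C1 (lY _ _ Yw) (CY _ _ Yw).
have C2Y w w' : Y w = Y w' -> C2 w = C2 w'.
  by move=> Yw; rewrite /C2 (lY _ _ Yw) (CY _ _ Yw).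
have npsi n : normc (psi n) <= 1.
  by apply: normcM_le1 => //; apply: normc_prod_le1 => t _; exact: normcX_le1.
have integ (D : measurable_tree V -> R[i]) : (forall w w', Y w = Y w' -> D w = D w') ->
    (forall w, normc (D w) <= 1) -> cintegrable (Ptree k) D.
  move=> DY D1; have [F DF] := complex_constant_on_fibers_factor DY.
  apply: (@cintegrable_bounded _ _ _ _ _ 1) => //; under eq_fun do rewrite DF.
    exact: (measurable_fibers_fun (fun j => complex.Re (F j))).
  exact: (measurable_fibers_fun (fun j => complex.Im (F j))).
have iC1 := integ _ C1Y nC1; have iC2 := integ _ C2Y nC2.
have iC1psi : cintegrable (Ptree k) (fun w => C1 w * psi (brood w l)).
  have [F DF] := complex_constant_on_fibers_factor C1Y.
  under eq_fun do rewrite DF.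
  have mYl := measurable_fibers_pair mY (@measurable_fibers_brood V l).
  apply: (@cintegrable_bounded _ _ _ _ _ 1) => //.
  - exact: (measurable_fibers_fun (fun j => complex.Re (F j.1 * psi j.2)) mYl).
  - exact: (measurable_fibers_fun (fun j => complex.Im (F j.1 * psi j.2)) mYl).
  - by move=> w; rewrite -DF normcM_le1.
rewrite !cexpectationD//; last exact: cintegrableZ.
(* [rec] turns [gamma (size l) s] into the expectation of [psi] of a root brood under [Ptree s], the
   form in which independence applies. *)
rewrite cexpectationZ//; congr (_ + _); rewrite [RHS]mulrC rec.
apply: (cexpectation_indep mY (measurable_fibers_brood l) (measurable_fibers_brood [::])
  nC1 npsi C1Y) => w0 C1w0 n.
apply: (GW_brood_indep hlaw) => //.
by apply: contrapT => npl; apply: C1w0; rewrite /C1 asboolF.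
Qed.

End ExpectedWeight.

Lemma Rintegral_dominated_cvg d (T : measurableType d) (R : realType)
    (P : probability T R) (F : nat -> T -> R) (f G : T -> R) :
  (forall n, measurable_fun setT (F n)) -> measurable_fun setT f ->
  {ae P, forall w, F ^~ w @ \oo --> f w} ->
  P.-integrable setT (EFin \o G) -> (forall n w, `|F n w| <= G w) ->
  (fun n => \int[P]_w F n w) @ \oo --> \int[P]_w f w.
Proof.
move=> mF mf Ff iG FG.
have [|||||/= i1 _ i2] := @dominated_convergence _ _ _ P setT measurableT
  (fun n => EFin \o F n) (EFin \o f) (EFin \o G).
- by move=> n; exact/measurable_EFinP.
- exact/measurable_EFinP.
- by apply: filterS Ff => w Fw _; apply: cvg_EFin; [exact: nearW|exact: Fw].
- exact: iG.
- by apply: aeW => w n _; rewrite /= lee_fin.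
- apply: fine_cvg; rewrite fineK//; exact: integrable_fin_num i1.
Qed.

Lemma Rintegral_bounded_cvg0 d (T : measurableType d) (R : realType)
    (P : probability T R) (F : nat -> T -> R) (B : R) :
  (forall n, measurable_fun setT (F n)) ->
  {ae P, forall w, F ^~ w @ \oo --> 0} -> (forall n w, `|F n w| <= B) ->
  (fun n => \int[P]_w F n w) @ \oo --> 0.
Proof.
move=> mF F0 FB.
have -> : (0 : R) = \int[P]_w (cst 0 w) by rewrite Rintegral_cst// mul0r.
apply: Rintegral_dominated_cvg (FB) => //.
exact: finite_measure_integrable_cst.
Qed.

Lemma ae_root_type_eq (R : realType) (V : nat) (p : 'I_V.+1 -> offspring V -> R)
    (Ptree : 'I_V.+1 -> probability (measurable_tree V) R) :
  (forall k, is_GW_law p k (Ptree k)) ->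
  forall k, {ae Ptree k, forall w, root_type w = k}.
Proof.
move=> hlaw k; exists (~` [set w | root_type w = k]); split=> //.
  by apply: measurableC; exact: measurable_root_type.
have := GW_root_type hlaw k => P1.
by rewrite probability_setC ?P1 ?subee//; exact: measurable_root_type.
Qed.

Section FiniteTrees.
Variables (R : realType) (V : nat) (k : 'I_V.+1).
Variables (alpha gamma : nat -> 'I_V.+1 -> R[i]) (a : 'I_V.+1 -> R[i]).

(** Once [S] contains the whole tree, no child is unexplored: all factors [gamma] disappear and the
    factors [a] group by type. *)
Lemma explored_weight_finite (S : seq (label V)) (w : tree V) n :
  root_type w = k -> closed_labels S ->
  (forall u, particle (brood w) u -> u \in S /\ (size u < n)%N) ->
  (forall d, (d < n)%N -> alpha d = a) ->
  explored_weight k alpha gamma S (brood w) = \prod_s a s ^+ particle_count s w.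
Proof.
move=> wk cS pS an; rewrite /explored_weight.
transitivity (\prod_(v <- S | `[< particle (brood w) v >]) a (label_type k v)).
  apply: eq_bigr => v /asboolP pv; have [vS vn] := pS _ pv.
  rewrite /label_weight an// big1 ?mulr1// => s _; rewrite big1// => i.
  by have [-> _] := pS _ (particle_child pv (ltn_ord i)).
rewrite (partition_big (label_type k) xpredT)//=; apply: eq_bigr => s _.
rewrite (eq_bigr (fun=> a s)); last by move=> v /andP[_ /eqP ->].
rewrite big_const_seq iter_mulr_1 /particle_count; congr (_ ^+ _).
set A := particles w `&` _.
have AE : A = [set` [fset v in [seq v <- S | `[< particle (brood w) v >] &&
    (label_type k v == s)]]%fset].
  apply/seteqP; split=> v /=.
    rewrite /A /= /particle_type wk => -[pv tv]; have [vS _] := pS _ pv.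
    rewrite in_fset/= mem_filter vS andbT asboolT//=.
    by rewrite -tv /label_type eqxx.
  rewrite in_fset/= mem_filter => /andP[/andP[/asboolP pv /eqP tv] _].
  by split=> //=; rewrite /particle_type wk.
rewrite AE set_fsetK card_fseq undup_id ?filter_uniq ?closed_labels_uniq//.
by rewrite size_filter.
Qed.

End FiniteTrees.

(** * Exhausting a finite tree by exploration *)

Section ExplorationLimit.
Variables (R : realType) (V : nat) (p : 'I_V.+1 -> offspring V -> R).
Variable Ptree : 'I_V.+1 -> probability (measurable_tree V) R.
Hypothesis hlaw : forall k, is_GW_law p k (Ptree k).
Hypothesis hfin : forall k, {ae Ptree k, forall w, finite_set (particles w)}.
Variables (alpha gamma : nat -> nat -> 'I_V.+1 -> R[i]) (a : 'I_V.+1 -> R[i]).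
Hypotheses (alpha1 : forall n d s, normc (alpha n d s) <= 1)
  (gamma1 : forall n d s, normc (gamma n d s) <= 1)
  (a1 : forall s, normc (a s) <= 1).
Hypothesis rec : forall n d s, gamma n d s = cexpectation (Ptree s)
  (fun w => alpha n d s * \prod_t gamma n d.+1 t ^+ brood w [::] t).
Hypothesis alpha_a : forall n d, (d < n)%N -> alpha n d = a.

(** The explored weight has expectation [gamma n 0 k] for each closed set. On a finite tree it
    eventually equals the product of the [a s] over all particles, and bounded convergence
    applies. *)
Lemma exploration_limit k :
  (fun n => normc (gamma n 0 k - cexpectation (Ptree k)
     (fun w => \prod_s a s ^+ particle_count s w))) @ \oo --> 0.
Proof.
(* [S n] is a closed set containing the first [n] labels in the enumeration of all labels. *)
have /choice [S /all_and2[cS SL]] : forall n, exists S, closed_labels S /\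
    {subset pmap (@choice.unpickle (label V)) (iota 0 n) <= S}.
  by move=> n; have [S cS SL] := closed_labels_exist
    (pmap (@choice.unpickle (label V)) (iota 0 n)); exists S.
pose X n (w : measurable_tree V) := explored_weight k (alpha n) (gamma n) (S n) (brood w).
pose Z (w : measurable_tree V) := \prod_s a s ^+ particle_count s w.
have Y n := measurable_fibers_pair (measurable_fibers_map (S n) (@measurable_fibers_brood V))
  (@measurable_fibers_tree_counts V).
have [F FE] : exists F : nat -> seq (offspring V) -> R[i],
    forall n w, X n w = F n [seq brood w v | v <- S n].
  have /choice [F FE] : forall n, exists F : seq (offspring V) -> R[i],
      forall w, X n w = F [seq brood w v | v <- S n].
    move=> n; apply: (@complex_constant_on_fibers_factor _ _ _
      (fun w : tree V => [seq brood w v | v <- S n])) => w w' /eq_in_map ww'.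
    exact: explored_weight_agree.
  by exists F.
pose G (c : offspring V) : R[i] := \prod_s a s ^+ c s.
have GE w : Z w = G (tree_counts w).
  by apply: eq_bigr => s _; rewrite ffunE.
have nX n w : normc (X n w) <= 1 by exact: normc_explored_weight_le1.
have nZ w : normc (Z w) <= 1 by apply: normc_prod_le1 => s _; exact: normcX_le1.
have iX n : cintegrable (Ptree k) (X n).
  apply: (@cintegrable_bounded _ _ _ _ _ 1) => //; under eq_fun do rewrite FE.
    exact: (measurable_fibers_fun (fun j => complex.Re (F n j.1)) (Y n)).
  exact: (measurable_fibers_fun (fun j => complex.Im (F n j.1)) (Y n)).
have iZ : cintegrable (Ptree k) Z.
  apply: (@cintegrable_bounded _ _ _ _ _ 1) => //; under eq_fun do rewrite GE.
    exact: (measurable_fibers_fun (fun j => complex.Re (G j)) (@measurable_fibers_tree_counts V)).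
  exact: (measurable_fibers_fun (fun j => complex.Im (G j)) (@measurable_fibers_tree_counts V)).
have mXZ n : measurable_fun setT (fun w => normc (X n w - Z w)).
  under eq_fun do rewrite FE GE.
  exact: (measurable_fibers_fun (fun j => normc (F n j.1 - G j.2)) (Y n)).
have bXZ n w : `|normc (X n w - Z w)| <= 2.
  rewrite ger0_norm ?normc_ge0// (le_trans (normcB _ _))//.
  by have := nX n w; have := nZ w; lra.
apply: (@squeeze_cvgr _ _ _ _ (cst 0) (fun n => \int[Ptree k]_w normc (X n w - Z w))).
- apply: nearW => n; rewrite normc_ge0/=.
  rewrite -(cexpectation_explored_weight hlaw (alpha1 n) (gamma1 n) (rec n) k (cS n)).
  rewrite -/(X n) -/Z -cexpectationB//; apply: normc_cexpectation => //.
    exact: cintegrableB.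
  exact: bounded_integrable (mXZ n) (bXZ n).
- exact: cvg_cst.
apply: (@Rintegral_bounded_cvg0 _ _ _ _ _ 2) => //.
apply: (@filterS2 _ _ (ae_filter_ringOfSetsType (Ptree k)) _ _ _ _
  (ae_root_type_eq hlaw k) (hfin k)) => w wk fw.
(* The bound on the codes puts the tree inside [S n]; the bound on the lengths keeps it in the
   generations where [alpha n] is [a]. *)
have [n0 n0P] : exists n0, forall u, particle (brood w) u ->
    (choice.pickle u < n0)%N /\ (size u < n0)%N.
  have [X0 /= X0P] := finite_fsetP.1 fw.
  exists (\max_(u <- X0) (maxn (choice.pickle u) (size u)).+1)%N => u pu.
  have uX : u \in X0 by have : particles w u := pu; rewrite X0P.
  have := @leq_bigmax_seq _ (enum_fset X0) xpredT (fun u => (maxn (choice.pickle u) (size u)).+1) u uX isT.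
  move=> h; split; apply: leq_trans h; rewrite ltnS; [exact: leq_maxl|exact: leq_maxr].
apply: cvg_near_cst; exists n0 => // n /= n0n.
rewrite /X (@explored_weight_finite _ _ _ _ (gamma n) a (S n) w n) ?subrr ?normc0//.
  move=> u /n0P [un sn]; split; last exact: leq_trans sn n0n.
  apply: SL; rewrite mem_pmap; apply/mapP; exists (choice.pickle u).
    by rewrite mem_iota/= add0n (leq_trans un n0n).
  by rewrite choice.pickleK.
exact: alpha_a.
Qed.

End ExplorationLimit.

(** * Taylor expansion of products *)

Section ProductExpansion.
Variable R : realType.

(** Telescoping: the factors are exchanged one at a time, the others being of modulus at most 1. *)
Lemma normc_prodB (I : Type) (r : seq I) (x y : I -> R[i]) :
  (forall i, normc (x i) <= 1) -> (forall i, normc (y i) <= 1) ->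
  normc (\prod_(i <- r) x i - \prod_(i <- r) y i) <= \sum_(i <- r) normc (x i - y i).
Proof.
move=> x1 y1; elim: r => [|i r IH]; first by rewrite !big_nil subrr normc0.
rewrite !big_cons (_ : _ - _ = (x i - y i) * \prod_(j <- r) x j +
  y i * (\prod_(j <- r) x j - \prod_(j <- r) y j)); last by ring.
apply: (le_trans (le_normcD _ _)); rewrite !normcM; apply: lerD.
  by rewrite ler_piMr ?normc_ge0// normc_prod_le1.
by apply: le_trans IH; rewrite ler_piMl ?normc_ge0.
Qed.

Lemma normcXB (x y : R[i]) n : normc x <= 1 -> normc y <= 1 ->
  normc (x ^+ n - y ^+ n) <= n%:R * normc (x - y).
Proof.
move=> x1 y1; have := @normc_prodB _ (nseq n tt) (fun=> x) (fun=> y) (fun=> x1) (fun=> y1).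
by rewrite !big_nseq !iter_mulr_1 iter_addr_0 mulr_natl.
Qed.

Section Taylor.
Variables (I : Type) (w : I -> R[i]) (e : R).
Hypotheses (w1 : forall i, normc (1 - w i) <= 1) (we : forall i, normc (w i) <= e).

Let prod1 (r : seq I) : normc (\prod_(i <- r) (1 - w i)) <= 1.
Proof. exact: normc_prod_le1. Qed.

Let e0 (r : seq I) : (0 < size r)%N -> 0 <= e.
Proof. by case: r => // i r _; exact: le_trans (normc_ge0 _) (we i). Qed.

(** In this expansion and in the two of higher order, peeling off a factor [1 - w i] subtracts [w i]
    times the remainder of the preceding order on the tail; the remainder of order zero is the
    product, of modulus at most 1. *)
Lemma normc_prod_sub1 (r : seq I) :
  normc (\prod_(i <- r) (1 - w i) - 1) <= (size r)%:R * e.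
Proof.
elim: r => [|i r IH]; first by rewrite big_nil subrr normc0 mul0r.
rewrite big_cons (_ : _ - 1 = (\prod_(j <- r) (1 - w j) - 1) -
  w i * \prod_(j <- r) (1 - w j)); last by ring.
apply: (le_trans (normcB _ _)); rewrite /= -natr1 mulrDl mul1r lerD//.
by rewrite normcM (le_trans _ (we i))// ler_piMr ?normc_ge0.
Qed.

Lemma normc_prod_expand1 (r : seq I) :
  normc (\prod_(i <- r) (1 - w i) - 1 + \sum_(i <- r) w i) <= ((size r)%:R * e) ^+ 2.
Proof.
elim: r => [|i r IH]; first by rewrite !big_nil subrr addr0 normc0 sqr_ge0.
have e_ge0 : 0 <= e by apply: (e0 (r := i :: r)).
rewrite !big_cons (_ : _ - 1 + _ = (\prod_(j <- r) (1 - w j) - 1 + \sum_(j <- r) w j) -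
  w i * (\prod_(j <- r) (1 - w j) - 1)); last by ring.
apply: (le_trans (normcB _ _)); rewrite normcM.
have h : normc (w i) * normc (\prod_(j <- r) (1 - w j) - 1) <= e * ((size r)%:R * e).
  by rewrite ler_pM ?normc_ge0// normc_prod_sub1.
apply: (le_trans (lerD IH h)); rewrite /= -natr1.
have : 0 <= (size r)%:R :> R by [].
by set n := (size r)%:R => n0; nra.
Qed.

(* The second elementary symmetric function of [w], as power sums. *)
Definition second_order (r : seq I) :=
  ((\sum_(i <- r) w i) ^+ 2 - \sum_(i <- r) w i ^+ 2) / 2 : R[i].

Lemma normc_prod_expand2 (r : seq I) :
  normc (\prod_(i <- r) (1 - w i) - 1 + \sum_(i <- r) w i - second_order r) <=
  ((size r)%:R * e) ^+ 3.
Proof.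
elim: r => [|i r IH].
  by rewrite /second_order !big_nil expr0n !subrr addr0 mul0r subr0 normc0 mul0r expr0n.
have e_ge0 : 0 <= e by apply: (e0 (r := i :: r)).
rewrite /second_order !big_cons (_ : _ - _ =
  (\prod_(j <- r) (1 - w j) - 1 + \sum_(j <- r) w j - second_order r) -
  w i * (\prod_(j <- r) (1 - w j) - 1 + \sum_(j <- r) w j)); last first.
  by rewrite /second_order; field.
apply: (le_trans (normcB _ _)); rewrite normcM.
have h : normc (w i) * normc (\prod_(j <- r) (1 - w j) - 1 + \sum_(j <- r) w j) <=
    e * ((size r)%:R * e) ^+ 2.
  by rewrite ler_pM ?normc_ge0// normc_prod_expand1.
apply: (le_trans (lerD IH h)); rewrite /= -natr1.
have : 0 <= (size r)%:R :> R by [].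
set n := (size r)%:R => n0.
rewrite -subr_ge0 (_ : _ - _ = e ^+ 3 * (2 * n ^+ 2 + 3 * n + 1)); last by ring.
by rewrite mulr_ge0 ?exprn_ge0// !addr_ge0 ?mulr_ge0 ?sqr_ge0.
Qed.

Lemma normc_second_order (r : seq I) :
  normc (second_order r) <= ((size r)%:R * e) ^+ 2.
Proof.
elim: r => [|i r IH].
  by rewrite /second_order !big_nil expr0n !subrr mul0r normc0 sqr_ge0.
have e_ge0 : 0 <= e by apply: (e0 (r := i :: r)).
rewrite /second_order !big_cons (_ : _ / 2 =
  second_order r + w i * \sum_(j <- r) w j); last by rewrite /second_order; field.
apply: (le_trans (le_normcD _ _)); rewrite [X in _ + X]normcM.
have hs : normc (\sum_(j <- r) w j) <= (size r)%:R * e.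
  apply: (le_trans (normc_sum _ _ _)).
  elim: (r) => [|j r' IHr]; first by rewrite big_nil mul0r.
  by rewrite big_cons /= -natr1 mulrDl mul1r addrC lerD.
have h : normc (w i) * normc (\sum_(j <- r) w j) <= e * ((size r)%:R * e).
  by rewrite ler_pM ?normc_ge0.
apply: le_trans (lerD IH h) _; rewrite /= -natr1.
have : 0 <= (size r)%:R :> R by [].
by set n := (size r)%:R => n0; nra.
Qed.

End Taylor.
End ProductExpansion.

Section Multisets.
Variables (R : realType) (V : nat).
Implicit Types n : offspring V.

(** Lists each type with its multiplicity, so that a product of powers becomes a product over a
    list. *)
Definition multiset_seq n : seq 'I_V.+1 :=
  flatten [seq nseq (n t) t | t <- enum 'I_V.+1].

Lemma prod_multiset_seq n (F : 'I_V.+1 -> R[i]) :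
  \prod_(i <- multiset_seq n) F i = \prod_t F t ^+ n t.
Proof.
rewrite big_flatten big_map big_enum /=; apply: eq_bigr => t _.
by rewrite big_nseq iter_mulr_1.
Qed.

Lemma sum_multiset_seq (U : nmodType) n (F : 'I_V.+1 -> U) :
  \sum_(i <- multiset_seq n) F i = \sum_t F t *+ n t.
Proof.
rewrite big_flatten big_map big_enum /=; apply: eq_bigr => t _.
by rewrite big_nseq iter_addr_0.
Qed.

Lemma size_multiset_seq n : size (multiset_seq n) = (\sum_t n t)%N.
Proof.
rewrite size_flatten /shape -map_comp sumnE big_map big_enum /=.
by apply: eq_bigr => t _; rewrite /= size_nseq.
Qed.

Definition total n : R := \sum_t (n t)%:R.

Lemma total_ge0 n : 0 <= total n.
Proof. exact: sumr_ge0. Qed.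

Lemma size_multiset_seqE n : (size (multiset_seq n))%:R = total n.
Proof. by rewrite size_multiset_seq natr_sum. Qed.

(** The remainder after second order, at h = 0, of the product of the powers of [1 - h t]. *)
Definition factorial_remainder (h : 'I_V.+1 -> R[i]) n : R[i] :=
  \prod_t (1 - h t) ^+ n t - 1 + \sum_t (n t)%:R * h t -
  ((\sum_t (n t)%:R * h t) ^+ 2 - \sum_t (n t)%:R * h t ^+ 2) / 2.

(** The cubic bound is used when [total n * e <= 1]. Otherwise the first-order remainder and the
    quadratic term are bounded separately, each by [(total n * e) ^+ 2], whence the factor 2. The
    minimum keeps the bound integrable under second moments. *)
Lemma normc_factorial_remainder (h : 'I_V.+1 -> R[i]) (e : R) n :
  (forall t, normc (1 - h t) <= 1) -> (forall t, normc (h t) <= e) ->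
  normc (factorial_remainder h n) <=
  2 * (total n * e) ^+ 2 * Num.min 1 (total n * e).
Proof.
move=> h1 he; have e0 : 0 <= e by exact: le_trans (normc_ge0 _) (he ord0).
have E (F : 'I_V.+1 -> R[i]) :
    \sum_(i <- multiset_seq n) F i = \sum_t (n t)%:R * F t.
  by rewrite sum_multiset_seq; apply: eq_bigr => t _; rewrite mulr_natl.
have -> : factorial_remainder h n = \prod_(i <- multiset_seq n) (1 - h i) - 1 +
    \sum_(i <- multiset_seq n) h i - second_order h (multiset_seq n).
  by rewrite /second_order !E prod_multiset_seq.
have t0 := total_ge0 n.
have [te|te] := leP (total n * e) 1.
  have := normc_prod_expand2 h1 he (multiset_seq n).
  rewrite size_multiset_seqE => /le_trans; apply.
  by rewrite exprSr -mulrA ler_peMl ?ler1n// mulr_ge0 ?sqr_ge0 ?mulr_ge0.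
rewrite mulr1; apply: (le_trans (normcB _ _)).
rewrite mulrDl mul1r lerD//.
  by have := normc_prod_expand1 h1 he (multiset_seq n); rewrite size_multiset_seqE.
by have := normc_second_order he (multiset_seq n); rewrite size_multiset_seqE.
Qed.

Lemma normc_prod_sub1_le (h : 'I_V.+1 -> R[i]) (e : R) n :
  (forall t, normc (1 - h t) <= 1) -> (forall t, normc (h t) <= e) ->
  normc (\prod_t (1 - h t) ^+ n t - 1) <= total n * e.
Proof.
move=> h1 he; have := normc_prod_sub1 h1 he (multiset_seq n).
by rewrite size_multiset_seqE prod_multiset_seq.
Qed.

Lemma normc_prod_expand1_le (h : 'I_V.+1 -> R[i]) (e : R) n :
  (forall t, normc (1 - h t) <= 1) -> (forall t, normc (h t) <= e) ->
  normc (\prod_t (1 - h t) ^+ n t - 1 + \sum_t (n t)%:R * h t) <= (total n * e) ^+ 2.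
Proof.
move=> h1 he; have := normc_prod_expand1 h1 he (multiset_seq n).
rewrite size_multiset_seqE prod_multiset_seq sum_multiset_seq.
by under [X in _ + X]eq_bigr do rewrite -mulr_natl.
Qed.

Lemma normc_prodB_le (x y : 'I_V.+1 -> R[i]) n :
  (forall t, normc (x t) <= 1) -> (forall t, normc (y t) <= 1) ->
  normc (\prod_t x t ^+ n t - \prod_t y t ^+ n t) <=
  \sum_t (n t)%:R * normc (x t - y t).
Proof.
move=> x1 y1; have := normc_prodB (multiset_seq n) x1 y1.
rewrite !prod_multiset_seq sum_multiset_seq.
by under [X in _ <= X]eq_bigr do rewrite -mulr_natl.
Qed.

End Multisets.

Lemma cvgr_sum (R : realType) (I : Type) (r : seq I) (f : I -> nat -> R) (l : I -> R) :
  (forall i, f i @ \oo --> l i) ->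
  (fun n => \sum_(i <- r) f i n) @ \oo --> \sum_(i <- r) l i.
Proof.
move=> fl; elim: r => [|i r IH].
  rewrite big_nil; under eq_fun do rewrite big_nil; exact: cvg_cst.
by rewrite big_cons; under eq_fun do rewrite big_cons; exact: cvgD.
Qed.

Section FiniteSums.
Context (R : realType) d (T : measurableType d) (P : probability T R) (I : Type).
Variables (r : seq I) (f : I -> T -> R).
Hypothesis fi : forall i, P.-integrable setT (EFin \o f i).

Lemma integrable_sumr : P.-integrable setT (EFin \o (fun w => \sum_(i <- r) f i w)).
Proof.
have := integrable_sum measurableT r (P := xpredT) (fun i _ => fi i).
by apply: eq_integrable => // w _; rewrite /= sumEFin.
Qed.

Lemma Rintegral_sumr :
  \int[P]_w (\sum_(i <- r) f i w) = \sum_(i <- r) \int[P]_w f i w.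
Proof.
rewrite /Rintegral; under eq_integral do rewrite -sumEFin.
rewrite integral_sum// -[RHS]/(fine (_%:E)) -sumEFin; congr fine.
by apply: eq_bigr => i _; apply/esym/fineK; exact: integrable_fin_num (fi i).
Qed.
End FiniteSums.

(** * The branching equation for the generating function of the counts *)

Section BranchingEquation.
Variables (R : realType) (V : nat) (p : 'I_V.+1 -> offspring V -> R).
Hypothesis hp : forall k, is_pmf (p k).
Hypothesis hM : forall k l, (emean p k l < +oo)%E.
Variable Ptree : 'I_V.+1 -> probability (measurable_tree V) R.
Hypothesis hlaw : forall k, is_GW_law p k (Ptree k).
Local Notation M := (mean_matrix p).

Lemma integral_root_brood k (F : offspring V -> R) : (forall n, 0 <= F n) ->
  (\int[Ptree k]_w (F (brood w [::]))%:E = \esum_(n in setT) (p k n * F n)%:E)%E.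
Proof.
move=> F0; rewrite (ge0_integral_fibers _ (measurable_fibers_brood [::]))//.
apply: eq_esum => n _; rewrite setTI.
by rewrite [X in (_ * X = _)%E](GW_root_brood hlaw) -EFinM mulrC.
Qed.

Lemma integrable_root_brood k (F : offspring V -> R) : (forall n, 0 <= F n) ->
  (\esum_(n in setT) (p k n * F n)%:E < +oo)%E ->
  (Ptree k).-integrable setT (EFin \o (fun w => F (brood w [::]))).
Proof.
move=> F0 Foo; apply/integrableP; split.
  apply/measurable_EFinP.
  exact: (measurable_fibers_fun F (measurable_fibers_brood [::])).
under eq_integral do rewrite /= ger0_norm//.
by rewrite integral_root_brood.
Qed.

Lemma integrable_root_brood_le k (F G : offspring V -> R) :
  (Ptree k).-integrable setT (EFin \o (fun w => G (brood w [::]))) ->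
  (forall n, `|F n| <= G n) ->
  (Ptree k).-integrable setT (EFin \o (fun w => F (brood w [::]))).
Proof.
move=> iG FG; apply: (le_integrable measurableT) iG.
  apply/measurable_EFinP.
  exact: (measurable_fibers_fun F (measurable_fibers_brood [::])).
by move=> w _ /=; rewrite lee_fin (le_trans (FG _))// ler_norm.
Qed.

Lemma cintegrable_root_brood k (F : offspring V -> R[i]) (G : offspring V -> R) :
  (Ptree k).-integrable setT (EFin \o (fun w => G (brood w [::]))) ->
  (forall n, normc (F n) <= G n) ->
  cintegrable (Ptree k) (fun w => F (brood w [::])).
Proof.
move=> iG FG; apply: (@cintegrable_dominated _ _ _ _ _ (fun w : measurable_tree V => brood w [::])
  F (fun w => G (brood w [::])) _ iG) => // A.
exact: measurable_fibers_preimage (measurable_fibers_brood [::]).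
Qed.

Lemma integrable_mean k l :
  (Ptree k).-integrable setT (EFin \o (fun w => (brood w [::] l)%:R)).
Proof.
by apply: (@integrable_root_brood k (fun n => (n l)%:R)) => //; exact: hM.
Qed.

Lemma Rintegral_mean k l : \int[Ptree k]_w (brood w [::] l)%:R = M k l.
Proof.
by rewrite /Rintegral (@integral_root_brood k (fun n => (n l)%:R))// mxE.
Qed.

Lemma integrable_total k :
  (Ptree k).-integrable setT (EFin \o (fun w => total R (brood w [::]))).
Proof.
have : (Ptree k).-integrable setT (fun w => \sum_l ((brood w [::] l)%:R : R)%:E)%E.
  by apply: integrable_sum => // l _; exact: integrable_mean.
by apply: eq_integrable => // w _; rewrite /= /total sumEFin.
Qed.

Lemma cexpectation_mean k (h : 'I_V.+1 -> R[i]) :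
  cintegrable (Ptree k) (fun w => \sum_t (brood w [::] t)%:R * h t) /\
  cexpectation (Ptree k) (fun w => \sum_t (brood w [::] t)%:R * h t) =
  \sum_t (M k t)%:C * h t.
Proof.
have i1 t : cintegrable (Ptree k) (fun w => (brood w [::] t)%:R).
  apply: (@cintegrable_root_brood k (fun n => (n t)%:R) (fun n => (n t)%:R)).
    exact: integrable_mean.
  by move=> n; rewrite normc_nat.
have i2 t : cintegrable (Ptree k) (fun w => h t * (brood w [::] t)%:R).
  exact: cintegrableZ.
under eq_fun do under eq_bigr do rewrite mulrC.
split; first exact: cintegrable_sum.
rewrite cexpectation_sum//; apply: eq_bigr => t _.
rewrite cexpectationZ// mulrC; congr (_ * _).
rewrite -Rintegral_mean; apply: complex_ext => /=.
  apply: eq_Rintegral => w _.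
  by rewrite -[X in complex.Re X](rmorph_nat (real_complex R)).
rewrite (eq_Rintegral _ (g := cst 0)) ?Rintegral_cst ?mul0r// => w _.
by rewrite -[X in complex.Im X](rmorph_nat (real_complex R)).
Qed.

Lemma cintegrable_prod k (h : 'I_V.+1 -> R[i]) :
  (forall t, normc (h t) <= 1) ->
  cintegrable (Ptree k) (fun w => \prod_t h t ^+ brood w [::] t).
Proof.
move=> h1; apply: (@cintegrable_root_brood k (fun n => \prod_t h t ^+ n t) (fun=> 1)).
  exact: finite_measure_integrable_cst.
by move=> n; apply: normc_prod_le1 => t _; exact: normcX_le1.
Qed.

Hypothesis hfin : forall k, {ae Ptree k, forall w, finite_set (particles w)}.

Lemma normc_cexpectation_le1 d (T : measurableType d) (P : probability T R)
    (X : T -> R[i]) : cintegrable P X -> (forall w, normc (X w) <= 1) ->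
  normc (cexpectation P X) <= 1.
Proof.
move=> iX X1; have := @normc_cexpectation _ _ _ P X (fun=> 1) iX _ X1.
rewrite Rintegral_cst// [X in _ * fine X]probability_setT mul1r; apply.
exact: finite_measure_integrable_cst.
Qed.

Definition count_transform k (a : 'I_V.+1 -> R[i]) : R[i] :=
  cexpectation (Ptree k) (fun w => \prod_s a s ^+ particle_count s w).

Lemma cintegrable_count_prod k (a : 'I_V.+1 -> R[i]) : (forall s, normc (a s) <= 1) ->
  cintegrable (Ptree k) (fun w => \prod_s a s ^+ particle_count s w).
Proof.
move=> a1.
have E w : \prod_s a s ^+ particle_count s w = \prod_s a s ^+ tree_counts w s.
  by apply: eq_bigr => s _; rewrite ffunE.
under eq_fun do rewrite E.
apply: (cintegrable_fibers _ (B := 1) (F := fun c : offspring V => \prod_s a s ^+ c s)).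
  exact: measurable_fibers_tree_counts.
by move=> c; apply: normc_prod_le1 => t _; exact: normcX_le1.
Qed.

Lemma normc_count_transform k a : (forall s, normc (a s) <= 1) ->
  normc (count_transform k a) <= 1.
Proof.
move=> a1; apply: normc_cexpectation_le1; first exact: cintegrable_count_prod.
by move=> w; apply: normc_prod_le1 => s _; exact: normcX_le1.
Qed.

(* [is_GW_law] only gives the probabilities of finite initial parts of the tree.
   Exploring the tree down to generation [n], with factor 1 for the later ones,
   shows that the iterates [G n] of the one-step map tend to [count_transform],
   which is therefore a fixed point. *)
Lemma branching_equation k a : (forall s, normc (a s) <= 1) ->
  count_transform k a = a k * cexpectation (Ptree k)
    (fun w => \prod_t count_transform t a ^+ brood w [::] t).
Proof.
move=> a1.
pose step (g : 'I_V.+1 -> R[i]) s :=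
  a s * cexpectation (Ptree s) (fun w => \prod_t g t ^+ brood w [::] t).
pose G n := iter n step (fun=> 1).
have step1 g : (forall s, normc (g s) <= 1) -> forall s, normc (step g s) <= 1.
  move=> g1 s; apply: normcM_le1 => //; apply: normc_cexpectation_le1.
    exact: cintegrable_prod.
  by move=> w; apply: normc_prod_le1 => t _; exact: normcX_le1.
have G1 n s : normc (G n s) <= 1.
  by elim: n s => [|n IH] s; [exact: normc1_le1|exact: step1].
pose g s := count_transform s a.
have g1 s : normc (g s) <= 1 by exact: normc_count_transform.
have Gg s : (fun n => normc (G n s - g s)) @ \oo --> 0.
  rewrite (_ : (fun n => _) = (fun n => normc (G (n - 0)%N s - g s))); last first.
    by apply/funext => n; rewrite subn0.
  (* The weight is [a] before generation [n] and 1 afterwards. By truncated subtraction [G (n - d)]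
     is [G 0 = 1] from generation [n] on, which matches. *)
  apply: (@exploration_limit R V p Ptree hlaw hfin
    (fun n d => if (d < n)%N then a else (fun=> 1)) (fun n d => G (n - d)%N) a) => //.
  - by move=> n d t; case: ifP => // _; exact: normc1_le1.
  - move=> n d t; case: ltnP => dn.
      by rewrite subnS -[in LHS](prednK (n := n - d)) ?subn_gt0//= /step
        -cexpectationZ//; exact: cintegrable_prod.
    rewrite subnS (eqP dn) /= -[LHS](cexpectation_cst (Ptree t)).
    by congr cexpectation; apply/funext => w; rewrite mul1r big1// => s' _; rewrite expr1n.
  - by move=> n d /= ->.
(* By telescoping of products, one step is Lipschitz with the entries of the mean matrix as
   constants. *)
pose e n := \sum_t M k t * normc (G n t - g t).
have e0 : e @ \oo --> 0.
  rewrite [X in _ --> X](_ : 0 = \sum_(t < V.+1) M k t * 0); last first.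
    by rewrite big1// => t _; rewrite mulr0.
  by apply: cvgr_sum => t; apply: cvgM; [exact: cvg_cst|exact: Gg].
have stepB n : normc (G n.+1 k - step g k) <= e n.
  rewrite /= /step -mulrBr normcM -cexpectationB; try exact: cintegrable_prod.
  apply: (@le_trans _ _ (normc (cexpectation (Ptree k) (fun w =>
    \prod_t G n t ^+ brood w [::] t - \prod_t g t ^+ brood w [::] t)))).
    by rewrite ler_piMl ?normc_ge0.
  have im t : (Ptree k).-integrable setT
      (EFin \o (fun w => (brood w [::] t)%:R * normc (G n t - g t))).
    under eq_fun do rewrite mulrC.
    exact: integrable_scaler (integrable_mean k t).
  have -> : e n = \int[Ptree k]_w \sum_t (brood w [::] t)%:R * normc (G n t - g t).
    rewrite Rintegral_sumr//; apply: eq_bigr => t _.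
    by rewrite RintegralZr ?Rintegral_mean//; exact: integrable_mean.
  apply: normc_cexpectation.
  - by apply: cintegrableB; exact: cintegrable_prod.
  - exact: integrable_sumr.
  - by move=> w; exact: normc_prodB_le.
apply/eqP; rewrite -subr_eq0; apply/eqP/eq0_normc/eqP.
rewrite eq_le normc_ge0 andbT -[leRHS](addr0 0).
have h0 : (fun n => normc (G n.+1 k - g k) + e n) @ \oo --> 0 + 0.
  by apply: cvgD => //; rewrite (cvg_shiftS (fun n => normc (G n k - g k))).
apply: (ler_cvg_to (cvg_cst (normc (g k - step g k))) h0).
apply: nearW => n /=.
rewrite (_ : g k - _ = (g k - G n.+1 k) + (G n.+1 k - step g k)); last by ring.
by rewrite (le_trans (le_normcD _ _))// normc_distrC lerD2l.
Qed.

End BranchingEquation.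

(** * Second moments and Perron projection *)

Section SecondMoments.
Variables (R : realType) (V : nat) (p : 'I_V.+1 -> offspring V -> R).
Hypothesis hp : forall k, is_pmf (p k).
Hypothesis hM : forall k l, (emean p k l < +oo)%E.
Variable Ptree : 'I_V.+1 -> probability (measurable_tree V) R.
Hypothesis hlaw : forall k, is_GW_law p k (Ptree k).
Hypothesis hfin : forall k, {ae Ptree k, forall w, finite_set (particles w)}.
Variables (v u : 'rV[R]_V.+1).
Hypotheses (hv0 : forall s, 0 < v 0 s) (hu0 : forall s, 0 < u 0 s).
Hypothesis hu : mean_matrix p *m u^T = u^T.
Local Notation scal n := (\sum_s (n s)%:R * u 0 s).
Hypothesis hvar : (\esum_(n in [set: offspring V])
  (Qmix p v n * scal n ^+ 2)%:E < +oo)%E.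

Lemma esum_Qmix (F : offspring V -> R) : (forall n, 0 <= F n) ->
  (\esum_(n in [set: offspring V]) (Qmix p v n * F n)%:E =
   \sum_s \int[Ptree s]_w (v 0 s * F (brood w [::]))%:E)%E.
Proof.
move=> F0; under [RHS]eq_bigr => s _.
  rewrite (@integral_root_brood _ _ _ _ hlaw s (fun n => v 0 s * F n)).
    over.
  by move=> n; rewrite mulr_ge0// ltW.
rewrite -esum_sum; last first.
  by move=> n s _ _; rewrite lee_fin mulr_ge0 ?(hp s).1// mulr_ge0// ltW.
apply: eq_esum => n _; rewrite sumEFin; congr EFin.
by rewrite /Qmix mulr_suml; apply: eq_bigr => s _; ring.
Qed.

(** As [v 0 s] is positive, [Qmix] dominates a positive multiple of [p s]. *)
Lemma integrable_sqr_scal s :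
  (Ptree s).-integrable setT (EFin \o (fun w => scal (brood w [::]) ^+ 2)).
Proof.
have i1 : (Ptree s).-integrable setT
    (EFin \o (fun w => v 0 s * scal (brood w [::]) ^+ 2)).
  have F0 n : 0 <= v 0 s * scal n ^+ 2 by rewrite mulr_ge0 ?sqr_ge0// ltW.
  apply: (@integrable_root_brood _ _ _ _ hlaw s (fun n => v 0 s * scal n ^+ 2)) => //.
  apply: le_lt_trans hvar; apply: le_esum => n _; rewrite lee_fin.
  rewrite /Qmix mulr_suml [X in _ <= X](bigD1 s)//= mulrA [p s n * _]mulrC lerDl.
  apply: sumr_ge0 => t _.
  by rewrite mulr_ge0 ?sqr_ge0// mulr_ge0 ?(hp t).1// ltW.
have := integrable_scaler (v 0 s)^-1 i1.
apply: eq_integrable => // w _ /=; congr EFin.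
by rewrite mulrA mulVf ?mul1r// gt_eqF.
Qed.

(** Positivity of [u] makes the number of children comparable with the pairing with [u], to which
    the moment hypothesis refers. *)
Lemma total_le_scal : exists2 c : R, 0 < c & forall n : offspring V, total R n <= c * scal n.
Proof.
exists (\sum_s (u 0 s)^-1).
  rewrite (bigD1 ord0)//= ltr_pwDl ?invr_gt0// sumr_ge0// => s _.
  by rewrite invr_ge0 ltW.
move=> n; rewrite mulr_sumr; apply: ler_sum => s _.
rewrite mulrCA ler_peMr//.
rewrite mulr_suml (bigD1 s)//= mulVf ?gt_eqF// lerDl sumr_ge0// => t _.
by rewrite mulr_ge0// ?invr_ge0 ltW.
Qed.

Lemma integrable_sqr_total s :
  (Ptree s).-integrable setT (EFin \o (fun w => total R (brood w [::]) ^+ 2)).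
Proof.
have [c c0 hc] := total_le_scal.
apply: (@integrable_root_brood_le _ _ _ s (fun n => total R n ^+ 2)
  (fun n => c ^+ 2 * scal n ^+ 2)).
  exact: integrable_scaler (integrable_sqr_scal s).
move=> n; rewrite ger0_norm ?sqr_ge0// -exprMn ler_pXn2r ?nnegrE ?total_ge0//.
by rewrite (le_trans _ (hc n))// total_ge0.
Qed.

Lemma integrable_scal s :
  (Ptree s).-integrable setT (EFin \o (fun w => scal (brood w [::]))).
Proof.
apply: integrable_sumr => t; under eq_fun do rewrite mulrC.
by apply: integrable_scaler; exact: integrable_mean.
Qed.

Lemma Rintegral_scal s : \int[Ptree s]_w scal (brood w [::]) = u 0 s.
Proof.
rewrite Rintegral_sumr => [|t].
  have /matrixP/(_ s 0) := hu; rewrite !mxE => <-; apply: eq_bigr => t _.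
  rewrite RintegralZr ?(Rintegral_mean hlaw)// ?mxE//.
  exact: integrable_mean.
under eq_fun do rewrite mulrC.
by apply: integrable_scaler; exact: integrable_mean.
Qed.

Definition branching_variance : R :=
  \sum_s v 0 s * \int[Ptree s]_w (scal (brood w [::]) ^+ 2) - \sum_s v 0 s * u 0 s ^+ 2.

Lemma Hfun_branching_variance :
  Hfun p v (map_mx (real_complex R) u) = branching_variance%:C.
Proof.
have Q0 n : 0 <= Qmix p v n.
  by apply: sumr_ge0 => s _; rewrite mulr_ge0 ?(hp s).1// ltW.
have E n : (Qmix p v n)%:C * (\sum_s (n s)%:R * map_mx (real_complex R) u 0 s) ^+ 2 =
    (Qmix p v n * scal n ^+ 2)%:C.
  rewrite rmorphM rmorphXn; congr (_ * _ ^+ 2); rewrite [RHS]rmorph_sum.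
  by apply: eq_bigr => s _; rewrite mxE rmorphM rmorph_nat.
rewrite /Hfun /branching_variance rmorphB; congr (_ - _); last first.
  rewrite rmorph_sum; apply: eq_bigr => s _.
  by rewrite mxE rmorphM rmorphXn.
rewrite (funext E) /csum /rsum.
have z0 : (\esum_(n in [set: offspring V]) (Num.max (0 : R) 0)%:E = 0)%E.
  by rewrite esum1// => n _; rewrite maxxx.
apply: complex_ext => /=; last by rewrite oppr0 z0 subrr.
have -> : (\esum_(n in [set: offspring V]) (Num.max (- (Qmix p v n * scal n ^+ 2)) 0)%:E = 0)%E.
  by rewrite esum1// => n _; rewrite max_r// oppr_le0 mulr_ge0// sqr_ge0.
rewrite subr0; under eq_esum => n _ do rewrite (max_idPl (mulr_ge0 (Q0 n) (sqr_ge0 _))).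
rewrite (esum_Qmix (F := fun n => scal n ^+ 2)); last by move=> n; rewrite sqr_ge0.
rewrite (eq_bigr (fun s => (v 0 s * \int[Ptree s]_w (scal (brood w [::]) ^+ 2))%:E)).
  by rewrite sumEFin.
move=> s _; have i1 := integrable_sqr_scal s.
rewrite -RintegralZl// /Rintegral fineK//.
by apply: integrable_fin_num => //; exact: integrable_scaler.
Qed.

(** Because [u] is fixed by the mean matrix, [u 0 s] is the mean of the pairing of the offspring
    with [u]; H(u) is thus a weighted mean of variances. *)
Lemma branching_variance_sum : branching_variance =
  \sum_s v 0 s * \int[Ptree s]_w ((scal (brood w [::]) - u 0 s) ^+ 2).
Proof.
rewrite /branching_variance -sumrB; apply: eq_bigr => s _.
rewrite -mulrBr; congr (_ * _).
have i1 := integrable_sqr_scal s.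
have i2 := integrable_scaler (- (2 * u 0 s)) (integrable_scal s).
have i3 : (Ptree s).-integrable setT (EFin \o (fun=> u 0 s ^+ 2)).
  exact: finite_measure_integrable_cst.
transitivity (\int[Ptree s]_w (scal (brood w [::]) ^+ 2 +
   (- (2 * u 0 s) * scal (brood w [::]) + u 0 s ^+ 2))).
  rewrite RintegralD//; last exact: integrable_addr.
  rewrite RintegralD// RintegralZl ?integrable_scal// Rintegral_scal.
  by rewrite Rintegral_cst// [X in _ * fine X]probability_setT /=; ring.
by apply: eq_Rintegral => w _; ring.
Qed.

Lemma expRN_lipschitz (x y : R) : 0 <= x -> 0 <= y ->
  `|expR (- x) - expR (- y)| <= `|x - y|.
Proof.
wlog xy : x y / y <= x => [H x0 y0|x0 y0].
  have /orP[xy|xy] := le_total x y; last exact: H.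
  by rewrite distrC [leRHS]distrC H.
rewrite distrC ger0_norm ?subr_ge0 ?ler_expR ?lerN2// ger0_norm ?subr_ge0//.
have -> : - x = - y + - (x - y) by ring.
rewrite expRD -[X in X - _]mulr1 -mulrBr.
have h1 : expR (- y) <= 1 by rewrite -expR0 ler_expR; lra.
have h2 := expR_ge1Dx (- (x - y)).
have h3 := expR_ge0 (- y).
have h4 : expR (- (x - y)) <= 1 by rewrite -expR0 ler_expR; lra.
set a := expR _ in h1 h3 *; set b := expR _ in h2 h4 *; nra.
Qed.

Lemma scal_ge0 (n : offspring V) : 0 <= scal n.
Proof. by apply: sumr_ge0 => t _; rewrite mulr_ge0// ltW. Qed.

(* If the variance vanished, [expR (- u_s)] would be a fixed point of the
   generating functions of the offspring laws, which is excluded for finite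
   trees. *)
Lemma branching_variance_gt0 : 0 < branching_variance.
Proof.
pose w2 s := \int[Ptree s]_w ((scal (brood w [::]) - u 0 s) ^+ 2).
have w2_ge0 s : 0 <= w2 s by apply: Rintegral_ge0 => w _; exact: sqr_ge0.
have t_ge0 s : 0 <= v 0 s * w2 s by rewrite mulr_ge0// ltW.
rewrite branching_variance_sum lt0r sumr_ge0//= andbT; apply/negP.
rewrite psumr_eq0// => /allP w2_0.
have {}w2_0 s : w2 s = 0.
  have := w2_0 s (mem_index_enum s); rewrite mulf_eq0 gt_eqF//=.
  by move=> /eqP.
pose g s : R[i] := (expR (- u 0 s))%:C.
have g1 s : normc (g s) <= 1.
  by rewrite normc_real ger0_norm ?expR_ge0// -expR0 ler_expR oppr_le0 ltW.
have prodE n : \prod_t g t ^+ n t = (expR (- scal n))%:C.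
  rewrite -sumrN expR_sum rmorph_prod; apply: eq_bigr => t _.
  by rewrite -mulrN expRM_natl rmorphXn.
have iabs s : (Ptree s).-integrable setT
    (EFin \o (fun w => `|scal (brood w [::]) - u 0 s|)).
  apply: (@integrable_root_brood_le _ _ _ s (fun n => `|scal n - u 0 s|)
    (fun n => scal n + u 0 s)).
    apply: integrable_addr; first exact: integrable_scal.
    exact: finite_measure_integrable_cst.
  move=> n; rewrite normr_id; apply: (le_trans (ler_normB _ _)).
  by rewrite (ger0_norm (scal_ge0 n)) (ger0_norm (ltW (hu0 s))).
have isq s : (Ptree s).-integrable setT
    (EFin \o (fun w => (scal (brood w [::]) - u 0 s) ^+ 2)).
  apply: (@integrable_root_brood_le _ _ _ s (fun n => (scal n - u 0 s) ^+ 2)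
    (fun n => 2 * scal n ^+ 2 + 2 * u 0 s ^+ 2)).
    apply: integrable_addr; first exact: integrable_scaler (integrable_sqr_scal s).
    exact: finite_measure_integrable_cst.
  move=> n; rewrite ger0_norm ?sqr_ge0//.
  by have := sqr_ge0 (scal n + u 0 s); nra.
(* For every positive e one has [|x| <= e + x^2 / e], and the expected square vanishes. *)
have abs0 s : \int[Ptree s]_w `|scal (brood w [::]) - u 0 s| <= 0.
  apply/ler_addgt0Pl => e e0; rewrite addr0.
  apply: (@le_trans _ _ (\int[Ptree s]_w (e + e^-1 * (scal (brood w [::]) - u 0 s) ^+ 2))).
    apply: le_Rintegral => //; first exact: iabs.
      apply: integrable_addr; first exact: finite_measure_integrable_cst.
      exact: integrable_scaler.
    move=> w _; set x := _ - _; rewrite -real_normK ?num_real//; set y := `|x|.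
    have e1 : e^-1 * e = 1 by rewrite mulVf// gt_eqF.
    have ei : 0 < e^-1 by rewrite invr_gt0.
    rewrite -(ler_pM2l ei) mulrDr mulrA.
    set z := e^-1 in e1 ei *; rewrite e1 -expr2 -exprMn.
    by have := sqr_ge0 (z * y - 1); have := sqr_ge0 (z * y); nra.
  rewrite RintegralD//; last 2 first.
  - exact: finite_measure_integrable_cst.
  - exact: integrable_scaler.
  rewrite RintegralZl//; last exact: isq.
  rewrite [X in _ * X](w2_0 s) mulr0 addr0 Rintegral_cst//.
  by rewrite [X in _ * fine X]probability_setT mulr1.
have rec s : g s = cexpectation (Ptree s) (fun w => 1 * \prod_t g t ^+ brood w [::] t).
  have ip : cintegrable (Ptree s) (fun w => \prod_t g t ^+ brood w [::] t).
    exact: cintegrable_prod.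
  have i1 := cintegrable_cst (Ptree s) (g s).
  under eq_fun do rewrite mul1r.
  apply/eqP; rewrite -subr_eq0 -[X in X - _](cexpectation_cst (Ptree s)).
  rewrite -cexpectationB//; apply/eqP/eq0_normc/eqP; rewrite eq_le normc_ge0 andbT.
  apply: le_trans (abs0 s); apply: normc_cexpectation => //.
    exact: cintegrableB.
  move=> w; rewrite prodE -rmorphB normc_real distrC.
  by rewrite expRN_lipschitz ?scal_ge0// ltW.
(* With unit weights and [gamma] equal to [g] in all generations, exhausting the tree gives
   [g = E 1 = 1], against [expR (- u) < 1]. *)
have := @exploration_limit R V p Ptree hlaw hfin (fun _ _ _ => 1) (fun _ _ => g) (fun=> 1)
  (fun _ _ _ => normc1_le1 R) (fun _ _ => g1) (fun _ => normc1_le1 R) (fun _ _ => rec)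
  (fun _ _ _ => erefl) ord0.
rewrite (_ : (fun w => _) = (fun=> 1)); last first.
  by apply/funext => w; rewrite big1// => s _; rewrite expr1n.
rewrite cexpectation_cst => H.
have n0 : normc (g ord0 - 1) = 0 by apply: cvg_unique (cvg_cst _) H.
have /(congr1 (@complex.Re R)) /= /eqP : g ord0 = 1.
  by apply/eqP; rewrite -subr_eq0; apply/eqP/eq0_normc.
by rewrite lt_eqF// -expR0 ltr_expR oppr_lt0.
Qed.

End SecondMoments.

(** * Perron projection and inversion of [1 - M] on the kernel of [v] *)

Section ResolventBound.
Variables (R : realType) (V : nat) (M : 'M[R]_V.+1) (v u : 'rV[R]_V.+1).
Hypothesis hirr : irreducible M.
Hypotheses (hu0 : forall s, 0 < u 0 s).
Hypotheses (hv : v *m M = v) (hu : M *m u^T = u^T).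
Hypothesis hvu : \sum_s v 0 s * u 0 s = 1.

(* Subtracting from [x] the largest multiple of [u] that leaves a nonnegative
   vector gives a fixed vector with a zero entry, which vanishes since [M ^+ q] is
   positive. *)
Lemma Perron_simple (x : 'cV[R]_V.+1) : M *m x = x -> v *m x = 0 -> x = 0.
Proof.
move=> Mx vx; have [q q0 Mq] := hirr.
have fixq (z : 'cV[R]_V.+1) : M *m z = z -> (M ^+ q) *m z = z.
  move=> Mz; elim: q {q0 Mq} => [|q IH]; first by rewrite expr0 mul1mx.
  by rewrite exprSr -mulmxA Mz.
pose i0 := [arg min_(i < ord0) (x i 0 / u 0 i)]%O.
have i0P j : x i0 0 / u 0 i0 <= x j 0 / u 0 j.
  by rewrite /i0; case: arg_minP => // i _; exact.
set t := x i0 0 / u 0 i0 in i0P.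
pose y := x - t *: u^T.
have y0 j : 0 <= y j 0.
  by rewrite !mxE subr_ge0 -ler_pdivlMr.
have yi0 : y i0 0 = 0 by rewrite !mxE /t mulfVK ?subrr// gt_eqF.
have yj j : y j 0 = 0.
  have : ((M ^+ q) *m y) i0 0 = 0.
    by rewrite fixq// /y mulmxBr -scalemxAr Mx hu.
  rewrite mxE => /eqP; rewrite psumr_eq0; last by move=> l _; rewrite mulr_ge0// ltW.
  move=> /allP/(_ j (mem_index_enum j)); rewrite mulf_eq0 gt_eqF ?Mq//=.
  by move/eqP.
have xE : x = t *: u^T.
  by apply/eqP; rewrite -subr_eq0; apply/eqP/matrixP => i j; rewrite ord1 yj mxE.
have : (v *m x) 0 0 = t.
  rewrite xE -scalemxAr mxE mxE; under eq_bigr do rewrite mxE.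
  by rewrite hvu mulr1.
by rewrite vx mxE xE => <-; rewrite scale0r.
Qed.

(* [K] is invertible and agrees with [1 - M] on the vectors annihilated by [v]. *)
Let K := 1%:M - M + u^T *m v.

(** Pairing [K z = 0] with [v] gives [v z = 0], as [v (1 - M) = 0] and [v u^T = 1]. Then [z] is
    fixed by [M], and simplicity of the Perron eigenvalue forces it to vanish. *)
Let K_unit : K \in unitmx.
Proof.
rewrite -unitmx_tr -row_free_unit; apply: inj_row_free => z zK.
have Kz : K *m z^T = 0 by rewrite -[K]trmxK -trmx_mul zK trmx0.
suff : z^T = 0 by move=> /(congr1 trmx); rewrite trmxK trmx0.
have vz : v *m z^T = 0.
  have : v *m (K *m z^T) = 0 by rewrite Kz mulmx0.
  rewrite mulmxA /K mulmxDr mulmxBr mulmx1 hv subrr add0r mulmxA.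
  rewrite (_ : v *m u^T = 1%:M) ?mul1mx//.
  apply/matrixP => i j; rewrite !ord1 !mxE -hvu.
  by apply: eq_bigr => s _; rewrite mxE.
apply: Perron_simple => //; apply/eqP; rewrite eq_sym -subr_eq0; apply/eqP.
by rewrite -[RHS]Kz /K mulmxDl mulmxBl mul1mx -mulmxA vz mulmx0 addr0.
Qed.

Lemma resolvent_bound : exists2 C : R, 0 < C &
  forall r : 'I_V.+1 -> R[i], \sum_s (v 0 s)%:C * r s = 0 ->
  forall s, normc (r s) <= C * \sum_t normc (r t - \sum_l (M t l)%:C * r l).
Proof.
(* [K] is real, so real and imaginary parts are bounded separately, each with constant [B]; the
   extra 1 in the constant ensures positivity. *)
pose B := \sum_i \sum_j `|invmx K i j|.
have B0 : 0 <= B by apply: sumr_ge0 => i _; exact: sumr_ge0.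
exists (2 * B + 1); first by rewrite ltr_wpDl// mulr_ge0.
move=> r vr s; pose e t := r t - \sum_l (M t l)%:C * r l; set S := \sum_t _.
have S0 : 0 <= S by apply: sumr_ge0 => t _; exact: normc_ge0.
have part (f : R[i] -> R) : (forall z, `|f z| <= normc z) ->
    (forall x y, f (x + y) = f x + f y) -> (forall a x, f (a%:C * x) = a * f x) ->
    `|f (r s)| <= B * S.
  move=> fn fD fZ.
  have fsum (a : 'I_V.+1 -> R) : f (\sum_l (a l)%:C * r l) = \sum_l a l * f (r l).
    have f0 : f 0 = 0 by have := fZ 0 0; rewrite mulr0 mul0r.
    by rewrite (big_morph f fD f0); apply: eq_bigr => l _.
  pose x : 'cV[R]_V.+1 := \col_t f (r t).
  have vx : v *m x = 0.
    have f0 : f 0 = 0 by have := fZ 0 0; rewrite mulr0 mul0r.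
    apply/matrixP => i j; rewrite !ord1 [RHS]mxE -[RHS]f0 -[X in f X]vr fsum mxE.
    by apply: eq_bigr => l _; rewrite mxE.
  have xK : x = invmx K *m (x - M *m x).
    rewrite -[LHS](mulKmx K_unit); congr (_ *m _).
    by rewrite /K mulmxDl mulmxBl mul1mx -mulmxA vx mulmx0 addr0.
  have -> : f (r s) = x s 0 by rewrite mxE.
  rewrite xK mxE; apply: (le_trans (ler_norm_sum _ _ _)).
  rewrite /B mulr_suml [leRHS](bigD1 s)//=; apply: ler_wpDr.
    by apply: sumr_ge0 => i _; rewrite mulr_ge0// sumr_ge0.
  rewrite mulr_suml; apply: ler_sum => t _; rewrite normrM ler_wpM2l//.
  have -> : (x - M *m x) t 0 = f (e t).
    have fN z : f (- z) = - f z by have := fZ (-1) z; rewrite rmorphN1 !mulN1r.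
    rewrite !mxE /e fD fN fsum.
    by congr (_ - _); apply: eq_bigr => l _; rewrite mxE.
  rewrite (le_trans (fn _))// /S (bigD1 t)//= lerDl.
  by apply: sumr_ge0 => l _; exact: normc_ge0.
apply: (le_trans (normc_le_ReIm _)).
have h1 := part (@complex.Re R) (@normr_Re_le R) (@complexReD R).
have h2 := part (@complex.Im R) (@normr_Im_le R) (@complexImD R).
have -> : (2 * B + 1) * S = B * S + B * S + S by ring.
apply: (@le_trans _ _ (B * S + B * S)); last by rewrite lerDl.
apply: lerD; [apply: h1|apply: h2] => a x.
  by rewrite complexReM /= mul0r subr0.
by rewrite complexImM /= mul0r addr0.
Qed.

End ResolventBound.

(** * Asymptotics of the generating functions *)

Section ElementaryEstimates.
Variable R : realType.
Implicit Types (a b : R) (x : R[i]).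

Let sin_secant b : 0 <= b -> exists2 c, 0 <= c <= b & sin b = cos c * b.
Proof.
move=> b0; have [c + E] := @MVT_segment R sin cos 0 b b0 (fun y _ => is_derive_sin y)
  (continuous_subspaceT (@continuous_sin R)).
rewrite in_itv/= => cb; exists c => //.
by move: E; rewrite sin0 !subr0.
Qed.

Lemma normr_sin_le b : `|sin b| <= `|b|.
Proof.
wlog b0 : b / 0 <= b => [H|].
  have /orP[|b0] := le_total 0 b; first exact: H.
  by rewrite -normrN -sinN -[leRHS]normrN; apply: H; rewrite oppr_ge0.
have [c _ ->] := sin_secant b0.
by rewrite normrM ler_piMl// cos_max.
Qed.

Lemma normr_1Bcos_le b : `|1 - cos b| <= b ^+ 2 / 2.
Proof.
have -> : 1 - cos b = 2 * sin (b / 2) ^+ 2.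
  rewrite -{1}(mulfVK (_ : 2 != 0) b)// mulr_natr cos_mulr2n cos2sin2; ring.
have h := normr_sin_le (b / 2).
have : sin (b / 2) ^+ 2 <= (b / 2) ^+ 2.
  by rewrite -real_normK ?num_real// -[leRHS]real_normK ?num_real// ler_pXn2r ?nnegrE.
have h0 : 0 <= 2 * sin (b / 2) ^+ 2 by rewrite mulr_ge0// sqr_ge0.
rewrite (ger0_norm h0) => h2.
have e4 : (b / 2) ^+ 2 = b ^+ 2 / 4 by field.
by rewrite e4 in h2; lra.
Qed.

(** For small b, the secant formula reduces the difference to [b (1 - cos c)] with [c <= b]; from 2
    on, the trivial bound suffices. *)
Lemma normr_sinB_le b : `|sin b - b| <= b ^+ 2.
Proof.
wlog b0 : b / 0 <= b => [H|].
  have /orP[|b0] := le_total 0 b; first exact: H.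
  by have := H (- b); rewrite oppr_ge0 sinN sqrrN -opprD normrN; apply.
have [b2|b2] := leP 2 b.
  apply: (le_trans (ler_normB _ _)); have := normr_sin_le b.
  by rewrite (ger0_norm b0); nra.
have [c /andP[c0 cb] ->] := sin_secant b0.
rewrite (_ : _ - b = - (b * (1 - cos c))); last by ring.
rewrite normrN normrM (ger0_norm b0) expr2 ler_wpM2l//.
have h := normr_1Bcos_le c.
apply: (le_trans h); nra.
Qed.

Lemma expRN_bounds a : 0 <= a -> 1 - a <= expR (- a) <= 1 - a + a ^+ 2.
Proof.
move=> a0; rewrite expR_ge1Dx/= expRN.
have h := expR_ge1Dx a.
(* The comparison is with [1 / (1 + a)], using [(1 + a) (1 - a + a^2) = 1 + a^3]. *)
apply: (@le_trans _ _ (1 + a)^-1).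
  by rewrite lef_pV2 ?posrE ?expR_gt0//; lra.
have a1 : 0 < 1 + a by lra.
rewrite -(ler_pM2l a1) mulfV ?gt_eqF//.
rewrite (_ : _ * _ = 1 + a ^+ 3); last by ring.
by rewrite lerDl exprn_ge0.
Qed.

Lemma normc_1Bcexp_le x : 0 <= complex.Re x -> normc (1 - cexp (- x)) <= 3 * normc x.
Proof.
case: x => a b a0; apply: (le_trans (normc_le_ReIm _)); rewrite /= in a0 *.
have ha := normr_Re_le (a +i* b); have hb := normr_Im_le (a +i* b).
rewrite /= in ha hb; set N := Num.sqrt _ in ha hb *.
rewrite cosN sinN.
have /andP[e1 e2] := expRN_bounds a0.
have e3 : expR (- a) <= 1 by rewrite -expR0 ler_expR; lra.
have e4 := expR_ge0 (- a).
set e := expR (- a) in e1 e2 e3 e4 *.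
have hs := normr_sin_le b.
have hc : `|1 - cos b| <= `|b|.
  have [b2|b2] := leP `|b| 2.
    apply: (le_trans (normr_1Bcos_le b)).
    by rewrite -real_normK ?num_real//; have := normr_ge0 b; nra.
  apply: (le_trans (ler_normB _ _)); rewrite normr1.
  by have := cos_max b; lra.
have h1 : `|1 - e * cos b| <= a + `|b|.
  rewrite (_ : 1 - _ = (1 - e) + e * (1 - cos b)); last by ring.
  apply: (le_trans (ler_normD _ _)); apply: lerD.
    by rewrite ger0_norm; lra.
  by rewrite normrM ger0_norm// (le_trans _ hc)// ler_piMl.
have h2 : `|0 - e * - sin b| <= `|b|.
  by rewrite sub0r mulrN opprK normrM ger0_norm// (le_trans _ hs)// ler_piMl.
rewrite ger0_norm// in ha; lra.
Qed.

Lemma normc_1BcexpB_le x : 0 <= complex.Re x ->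
  normc (1 - cexp (- x) - x) <= 4 * normc x ^+ 2.
Proof.
case: x => a b a0; apply: (le_trans (normc_le_ReIm _)); rewrite /= in a0 *.
have h2 : Num.sqrt (a ^+ 2 + b ^+ 2) ^+ 2 = a ^+ 2 + b ^+ 2.
  by rewrite sqr_sqrtr// addr_ge0 ?sqr_ge0.
rewrite h2 cosN sinN.
have /andP[e1 e2] := expRN_bounds a0.
have e3 : expR (- a) <= 1 by rewrite -expR0 ler_expR; lra.
have e4 := expR_ge0 (- a).
set e := expR (- a) in e1 e2 e3 e4 *.
have hs := normr_sin_le b; have hc := normr_1Bcos_le b.
have hsb := normr_sinB_le b.
have b2 : `|b| ^+ 2 = b ^+ 2 by rewrite real_normK ?num_real.
have k1 : `|1 - e * cos b - a| <= a ^+ 2 + b ^+ 2 / 2.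
  rewrite (_ : _ - a = (1 - a - e) + e * (1 - cos b)); last by ring.
  apply: (le_trans (ler_normD _ _)); apply: lerD.
    by rewrite ler0_norm; lra.
  by rewrite normrM ger0_norm// (le_trans _ hc)// ler_piMl.
have k2 : `|0 - e * - sin b - b| <= a * `|b| + b ^+ 2.
  rewrite (_ : _ - b = (e - 1) * sin b + (sin b - b)); last by ring.
  apply: (le_trans (ler_normD _ _)); apply: lerD => //.
  by rewrite normrM ler_pM// ler0_norm; lra.
have := sqr_ge0 (a - `|b|); have := sqr_ge0 a; have := sqr_ge0 b.
move: k1 k2; set A := `|_ - a| ; set B := `|_ - b| => k1 k2; nra.
Qed.

End ElementaryEstimates.

Lemma cvg0_le (R : realType) (f g : nat -> R) : (\forall n \near \oo, 0 <= f n <= g n) ->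
  g @ \oo --> 0 -> f @ \oo --> 0.
Proof.
by move=> fg g0; apply: (squeeze_cvgr fg) => //; exact: cvg_cst.
Qed.

(** Continuity of the square root with nonnegative real part: in [y^2 - z^2 = (y - z) (y + z)] the
    second factor has real part at least [Re z]. At z = 0 the modulus alone decides. *)
Lemma normc_sqrt_cvg (R : realType) (y : nat -> R[i]) (z : R[i]) :
  (forall n, 0 <= complex.Re (y n)) -> z = 0 \/ 0 < complex.Re z ->
  (fun n => normc (y n ^+ 2 - z ^+ 2)) @ \oo --> 0 ->
  (fun n => normc (y n - z)) @ \oo --> 0.
Proof.
move=> y0 [->|z0] yz.
  apply/cvgrPdist_lt => e e0; move/cvgrPdist_lt/(_ (e ^+ 2) (exprn_gt0 _ e0)): yz.
  apply: filterS => n; rewrite !sub0r !normrN expr0n /= !subr0.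
  rewrite !ger0_norm ?normc_ge0// normcX.
  by rewrite ltr_pXn2r// nnegrE ?normc_ge0 ?ltW.
apply: (@cvg0_le _ _ (fun n => (complex.Re z)^-1 * normc (y n ^+ 2 - z ^+ 2))).
  apply: nearW => n; rewrite normc_ge0/= mulrC ler_pdivlMr//.
  rewrite subr_sqr normcM ler_wpM2l ?normc_ge0//.
  apply: le_trans (normr_Re_le _); apply: le_trans (ler_norm _).
  by rewrite complexReD lerDr.
rewrite -(mulr0 (complex.Re z)^-1).
by apply: cvgM => //; exact: cvg_cst.
Qed.

(* Absorbs the small multiples of [x] and [m] on the right-hand sides. *)
Lemma bootstrap_bounded (R : realType) (x m eta theta : nat -> R) (U C K : R) :
  0 <= U -> 0 <= C -> 0 <= K -> (forall n, 0 <= x n) -> (forall n, 0 <= m n) ->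
  (forall n, x n <= U * m n + C * (eta n * x n + 1)) ->
  (forall n, m n ^+ 2 <= K + K * theta n * (1 + x n ^+ 2)) ->
  eta @ \oo --> 0 -> theta @ \oo --> 0 ->
  exists B, \forall n \near \oo, x n <= B.
Proof.
move=> U0 C0 K0 x0 m0 hx hm eta0 theta0.
(* Chosen so that [(2 U m + 2 C)^2 <= D (m^2 + 1)]. The two thresholds below then give
   [C eta <= 1/2] and [K |theta| D <= 1/2], which allows absorption. *)
pose D := 8 * U ^+ 2 + 8 * C ^+ 2 + 1.
have D1 : 1 <= D by rewrite /D; have := sqr_ge0 U; have := sqr_ge0 C; lra.
have e1 : 0 < (2 * C + 1)^-1 by rewrite invr_gt0; lra.
have e2 : 0 < (2 * (K + 1) * D)^-1 by rewrite invr_gt0 !mulr_gt0//; lra.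
have H1 : \forall n \near \oo, `|eta n| < (2 * C + 1)^-1.
  by move/cvgrPdist_lt/(_ _ e1): eta0; apply: filterS => n; rewrite sub0r normrN.
have H2 : \forall n \near \oo, `|theta n| < (2 * (K + 1) * D)^-1.
  by move/cvgrPdist_lt/(_ _ e2): theta0; apply: filterS => n; rewrite sub0r normrN.
exists (2 * U * (2 * K + 3) + 2 * C).
apply: filterS2 H1 H2 => n h1 h2.
have x0n := x0 n; have m0n := m0 n.
have k1 : x n <= 2 * U * m n + 2 * C.
  have : C * eta n <= 2^-1.
    have : eta n <= (2 * C + 1)^-1 by rewrite (le_trans (ler_norm _))// ltW.
    move=> /(ler_wpM2l C0) /le_trans; apply.
    by rewrite ler_pdivrMr; lra.
  by have := hx n; nra.
have k2 : x n ^+ 2 <= D * (m n ^+ 2 + 1).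
  have h3 : x n ^+ 2 <= (2 * U * m n + 2 * C) ^+ 2.
    by rewrite ler_pXn2r// nnegrE// addr_ge0 ?mulr_ge0.
  apply: (le_trans h3).
  rewrite -subr_ge0 (_ : _ - _ = (2 * U * m n - 2 * C) ^+ 2 + 8 * U ^+ 2 +
    8 * C ^+ 2 * m n ^+ 2 + m n ^+ 2 + 1); last by rewrite /D; ring.
  have q1 := sqr_ge0 (2 * U * m n - 2 * C); have q2 := sqr_ge0 U.
  have q3 : 0 <= 8 * C ^+ 2 * m n ^+ 2.
    by apply: mulr_ge0; [apply: mulr_ge0 => //|]; exact: sqr_ge0.
  have q4 := sqr_ge0 (m n); lra.
have k3 : m n ^+ 2 <= 2 * K + 2.
  have h3 : K * `|theta n| * D <= 2^-1.
    have D0 : 0 < D by lra.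
    move/ltW: h2 => /(ler_wpM2l K0) /(ler_wpM2r (ltW D0)) /le_trans; apply.
    rewrite invfM mulrA mulfVK ?gt_eqF// ler_pdivrMr; lra.
  have m2 := sqr_ge0 (m n).
  have h4 : m n ^+ 2 <= K + K * `|theta n| * (1 + x n ^+ 2).
    apply: (le_trans (hm n)); rewrite lerD2l ler_wpM2r ?addr_ge0 ?sqr_ge0//.
    by rewrite ler_wpM2l// ler_norm.
  have Kt : 0 <= K * `|theta n| by rewrite mulr_ge0.
  have h5 : K * `|theta n| * (1 + x n ^+ 2) <= K * `|theta n| * D * (m n ^+ 2 + 2).
    by rewrite -[leRHS]mulrA ler_wpM2l//; nra.
  have h6 : K * `|theta n| * D * (m n ^+ 2 + 2) <= 2^-1 * (m n ^+ 2 + 2).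
    by rewrite ler_wpM2r// addr_ge0.
  lra.
have k4 : m n <= 2 * K + 3 by have := sqr_ge0 (m n - 1); nra.
apply: (le_trans k1); rewrite lerD2r ler_wpM2l//.
by rewrite mulr_ge0.
Qed.

Lemma normc_dot_le (R : realType) (V : nat) (h : 'I_V.+1 -> R[i]) (e : R) (n : offspring V) :
  (forall t, normc (h t) <= e) -> normc (\sum_t (n t)%:R * h t) <= total R n * e.
Proof.
move=> he; apply: (le_trans (normc_sum _ _ _)); rewrite /total mulr_suml.
by apply: ler_sum => t _; rewrite normcM normc_nat ler_wpM2l.
Qed.

Lemma ler_sum_ord (R : realType) (n : nat) (F : 'I_n -> R) (e : R) :
  (forall i, F i <= e) -> \sum_i F i <= n%:R * e.
Proof.
by move=> Fe; rewrite -[n in n%:R]card_ord mulr_natl -sumr_const; exact: ler_sum.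
Qed.

Lemma le_sum_normc (R : realType) (V : nat) (h : 'I_V.+1 -> R[i]) t :
  normc (h t) <= \sum_s normc (h s).
Proof. by rewrite (bigD1 t)//= lerDl sumr_ge0// => s _; exact: normc_ge0. Qed.

Lemma cexpectation_real d (T : measurableType d) (R : realType)
    (P : probability T R) (F : T -> R) :
  cexpectation P (fun w => (F w)%:C) = (\int[P]_w F w)%:C.
Proof. by apply: complex_ext => //=; rewrite Rintegral_cst// mul0r. Qed.

Lemma cintegrable_real d (T : measurableType d) (R : realType)
    (P : probability T R) (F : T -> R) : P.-integrable setT (EFin \o F) ->
  cintegrable P (fun w => (F w)%:C).
Proof. by move=> iF; split=> //=; exact: finite_measure_integrable_cst. Qed.

(** * Second-order expansion of the branching equation at a fixed argument *)

Section OneStep.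
Variables (R : realType) (V : nat) (p : 'I_V.+1 -> offspring V -> R).
Hypothesis hp : forall k, is_pmf (p k).
Hypothesis hM : forall k l, (emean p k l < +oo)%E.
Hypothesis hirr : irreducible (mean_matrix p).
Variable Ptree : 'I_V.+1 -> probability (measurable_tree V) R.
Hypothesis hlaw : forall k, is_GW_law p k (Ptree k).
Hypothesis hfin : forall k, {ae Ptree k, forall w, finite_set (particles w)}.
Variables (v u : 'rV[R]_V.+1).
Hypotheses (hv0 : forall s, 0 < v 0 s) (hu0 : forall s, 0 < u 0 s).
Hypotheses (hv : v *m mean_matrix p = v) (hu : mean_matrix p *m u^T = u^T).
Hypotheses (hv1 : \sum_s v 0 s = 1) (hvu : \sum_s v 0 s * u 0 s = 1).
Hypothesis hvar : (\esum_(n in [set: offspring V])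
  (Qmix p v n * (\sum_s (n s)%:R * u 0 s) ^+ 2)%:E < +oo)%E.
Local Notation M := (mean_matrix p).
Local Notation H := (branching_variance Ptree v u).
Local Notation kids w := (brood w [::]).

(** Takes the role of [e] times a third moment in the remainder, and still tends to 0 with [e] under
    second moments. *)
Definition truncated_moment (e : R) : R :=
  \sum_k \int[Ptree k]_w (total R (kids w) ^+ 2 * Num.min 1 (total R (kids w) * e)).

Let T1 := \sum_k \int[Ptree k]_w total R (kids w).
Let T2 := \sum_k \int[Ptree k]_w (total R (kids w) ^+ 2).
Let U := \sum_s u 0 s.

Let T1_ge0 : 0 <= T1.
Proof. by apply: sumr_ge0 => k _; apply: Rintegral_ge0 => w _; exact: total_ge0. Qed.
Let T2_ge0 : 0 <= T2.
Proof. by apply: sumr_ge0 => k _; apply: Rintegral_ge0 => w _; exact: sqr_ge0. Qed.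
Let U_ge0 : 0 <= U.
Proof. by apply: sumr_ge0 => k _; exact: ltW. Qed.
Let le_T1 k : \int[Ptree k]_w total R (kids w) <= T1.
Proof.
rewrite /T1 (bigD1 k)//= lerDl; apply: sumr_ge0 => j _.
by apply: Rintegral_ge0 => w _; exact: total_ge0.
Qed.
Let le_T2 k : \int[Ptree k]_w (total R (kids w) ^+ 2) <= T2.
Proof.
rewrite /T2 (bigD1 k)//= lerDl; apply: sumr_ge0 => j _.
by apply: Rintegral_ge0 => w _; exact: sqr_ge0.
Qed.
Let it2 k := integrable_sqr_total hp hlaw hv0 hu0 hvar k.
Let it1 k := integrable_total hM hlaw k.
Let it2Z k (c : R) : (Ptree k).-integrable setT (EFin \o (fun w => c * total R (kids w) ^+ 2)).
Proof. exact: integrable_scaler. Qed.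
Let it1Z k (c : R) : (Ptree k).-integrable setT (EFin \o (fun w => c * total R (kids w))).
Proof. exact: integrable_scaler. Qed.
Let u_le k : u 0 k <= U.
Proof. by rewrite /U (bigD1 k)//= lerDl; apply: sumr_ge0 => j _; exact: ltW. Qed.
Let v_sum_le (x : 'I_V.+1 -> R[i]) (e : R) : (forall s, normc (x s) <= e) ->
  normc (\sum_s (v 0 s)%:C * x s) <= e.
Proof.
move=> xe; apply: (le_trans (normc_sum _ _ _)).
rewrite -[leRHS]mul1r -hv1 mulr_suml; apply: ler_sum => s _.
by rewrite normcM normc_real ger0_norm ?ler_wpM2l// ltW.
Qed.

Let truncated_integrable k (e : R) : 0 <= e -> (Ptree k).-integrable setT
  (EFin \o (fun w => total R (kids w) ^+ 2 * Num.min 1 (total R (kids w) * e))).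
Proof.
move=> e0; apply: (@integrable_root_brood_le _ _ _ k
  (fun n => total R n ^+ 2 * Num.min 1 (total R n * e)) (fun n => total R n ^+ 2)) => [|n]; first exact: it2.
have m0 : 0 <= Num.min 1 (total R n * e).
  by rewrite le_min ler01 mulr_ge0// total_ge0.
have P0 := mulr_ge0 (sqr_ge0 (total R n)) m0.
rewrite (ger0_norm P0).
by rewrite ler_piMr ?sqr_ge0// ge_min lexx.
Qed.

Lemma v_dot_mean (x : 'I_V.+1 -> R[i]) :
  \sum_k (v 0 k)%:C * (\sum_l (M k l)%:C * x l) = \sum_l (v 0 l)%:C * x l.
Proof.
under eq_bigr do rewrite mulr_sumr.
rewrite exchange_big /=; apply: eq_bigr => l _.
under eq_bigr do rewrite mulrA -rmorphM; rewrite -mulr_suml -rmorph_sum.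
by congr (_%:C * _); rewrite -[in RHS]hv mxE.
Qed.

Section FixedArgument.
Variables (a : 'I_V.+1 -> R[i]) (delta : R).
Hypotheses (a1 : forall s, normc (a s) <= 1) (ad : forall s, normc (1 - a s) <= delta).

Let h s := 1 - count_transform Ptree s a.
Let eta := \sum_s normc (h s).
Let c := \sum_s (v 0 s)%:C * h s.
Let r s := h s - c * (u 0 s)%:C.
Let rho := \sum_s normc (r s).
Let bb k := cexpectation (Ptree k) (fun w => \prod_t (1 - h t) ^+ kids w t).
(** What the expected product contains beyond first order in [h]; its first-order part is
    [- M h]. *)
Let q k := cexpectation (Ptree k)
  (fun w => \prod_t (1 - h t) ^+ kids w t - 1 + \sum_t (kids w t)%:R * h t).

Let g1 s : normc (1 - h s) <= 1.
Proof. by rewrite /h subKr; exact: normc_count_transform. Qed.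
Let h_le s : normc (h s) <= eta.
Proof. exact: le_sum_normc. Qed.
Let r_le s : normc (r s) <= rho.
Proof. exact: le_sum_normc. Qed.
Let eta0 : 0 <= eta.
Proof. by apply: sumr_ge0 => s _; exact: normc_ge0. Qed.
Let rho0 : 0 <= rho.
Proof. by apply: sumr_ge0 => s _; exact: normc_ge0. Qed.
Let c_le : normc c <= eta.
Proof. exact: v_sum_le. Qed.

Let ibb k : cintegrable (Ptree k) (fun w => \prod_t (1 - h t) ^+ kids w t).
Proof. exact: cintegrable_prod. Qed.

Let idot k : cintegrable (Ptree k) (fun w => \sum_t (kids w t)%:R * h t).
Proof. exact: (cexpectation_mean hM hlaw k h).1. Qed.

Let qE k : q k = bb k - 1 + \sum_l (M k l)%:C * h l.
Proof.
rewrite /q cexpectationD//; last exact/cintegrableB/cintegrable_cst.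
rewrite cexpectationB//; last exact: cintegrable_cst.
by rewrite cexpectation_cst (cexpectation_mean hM hlaw k h).2.
Qed.

Let one_step_equation k : h k - \sum_l (M k l)%:C * h l = (1 - a k) * bb k - q k.
Proof.
rewrite qE; have hE : h k = 1 - a k * bb k.
  rewrite /h (branching_equation hM hlaw hfin k a1); congr (1 - _ * cexpectation _ _).
  apply/funext => w; apply: eq_bigr => t _; by rewrite /h subKr.
rewrite hE; ring.
Qed.

Let q_le k : normc (q k) <= T2 * eta ^+ 2.
Proof.
apply: (@le_trans _ _ (\int[Ptree k]_w (eta ^+ 2 * total R (kids w) ^+ 2))).
  apply: normc_cexpectation => //.
    by apply: cintegrableD => //; apply: cintegrableB => //; exact: cintegrable_cst.
  by move=> w; rewrite -exprMn mulrC; exact: normc_prod_expand1_le.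
rewrite RintegralZl//; last exact: it2.
by rewrite mulrC ler_wpM2r ?sqr_ge0.
Qed.

Let bb1_le k : normc (bb k - 1) <= T1 * eta.
Proof.
have -> : bb k - 1 = cexpectation (Ptree k) (fun w => \prod_t (1 - h t) ^+ kids w t - 1).
  by rewrite cexpectationB ?cexpectation_cst//; exact: cintegrable_cst.
apply: (@le_trans _ _ (\int[Ptree k]_w (eta * total R (kids w)))).
  apply: normc_cexpectation => //.
    by apply: cintegrableB => //; exact: cintegrable_cst.
  by move=> w; rewrite mulrC; exact: normc_prod_sub1_le.
rewrite RintegralZl//; last exact: it1.
by rewrite mulrC ler_wpM2r.
Qed.

Let bb_le1 k : normc (bb k) <= 1.
Proof.
apply: normc_cexpectation_le1 => // w.
by apply: normc_prod_le1 => t _; exact: normcX_le1.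
Qed.

(** From |g| <= 1 one gets [Re h >= 0] for each type. This sign selects the branch of the square
    root in the limit. *)
Lemma Re_weighted_sum_ge0 : 0 <= complex.Re c.
Proof.
rewrite /c complexRe_sum; apply: sumr_ge0 => s _.
rewrite complexReM /= mul0r subr0.
apply: mulr_ge0; first exact: ltW.
have := g1 s => /(le_trans (normr_Re_le _)).
rewrite complexReD complexReN ler_norml => /andP[_].
by rewrite lerBlDr (_ : complex.Re 1 = 1)// lerDl.
Qed.

Let v_r : \sum_s (v 0 s)%:C * r s = 0.
Proof.
rewrite /r; under eq_bigr do rewrite mulrBr mulrCA -rmorphM.
by rewrite sumrB -mulr_sumr -rmorph_sum hvu mulr1 subrr.
Qed.

(** Since [u] is fixed by [M], the remainder [r] has the same image under [1 - M] as [h], and it is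
    annihilated by [v], so the resolvent bound applies. The two factors [V.+1] come from the sums
    over the types. *)
Lemma deviation_le (C : R) : 0 <= C ->
  (forall r : 'I_V.+1 -> R[i], \sum_s (v 0 s)%:C * r s = 0 ->
     forall s, normc (r s) <= C * \sum_t normc (r t - \sum_l (M t l)%:C * r l)) ->
  rho <= V.+1%:R * (C * (V.+1%:R * (T2 * eta ^+ 2 + delta))).
Proof.
move=> C0 hC.
have E t : r t - \sum_l (M t l)%:C * r l = (1 - a t) * bb t - q t.
  rewrite -one_step_equation /r; under eq_bigr do rewrite mulrBr mulrCA -rmorphM.
  rewrite sumrB -mulr_sumr -rmorph_sum.
  have -> : \sum_l M t l * u 0 l = u 0 t.
    have /matrixP/(_ t 0) := hu; rewrite !mxE => <-; apply: eq_bigr => l _.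
    by rewrite !mxE.
  ring.
apply: ler_sum_ord => s; apply: (le_trans (hC r v_r s)); rewrite ler_wpM2l//.
apply: ler_sum_ord => t; rewrite E; apply: (le_trans (normcB _ _)).
by rewrite addrC lerD// normcM (le_trans _ (ad t))// ler_piMr ?normc_ge0.
Qed.

Local Notation scal w := (\sum_t (kids w t)%:R * u 0 t).

Let quad k := cexpectation (Ptree k) (fun w => (\sum_t (kids w t)%:R * h t) ^+ 2).
Let rem k := cexpectation (Ptree k) (fun w => factorial_remainder h (kids w)).

Let iquad k : cintegrable (Ptree k) (fun w => (\sum_t (kids w t)%:R * h t) ^+ 2).
Proof.
apply: (@cintegrable_root_brood _ _ _ k (fun n => (\sum_t (n t)%:R * h t) ^+ 2)
  (fun n => eta ^+ 2 * total R n ^+ 2)) => [|n]; first exact: it2Z.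
rewrite normcX -exprMn ler_pXn2r ?nnegrE ?normc_ge0 ?mulr_ge0 ?total_ge0//.
by rewrite mulrC normc_dot_le.
Qed.

Let q_split k : q k = (quad k - \sum_l (M k l)%:C * h l ^+ 2) / 2 + rem k.
Proof.
have [i1 E1] := cexpectation_mean hM hlaw k (fun t => h t ^+ 2).
have i2 : cintegrable (Ptree k) (fun w => (2^-1 : R[i]) *
    ((\sum_t (kids w t)%:R * h t) ^+ 2 - \sum_t (kids w t)%:R * h t ^+ 2)).
  by apply: cintegrableZ; exact: cintegrableB.
have i3 : cintegrable (Ptree k)
    (fun w => \prod_t (1 - h t) ^+ kids w t - 1 + \sum_t (kids w t)%:R * h t).
  by apply: cintegrableD => //; apply: cintegrableB => //; exact: cintegrable_cst.
have -> : rem k = q k - 2^-1 * (quad k - \sum_l (M k l)%:C * h l ^+ 2).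
  rewrite /quad -E1 -cexpectationB// -cexpectationZ; last exact: cintegrableB.
  rewrite /q -cexpectationB//; congr cexpectation; apply/funext => w.
  by rewrite /factorial_remainder [_ / 2]mulrC.
by rewrite mulrC addrCA subrr addr0.
Qed.

Let rem_le k : normc (rem k) <= 2 * eta ^+ 2 *
  \int[Ptree k]_w (total R (kids w) ^+ 2 * Num.min 1 (total R (kids w) * eta)).
Proof.
have i1 := truncated_integrable k eta0.
rewrite -RintegralZl//; apply: normc_cexpectation.
- apply: (@cintegrable_root_brood _ _ _ k (factorial_remainder h)
    (fun n => 2 * eta ^+ 2 * (total R n ^+ 2 * Num.min 1 (total R n * eta)))).
    exact: integrable_scaler.
  move=> n; apply: (le_trans (normc_factorial_remainder n g1 h_le)).
  by rewrite exprMn [_ ^+ 2 * eta ^+ 2]mulrC !mulrA.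
- exact: integrable_scaler.
- move=> w; apply: (le_trans (normc_factorial_remainder _ g1 h_le)).
  by rewrite exprMn [_ ^+ 2 * eta ^+ 2]mulrC !mulrA.
Qed.

(** Pairing with [v] kills [h - M h], so only the second-order part balances the perturbation
    [1 - a]. *)
Let weighted_q : \sum_k (v 0 k)%:C * q k = \sum_k (v 0 k)%:C * ((1 - a k) * bb k).
Proof.
apply/eqP; rewrite eq_sym -subr_eq0 -sumrB; apply/eqP.
under eq_bigr do rewrite -mulrBr -one_step_equation mulrBr.
by rewrite sumrB v_dot_mean subrr.
Qed.

(** With [h = c u + r], each difference of squares factors into the pairings with [r] and with
    [h + c u], of sizes [rho] and [(1 + U) eta]. The offspring term costs [T2], the diagonal term
    1. *)
Let quadratic_form_le :
  normc (\sum_k (v 0 k)%:C * quad k - \sum_l (v 0 l)%:C * h l ^+ 2 - c ^+ 2 * H%:C) <=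
  (T2 + 1) * (1 + U) * (rho * eta).
Proof.
have hu_le t : normc (h t + c * (u 0 t)%:C) <= (1 + U) * eta.
  apply: (le_trans (le_normcD _ _)); rewrite mulrDl mul1r lerD//.
  rewrite normcM normc_real (ger0_norm (ltW (hu0 t))) mulrC ler_pM//; first exact: ltW.
  exact: normc_ge0.
have -> : \sum_k (v 0 k)%:C * quad k - \sum_l (v 0 l)%:C * h l ^+ 2 - c ^+ 2 * H%:C =
    \sum_k (v 0 k)%:C * (quad k - c ^+ 2 * (\int[Ptree k]_w (scal w ^+ 2))%:C) -
    \sum_l (v 0 l)%:C * (h l ^+ 2 - c ^+ 2 * (u 0 l ^+ 2)%:C).
  rewrite /branching_variance rmorphB !rmorph_sum mulrBr.
  under [in RHS]eq_bigr do rewrite mulrBr.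
  under [X in _ = _ - X]eq_bigr do rewrite mulrBr.
  rewrite !sumrB !mulr_sumr.
  under [X in _ - (X - _) = _]eq_bigr do rewrite rmorphM mulrCA.
  under [X in _ - (_ - X) = _]eq_bigr do rewrite rmorphM mulrCA.
  ring.
rewrite mulrDl mul1r; apply: (le_trans (normcB _ _)); rewrite !mulrDl; apply: lerD.
  apply: v_sum_le => k; rewrite -cexpectation_real -cexpectationZ; last first.
    by apply: cintegrable_real; exact: (integrable_sqr_scal hp hlaw hv0 hvar).
  rewrite -cexpectationB//; last first.
    by apply: cintegrableZ; apply: cintegrable_real;
      exact: (integrable_sqr_scal hp hlaw hv0 hvar).
  apply: (@le_trans _ _ (\int[Ptree k]_w ((1 + U) * (rho * eta) * total R (kids w) ^+ 2))).
    apply: normc_cexpectation => //.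
      apply: cintegrableB => //; apply: cintegrableZ; apply: cintegrable_real.
      exact: (integrable_sqr_scal hp hlaw hv0 hvar).
    move=> w; rewrite (_ : _ - _ = (\sum_t (kids w t)%:R * r t) *
        (\sum_t (kids w t)%:R * (h t + c * (u 0 t)%:C))); last first.
      have -> : (scal w ^+ 2)%:C = (\sum_t (kids w t)%:R * (u 0 t)%:C) ^+ 2.
        rewrite rmorphXn rmorph_sum; congr (_ ^+ 2); apply: eq_bigr => t _.
        by rewrite rmorphM rmorph_nat.
      rewrite -exprMn subr_sqr [c * _]mulr_sumr -sumrB -big_split /=.
      by congr (_ * _); apply: eq_bigr => t _; rewrite /r; ring.
    rewrite normcM (_ : _ * _ ^+ 2 = (total R (kids w) * rho) *
      (total R (kids w) * ((1 + U) * eta))); last by ring.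
    by rewrite ler_pM ?normc_ge0// normc_dot_le.
  rewrite RintegralZl//; last exact: it2.
  rewrite mulrC -mulrA ler_wpM2r//.
  by rewrite mulr_ge0// ?addr_ge0// mulr_ge0.
apply: v_sum_le => l; rewrite rmorphXn -exprMn subr_sqr normcM.
have := ler_pM (normc_ge0 _) (normc_ge0 _) (r_le l) (hu_le l).
by rewrite mulrCA mulrDl mul1r.
Qed.

(** The three errors come from the Taylor remainder, from replacing [h] by [c u] in the quadratic
    form, and from replacing the expected product by 1 in front of [1 - a]. *)
Lemma quadratic_equation :
  normc (c ^+ 2 * (H / 2)%:C - \sum_k (v 0 k)%:C * (1 - a k)) <=
  2 * eta ^+ 2 * truncated_moment eta + (T2 + 1) * (1 + U) * (rho * eta) +
  delta * (T1 * eta).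
Proof.
set Q := \sum_k (v 0 k)%:C * quad k - \sum_l (v 0 l)%:C * h l ^+ 2.
have E : \sum_k (v 0 k)%:C * q k = Q / 2 + \sum_k (v 0 k)%:C * rem k.
  under eq_bigr do rewrite q_split mulrDr mulrA mulrBr.
  rewrite big_split /= -mulr_suml sumrB; congr ((_ - _) / 2 + _).
  exact: v_dot_mean.
have H2 : (H / 2)%:C = H%:C / 2 by rewrite rmorphM fmorphV rmorph_nat.
rewrite (_ : _ - _ = - ((Q - c ^+ 2 * H%:C) / 2) - \sum_k (v 0 k)%:C * rem k +
  \sum_k (v 0 k)%:C * ((1 - a k) * (bb k - 1))); last first.
  rewrite H2; have -> : \sum_k (v 0 k)%:C * ((1 - a k) * (bb k - 1)) =
      \sum_k (v 0 k)%:C * q k - \sum_k (v 0 k)%:C * (1 - a k).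
    by rewrite weighted_q -sumrB; apply: eq_bigr => k _; ring.
  by rewrite E; field.
apply: (le_trans (le_normcD _ _)); apply: lerD.
  apply: (le_trans (normcB _ _)); rewrite addrC; apply: lerD.
    apply: v_sum_le => k; apply: (le_trans (rem_le k)).
    rewrite ler_wpM2l ?mulr_ge0 ?sqr_ge0// /truncated_moment (bigD1 k)//= lerDl.
    apply: sumr_ge0 => j _; apply: Rintegral_ge0 => w _.
    by rewrite mulr_ge0 ?sqr_ge0// le_min ler01 mulr_ge0// total_ge0.
  rewrite normcN; apply: le_trans quadratic_form_le.
  rewrite normcM normcV normc_nat ler_piMr ?normc_ge0// invf_le1//; lra.
apply: v_sum_le => k; rewrite normcM ler_pM ?normc_ge0//.
Qed.

End FixedArgument.

(* [c] is the coordinate of [h] along [u] and [rho] the size of the remainder. *)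
Lemma one_step_bounds : exists2 C : R, 0 <= C &
  forall (a : 'I_V.+1 -> R[i]) (delta : R),
  (forall s, normc (a s) <= 1) -> (forall s, normc (1 - a s) <= delta) ->
  let h s := 1 - count_transform Ptree s a in
  let eta := \sum_s normc (h s) in
  let c := \sum_s (v 0 s)%:C * h s in
  let rho := \sum_s normc (h s - c * (u 0 s)%:C) in
  [/\ 0 <= complex.Re c, rho <= C * (eta ^+ 2 + delta) &
      normc (c ^+ 2 * (H / 2)%:C - \sum_k (v 0 k)%:C * (1 - a k)) <=
      C * (eta ^+ 2 * truncated_moment eta + rho * eta + delta * eta)].
Proof.
have [C0 C0_gt0 hC0] := resolvent_bound hirr hu0 hv hu hvu.
pose A := V.+1%:R * C0 * V.+1%:R.
have A0 : 0 <= A by rewrite !mulr_ge0// ltW.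
pose B := (T2 + 1) * (1 + U).
have B0 : 0 <= B by rewrite mulr_ge0 ?addr_ge0.
pose C := A * (T2 + 1) + (2 + B + T1).
have CA : A * (T2 + 1) <= C by rewrite lerDl !addr_ge0.
have AT0 : 0 <= A * (T2 + 1) by rewrite mulr_ge0 ?addr_ge0.
have C1 : 2 <= C by have := T1_ge0; rewrite /C; lra.
have CB : B <= C by have := T1_ge0; rewrite /C; lra.
have CT : T1 <= C by rewrite /C; lra.
exists C; first by rewrite (le_trans _ C1).
move=> a delta a1 ad h eta c rho.
have eta_ge0 : 0 <= eta by apply: sumr_ge0 => s _; exact: normc_ge0.
have rho_ge0 : 0 <= rho by apply: sumr_ge0 => s _; exact: normc_ge0.
have delta_ge0 : 0 <= delta by exact: le_trans (normc_ge0 _) (ad ord0).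
have e2 := sqr_ge0 eta.
split.
- exact: Re_weighted_sum_ge0.
- have := deviation_le a1 ad (ltW C0_gt0) hC0; rewrite -/h -/eta -/c -/rho => /le_trans; apply.
  rewrite mulrA mulrA -/A; apply: (@le_trans _ _ (A * (T2 + 1) * (eta ^+ 2 + delta))).
    by rewrite -[leRHS]mulrA ler_wpM2l//; have := T2_ge0; nra.
  by rewrite ler_wpM2r// addr_ge0.
- have := quadratic_equation a1 ad; rewrite -/h -/eta -/c -/rho => /le_trans; apply.
  have t0 : 0 <= truncated_moment eta.
    apply: sumr_ge0 => j _; apply: Rintegral_ge0 => w _.
    by apply: mulr_ge0; [exact: sqr_ge0|rewrite le_min ler01 mulr_ge0// total_ge0].
  rewrite [leRHS]mulrDr [C * (_ + _)]mulrDr; apply: lerD; first apply: lerD.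
  + by rewrite -mulrA; apply: ler_wpM2r => //; apply: mulr_ge0.
  + by apply: ler_wpM2r => //; apply: mulr_ge0.
  + by rewrite mulrCA; apply: ler_wpM2r => //; apply: mulr_ge0.
Qed.

End OneStep.

Lemma invn_cvg0 (R : realType) : (fun n : nat => n%:R^-1 : R) @ \oo --> 0.
Proof.
by rewrite -(cvg_shiftS (fun n : nat => n%:R^-1 : R)); exact: cvg_harmonic.
Qed.

Lemma invn2_cvg0 (R : realType) : (fun n : nat => n%:R ^- 2 : R) @ \oo --> 0.
Proof.
rewrite -(mulr0 (0 : R)); under eq_fun do rewrite -exprVn expr2.
by apply: cvgM; exact: invn_cvg0.
Qed.

(** * Asymptotics under the scaling by [N ^- 2] *)

Section Asymptotics.
Variables (R : realType) (V : nat) (p : 'I_V.+1 -> offspring V -> R).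
Hypothesis hp : forall k, is_pmf (p k).
Hypothesis hM : forall k l, (emean p k l < +oo)%E.
Hypothesis hirr : irreducible (mean_matrix p).
Variable Ptree : 'I_V.+1 -> probability (measurable_tree V) R.
Hypothesis hlaw : forall k, is_GW_law p k (Ptree k).
Hypothesis hfin : forall k, {ae Ptree k, forall w, finite_set (particles w)}.
Variables (v u : 'rV[R]_V.+1).
Hypotheses (hv0 : forall s, 0 < v 0 s) (hu0 : forall s, 0 < u 0 s).
Hypotheses (hv : v *m mean_matrix p = v) (hu : mean_matrix p *m u^T = u^T).
Hypotheses (hv1 : \sum_s v 0 s = 1) (hvu : \sum_s v 0 s * u 0 s = 1).
Hypothesis hvar : (\esum_(n in [set: offspring V])
  (Qmix p v n * (\sum_s (n s)%:R * u 0 s) ^+ 2)%:E < +oo)%E.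
Local Notation H := (branching_variance Ptree v u).
Local Notation kids w := (brood w [::]).

Lemma truncated_moment_cvg0 (e : nat -> R) : (forall n, 0 <= e n) ->
  e @ \oo --> 0 -> (fun n => truncated_moment Ptree (e n)) @ \oo --> 0.
Proof.
move=> e0 ecvg; rewrite [X in _ --> X](_ : 0 = \sum_(k < V.+1) 0 :> R); last by rewrite big1.
apply: cvgr_sum => k.
have -> : (0 : R) = \int[Ptree k]_w (cst 0 w) by rewrite Rintegral_cst// mul0r.
apply: (@Rintegral_dominated_cvg _ _ _ (Ptree k)
  (fun n w => total R (kids w) ^+ 2 * Num.min 1 (total R (kids w) * e n)) (cst 0)
  (fun w => total R (kids w) ^+ 2)) => //.
- move=> n; exact: (measurable_fibers_fun
    (fun b => total R b ^+ 2 * Num.min 1 (total R b * e n)) (measurable_fibers_brood [::])).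
- apply: aeW => w.
  apply: (@cvg0_le _ _ (fun n => total R (kids w) ^+ 2 * (total R (kids w) * e n))).
    apply: nearW => n; apply/andP; split.
      by apply: mulr_ge0; [exact: sqr_ge0|rewrite le_min ler01 mulr_ge0// total_ge0].
    by rewrite ler_wpM2l ?sqr_ge0// ge_min lexx orbT.
  rewrite -(mulr0 (total R (kids w) ^+ 2)) -(mulr0 (total R (kids w))).
  by apply: cvgM; [exact: cvg_cst|apply: cvgM => //; exact: cvg_cst].
- exact: (integrable_sqr_total hp hlaw hv0 hu0 hvar).
- move=> n w.
  have m0 : 0 <= Num.min 1 (total R (kids w) * e n).
    by rewrite le_min ler01 mulr_ge0// total_ge0.
  have P0 := mulr_ge0 (sqr_ge0 (total R (kids w))) m0.
  by rewrite (ger0_norm P0) ler_piMr ?sqr_ge0// ge_min lexx.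
Qed.

Variables (z : 'I_V.+1 -> R[i]) (zeta : R[i]).
Hypothesis hz : forall s, 0 <= complex.Re (z s).
Hypothesis hzeta : zeta ^+ 2 * (H / 2)%:C = \sum_s (v 0 s)%:C * z s.
Hypothesis hzeta0 : zeta = 0 \/ 0 < complex.Re zeta.

Definition scaled_weight (N : nat) s : R[i] := cexp (- ((N%:R ^- 2)%:C * z s)).

Let kappa N : R := N%:R ^- 2.
Let a := scaled_weight.
Let A := 3 * \sum_s normc (z s).
Let h N s := 1 - count_transform Ptree s (a N).
Let eta N := \sum_s normc (h N s).

Let kappa_ge0 N : 0 <= kappa N.
Proof. by rewrite invr_ge0 exprn_ge0. Qed.

Let A_ge0 : 0 <= A.
Proof. by rewrite mulr_ge0// sumr_ge0// => s _; exact: normc_ge0. Qed.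

Let ReZ N s : 0 <= complex.Re ((kappa N)%:C * z s).
Proof. by rewrite complexReM /= mul0r subr0 mulr_ge0. Qed.

Let normcZ N s : normc ((kappa N)%:C * z s) = kappa N * normc (z s).
Proof. by rewrite normcM normc_real ger0_norm. Qed.

Lemma normc_scaled_weight N s : normc (scaled_weight N s) <= 1.
Proof. by rewrite normc_cexp_le1// complexReN oppr_le0; exact: ReZ. Qed.

Let a_near1 N s : normc (1 - a N s) <= A * kappa N.
Proof.
apply: (le_trans (normc_1Bcexp_le (ReZ N s))); rewrite normcZ /A -mulrA ler_wpM2l//.
by rewrite mulrC ler_wpM2r// le_sum_normc.
Qed.

Let eta_ge0 N : 0 <= eta N.
Proof. by apply: sumr_ge0 => s _; exact: normc_ge0. Qed.

(** For a fixed tree the product of weights tends to 1, and bounded convergence applies. This gives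
    no rate, but it makes the error terms of the bootstrap small. *)
Lemma count_transform_scaled_cvg s :
  (fun N => normc (1 - count_transform Ptree s (scaled_weight N))) @ \oo --> 0.
Proof.
pose F N (w : measurable_tree V) := normc (1 - \prod_t a N t ^+ particle_count t w).
have FE N w : F N w = normc (1 - \prod_t a N t ^+ tree_counts w t).
  by rewrite /F; congr (normc (1 - _)); apply: eq_bigr => t _; rewrite ffunE.
have mF N : measurable_fun setT (F N).
  rewrite (funext (FE N)).
  exact: (measurable_fibers_fun (fun c : offspring V => normc (1 - \prod_t a N t ^+ c t))
    (@measurable_fibers_tree_counts V)).
have F2 N w : `|F N w| <= 2.
  rewrite ger0_norm ?normc_ge0//; apply: (le_trans (normcB _ _)).
  rewrite normc1 -[leRHS]/(1 + 1) lerD2l; apply: normc_prod_le1 => t _.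
  exact/normcX_le1/normc_scaled_weight.
apply: (@cvg0_le _ _ (fun N => \int[Ptree s]_w F N w)).
  apply: nearW => N; apply/andP; split; first exact: normc_ge0.
  rewrite /count_transform.
  have i1 := cintegrable_count_prod Ptree s (normc_scaled_weight N).
  rewrite -[X in normc (X - _)](cexpectation_cst (Ptree s)) -cexpectationB//; last exact: cintegrable_cst.
  apply: normc_cexpectation => //; first by apply: cintegrableB => //; exact: cintegrable_cst.
  exact: bounded_integrable (mF N) (F2 N).
apply: Rintegral_bounded_cvg0 F2 => //; apply: aeW => w.
apply: (@cvg0_le _ _ (fun N => total R (tree_counts w) * A * kappa N)).
  apply: nearW => N; rewrite normc_ge0/= FE.
  have := @normc_prodB_le _ _ (fun=> 1) (a N) (tree_counts w)
    (fun=> normc1_le1 R) (normc_scaled_weight N).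
  rewrite [X in normc (X - _)]big1 => [/le_trans|t _]; last by rewrite expr1n.
  apply; rewrite /total -mulrA mulr_suml; apply: ler_sum => t _.
  by rewrite ler_wpM2l.
rewrite -(mulr0 (total R (tree_counts w) * A)).
by apply: cvgM; [exact: cvg_cst|exact: invn2_cvg0].
Qed.

Let eta_cvg0 : eta @ \oo --> 0.
Proof.
rewrite [X in _ --> X](_ : 0 = \sum_(k < V.+1) 0 :> R); last by rewrite big1.
by apply: cvgr_sum => s; exact: count_transform_scaled_cvg.
Qed.

(** An equality except at N = 0, where the inverse is 0 by convention. *)
Let N2kappa N : N%:R ^+ 2 * kappa N <= 1.
Proof.
rewrite /kappa; have [->|N0] := eqVneq N 0%N; first by rewrite expr0n mul0r.
by rewrite mulfV// sqrf_eq0 pnatr_eq0.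
Qed.

Let Nkappa N : N%:R * kappa N = N%:R^-1.
Proof.
rewrite /kappa; have [->|N0] := eqVneq N 0%N; first by rewrite mul0r invr0.
by rewrite expr2 invfM mulrA mulfV ?mul1r// pnatr_eq0.
Qed.

Let Nkappa_le1 N : N%:R * kappa N <= 1.
Proof.
rewrite Nkappa; case: N => [|N]; first by rewrite invr0.
by rewrite invf_le1// ler1n.
Qed.

(** Multiplied by powers of [N], the one-step bounds become the hypotheses of [bootstrap_bounded]
    for [x = N eta] and [m = N |c|]. Once [x] is bounded, the quadratic equation determines the
    limit of [(N c)^2], and [N rho] tends to 0. *)
Lemma survival_asymptotics k :
  (fun N : nat => normc (N%:R * h N k - zeta * (u 0 k)%:C)) @ \oo --> 0.
Proof.
have [C C0 bnd] := one_step_bounds hp hM hirr hlaw hfin hv0 hu0 hv hu hv1 hvu hvar.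
have Hgt0 : 0 < H := branching_variance_gt0 hp hM hlaw hfin hv0 hu0 hu hvar.
pose c N := \sum_s (v 0 s)%:C * h N s.
pose rho N := \sum_s normc (h N s - c N * (u 0 s)%:C).
pose U := \sum_s u 0 s.
have U0 : 0 <= U by apply: sumr_ge0 => s _; exact: ltW.
have u_le s : u 0 s <= U.
  by rewrite /U (bigD1 s)//= lerDl; apply: sumr_ge0 => j _; exact: ltW.
pose tm N := truncated_moment Ptree (eta N).
have tm0 : tm @ \oo --> 0 by exact: truncated_moment_cvg0.
have tm_ge0 N : 0 <= tm N.
  apply: sumr_ge0 => j _; apply: Rintegral_ge0 => w _.
  by apply: mulr_ge0; [exact: sqr_ge0|rewrite le_min ler01 mulr_ge0// total_ge0].
have B1 N : 0 <= complex.Re (c N).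
  by have [] := bnd _ _ (normc_scaled_weight N) (a_near1 N).
have B2 N : rho N <= C * (eta N ^+ 2 + A * kappa N).
  by have [] := bnd _ _ (normc_scaled_weight N) (a_near1 N).
have B3 N : normc (c N ^+ 2 * (H / 2)%:C - \sum_k (v 0 k)%:C * (1 - a N k)) <=
    C * (eta N ^+ 2 * tm N + rho N * eta N + A * kappa N * eta N).
  by have [] := bnd _ _ (normc_scaled_weight N) (a_near1 N).
have rho_ge0 N : 0 <= rho N by apply: sumr_ge0 => s _; exact: normc_ge0.
pose x N := N%:R * eta N.
pose m N := N%:R * normc (c N).
pose C' := C * (1 + A).
have C'0 : 0 <= C' by rewrite mulr_ge0 ?addr_ge0.
have x0 N : 0 <= x N by rewrite mulr_ge0.
have m0 N : 0 <= m N by rewrite mulr_ge0 ?normc_ge0.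
have Nrho N : N%:R * rho N <= C * (eta N * x N + A * N%:R^-1).
  apply: (le_trans (ler_wpM2l (ler0n _ N) (B2 N))).
  by rewrite -Nkappa /x le_eqVlt; apply/orP; left; apply/eqP; ring.
have hx N : x N <= U * m N + C' * (eta N * x N + 1).
  have h1 : eta N <= U * normc (c N) + rho N.
    rewrite /eta /rho /U mulr_suml -big_split; apply: ler_sum => s _.
    rewrite [X in normc X <= _](_ : _ = c N * (u 0 s)%:C + (h N s - c N * (u 0 s)%:C));
      last by rewrite addrC subrK.
    apply: (le_trans (le_normcD _ _)).
    by rewrite lerD2r normcM normc_real (ger0_norm (ltW (hu0 s))) mulrC.
  apply: (le_trans (ler_wpM2l (ler0n _ N) h1)).
  rewrite mulrDr mulrCA lerD2l; apply: (le_trans (Nrho N)).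
  have e1 : 0 <= eta N * x N by rewrite mulr_ge0.
  have e2 : N%:R^-1 <= 1 :> R by rewrite -Nkappa.
  have e3 : 0 <= N%:R^-1 :> R by rewrite invr_ge0.
  have e4 : A * N%:R^-1 <= A by rewrite ler_piMr.
  have e5 : 0 <= A * (eta N * x N) by rewrite mulr_ge0.
  rewrite /C' -mulrA ler_wpM2l// mulrDl mul1r mulrDr mulr1.
  by move: e1 e4 e5; set t := eta N * x N; set t' := A * _^-1; lra.
(* [tm] stems from the Taylor remainder, [C + C * A] from the bound on [rho], and the last [A] from
   the distance of the weights to 1. *)
pose theta N := C * (tm N + (C + C * A + A) * eta N).
have theta_ge0 N : 0 <= theta N.
  by rewrite mulr_ge0// addr_ge0// mulr_ge0// !addr_ge0// mulr_ge0.
have theta0 : theta @ \oo --> 0.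
  rewrite -(mulr0 C) -(addr0 (0 : R)) -{2}(mulr0 (C + C * A + A)).
  apply: cvgM; first exact: cvg_cst.
  by apply: cvgD => //; apply: cvgM => //; exact: cvg_cst.
have B3' N : N%:R ^+ 2 *
    normc (c N ^+ 2 * (H / 2)%:C - \sum_k (v 0 k)%:C * (1 - a N k)) <=
    theta N * (1 + x N ^+ 2).
  have N20 : 0 <= N%:R ^+ 2 :> R by rewrite exprn_ge0.
  apply: (le_trans (ler_wpM2l N20 (B3 N))).
  rewrite mulrCA /theta -[leRHS]mulrA ler_wpM2l//.
  rewrite mulrDr [X in X + _ <= _]mulrDr.
  have re : N%:R ^+ 2 * (rho N * eta N) <= (C * x N ^+ 2 + C * A) * eta N.
    rewrite mulrA ler_wpM2r//; apply: (le_trans (ler_wpM2l N20 (B2 N))).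
    rewrite mulrCA [N%:R ^+ 2 * (_ + _)]mulrDr -[leRHS]mulrDr ler_wpM2l// lerD//.
      by rewrite /x exprMn.
    by rewrite mulrCA -[leRHS]mulr1 ler_wpM2l.
  have ke : N%:R ^+ 2 * (A * kappa N * eta N) <= A * eta N.
    by rewrite mulrA ler_wpM2r// mulrCA -[leRHS]mulr1 ler_wpM2l.
  have xe : N%:R ^+ 2 * (eta N ^+ 2 * tm N) = x N ^+ 2 * tm N by rewrite /x; ring.
  have p4 : 0 <= tm N by exact: tm_ge0.
  have x2 := sqr_ge0 (x N).
  have p1 : 0 <= C * A * eta N * x N ^+ 2 by do 3 (apply: mulr_ge0 => //).
  have p2 : 0 <= A * eta N * x N ^+ 2 by do 2 (apply: mulr_ge0 => //).
  have p3 : 0 <= C * eta N by rewrite !mulr_ge0.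
  have p5 : 0 <= A * eta N by rewrite mulr_ge0.
  have H1 := lerD re ke; rewrite xe -addrA; apply: (@le_trans _ _ (x N ^+ 2 * tm N +
    ((C * x N ^+ 2 + C * A) * eta N + A * eta N))); first by rewrite lerD2l; exact: H1.
  rewrite -subr_ge0 (_ : _ - _ = tm N + C * eta N + C * A * eta N * x N ^+ 2 +
    A * eta N * x N ^+ 2); last by ring.
  by rewrite !addr_ge0.
have [B xB] : exists B, \forall n \near \oo, x n <= B.
  (* [A] bounds [N^2] times the pairing of [1 - a] with [v], and [2 / H] inverts the coefficient of
     [c^2]. *)
  pose K := 2 / H * (A + 1).
  have K0 : 0 <= K by rewrite mulr_ge0 ?addr_ge0// divr_ge0// ltW.
  apply: (@bootstrap_bounded _ x m eta theta U C' K) => // N.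
  have e1 : m N ^+ 2 * (H / 2) = N%:R ^+ 2 * normc (c N ^+ 2 * (H / 2)%:C).
    rewrite normcM normcX normc_real ger0_norm; last by rewrite divr_ge0// ltW.
    by rewrite /m exprMn mulrA.
  have e2 : N%:R ^+ 2 * normc (\sum_k (v 0 k)%:C * (1 - a N k)) <= A.
    apply: (@le_trans _ _ (N%:R ^+ 2 * (A * kappa N))).
      rewrite ler_wpM2l ?exprn_ge0//; apply: (le_trans (normc_sum _ _ _)).
      rewrite -[leRHS]mul1r -hv1 mulr_suml; apply: ler_sum => s _.
      by rewrite normcM normc_real ger0_norm ?ler_wpM2l// ltW.
    by rewrite mulrCA -[leRHS]mulr1 ler_wpM2l.
  have e3 : m N ^+ 2 * (H / 2) <= theta N * (1 + x N ^+ 2) + A.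
    rewrite e1; apply: le_trans (lerD (B3' N) e2); rewrite -mulrDr ler_wpM2l ?exprn_ge0//.
    apply: le_trans (le_normcD _ _).
    by rewrite subrK.
  have H2 : 0 < 2 / H by rewrite divr_gt0.
  have : 2 / H * (m N ^+ 2 * (H / 2)) <= 2 / H * (theta N * (1 + x N ^+ 2) + A).
    by rewrite ler_wpM2l// ltW.
  rewrite (_ : 2 / H * (m N ^+ 2 * (H / 2)) = m N ^+ 2); last first.
    by field; rewrite gt_eqF.
  move=> /le_trans; apply.
  have tx : 0 <= theta N * (1 + x N ^+ 2) by rewrite mulr_ge0// addr_ge0// sqr_ge0.
  have q1 : 0 <= A * (theta N * (1 + x N ^+ 2)) by rewrite mulr_ge0.
  set t := theta N * (1 + x N ^+ 2) in tx q1 *.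
  rewrite [leRHS](_ : _ = 2 / H * (A + 1 + (A + 1) * t)); last by rewrite /K /t; ring.
  by rewrite ler_wpM2l ?ltW//; lra.
pose y N : R[i] := N%:R * c N.
have ycvg : (fun N => normc (y N - zeta)) @ \oo --> 0.
  apply: normc_sqrt_cvg => //.
    move=> N; rewrite /y -(rmorph_nat (real_complex R)) complexReM /= mul0r subr0.
    by rewrite mulr_ge0.
  pose D := \sum_s normc (z s) ^+ 2.
  have H2 : 0 < 2 / H by rewrite divr_gt0.
  apply: (@cvg0_le _ _ (fun N => 2 / H * (theta N * (1 + B ^+ 2) + 4 * D * kappa N))).
    have N1 : \forall N \near \oo, (0 < N)%N by exists 1%N.
    apply: filterS2 N1 xB => N N1 xNB; apply/andP; split; first exact: normc_ge0.
    have N0 : N%:R != 0 :> R by rewrite pnatr_eq0 -lt0n.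
    have E1 t : t = 2 / H * (normc (H / 2)%:C * t).
      rewrite normc_real ger0_norm; last by rewrite divr_ge0// ltW.
      by field; rewrite gt_eqF.
    rewrite [leLHS]E1; apply: ler_wpM2l; first exact: ltW.
    rewrite -normcM mulrC mulrBl hzeta.
    (* Separates the error of the quadratic equation from that of replacing [N^2 (1 - a)] by [z]. *)
    rewrite (_ : _ - _ = ((N%:R ^+ 2 : R)%:C) * (c N ^+ 2 * (H / 2)%:C -
        \sum_k (v 0 k)%:C * (1 - a N k)) +
      \sum_k (v 0 k)%:C * ((N%:R ^+ 2 : R)%:C * (1 - a N k - (kappa N)%:C * z k))); last first.
      have kE : (N%:R ^+ 2 : R)%:C * (kappa N)%:C = 1.
        by rewrite -rmorphM mulfV ?rmorph1// sqrf_eq0.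
      have -> : \sum_k (v 0 k)%:C * ((N%:R ^+ 2 : R)%:C * (1 - a N k - (kappa N)%:C * z k)) =
         (N%:R ^+ 2 : R)%:C * \sum_k (v 0 k)%:C * (1 - a N k) - \sum_k (v 0 k)%:C * z k.
        rewrite mulr_sumr -sumrB; apply: eq_bigr => s _.
        by rewrite [_ * (_ - _ * _)]mulrBr [X in _ - X]mulrA kE mul1r; ring.
      by rewrite /y rmorphXn rmorph_nat; ring.
    apply: (le_trans (le_normcD _ _)); apply: lerD.
      rewrite normcM normc_real ger0_norm ?exprn_ge0//; apply: (le_trans (B3' N)).
      rewrite ler_wpM2l// lerD2l ler_pXn2r// nnegrE//.
      exact: le_trans (x0 N) xNB.
    apply: (le_trans (normc_sum _ _ _)); rewrite /D mulr_sumr mulr_suml.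
    apply: ler_sum => s _; rewrite !normcM !normc_real.
    have vs1 : `|v 0 s| <= 1.
      rewrite (ger0_norm (ltW (hv0 s))) -hv1 (bigD1 s)//= lerDl; apply: sumr_ge0 => j _.
      exact: ltW.
    rewrite -[leRHS]mul1r ler_pM ?normr_ge0 ?mulr_ge0 ?normc_ge0//.
    have := normc_1BcexpB_le (ReZ N s); rewrite normcZ => /(ler_wpM2l (normr_ge0 (N%:R ^+ 2))).
    move=> /le_trans; apply; rewrite ger0_norm ?exprn_ge0//.
    rewrite [leLHS](_ : _ = 4 * normc (z s) ^+ 2 * (N%:R ^+ 2 * kappa N * kappa N)); last by ring.
    apply: ler_wpM2l; first by apply: mulr_ge0 => //; exact: sqr_ge0.
    by rewrite ler_piMl.
  have c1 : (fun N => theta N * (1 + B ^+ 2)) @ \oo --> 0 * (1 + B ^+ 2).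
    by apply: cvgM => //; exact: cvg_cst.
  have c2 : (fun N => 4 * D * kappa N) @ \oo --> 4 * D * 0.
    by apply: cvgM; [exact: cvg_cst|exact: invn2_cvg0].
  by have := cvgM (cvg_cst (2 / H)) (cvgD c1 c2); rewrite mul0r mulr0 addr0 mulr0; apply.
(* [N h - zeta u] splits into [(N c - zeta) u] and [N (h - c u)]; the latter is at most [N rho],
   which vanishes because [x] is bounded. *)
apply: (@cvg0_le _ _ (fun N => normc (y N - zeta) * u 0 k + C * (eta N * B + A * N%:R^-1))).
  apply: filterS xB => N xNB; apply/andP; split; first exact: normc_ge0.
  rewrite (_ : _ - _ = (y N - zeta) * (u 0 k)%:C + N%:R * (h N k - c N * (u 0 k)%:C));
    last by rewrite /y; ring.
  apply: (le_trans (le_normcD _ _)); apply: lerD.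
    by rewrite normcM normc_real (ger0_norm (ltW (hu0 k))).
  rewrite normcM normc_nat.
  apply: (@le_trans _ _ (N%:R * rho N)); first by rewrite ler_wpM2l// le_sum_normc.
  by apply: (le_trans (Nrho N)); rewrite ler_wpM2l// lerD2r ler_wpM2l.
have c1 : (fun N => normc (y N - zeta) * u 0 k) @ \oo --> 0 * u 0 k.
  by apply: cvgM => //; exact: cvg_cst.
have c2 : (fun N => eta N * B) @ \oo --> 0 * B.
  by apply: cvgM => //; exact: cvg_cst.
have c3 : (fun N : nat => A * N%:R^-1) @ \oo --> A * 0.
  by apply: cvgM; [exact: cvg_cst|exact: invn_cvg0].
have := cvgD c1 (cvgM (cvg_cst C) (cvgD c2 c3)).
by rewrite !mul0r !(mulr0, addr0); apply.
Qed.

End Asymptotics.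

(** * Laplace transforms of the scaled counts *)

Section IidProduct.
Variables (R : realType) (V : nat).
Context d (T : measurableType d) (P : probability T R).
Variables (mu : probability (measurable_tree V) R)
  (omega : nat -> {mfun T >-> measurable_tree V}).
Hypothesis homega : iid P mu omega.

Lemma measurable_fibers_omega (n : nat) : measurable_fibers (fun w => tree_counts (omega n w)).
Proof.
move=> c; rewrite -[X in measurable X]setTI.
exact: (measurable_funP (omega n)) measurableT _ (@measurable_fibers_tree_counts V c).
Qed.

Lemma iid_fiber (N : nat) (y : nat -> offspring V) :
  P [set w | [seq tree_counts (omega n w) | n <- iota 0 N] = [seq y n | n <- iota 0 N]] =
  (\prod_(n <- iota 0 N) mu [set w | tree_counts w = y n])%E.
Proof.
have [ind law] := homega.
have mA n : measurable ([set w | tree_counts w = y n] : set (measurable_tree V)).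
  exact: (@measurable_fibers_tree_counts V).
have := ind (iota 0 N) (fun n => [set w | tree_counts w = y n]) (iota_uniq _ _) mA.
under eq_bigr do rewrite -[P _]/(distribution P (omega _) _) law//.
move=> <-; congr (P _); apply/seteqP; split=> w /=; first by move=> /eq_in_map.
by move=> h; apply/eq_in_map.
Qed.

Lemma cexpectation_iid_prod (a : 'I_V.+1 -> R[i]) (N : nat) :
  (forall s, normc (a s) <= 1) ->
  cexpectation P (fun w => \prod_(n < N) \prod_s a s ^+ particle_count s (omega n w)) =
  cexpectation mu (fun w => \prod_s a s ^+ particle_count s w) ^+ N.
Proof.
move=> a1; pose psi (c : offspring V) := \prod_s a s ^+ c s.
have psiE w : \prod_s a s ^+ particle_count s w = psi (tree_counts w).
  by apply: eq_bigr => s _; rewrite ffunE.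
have psi1 c : normc (psi c) <= 1.
  by apply: normc_prod_le1 => s _; exact: normcX_le1.
under eq_fun do under eq_bigr do rewrite psiE.
under [in RHS]eq_fun do rewrite psiE.
elim: N => [|N IH].
  by under eq_fun do rewrite big_ord0; rewrite cexpectation_cst expr0.
under eq_fun do rewrite big_ord_recr.
rewrite exprSr -IH.
pose Y w := [seq tree_counts (omega n w) | n <- iota 0 N].
have mY : measurable_fibers Y.
  exact: (@measurable_fibers_map _ _ _ _ (fun n w => tree_counts (omega n w)) _
    measurable_fibers_omega).
apply: (cexpectation_indep mY (measurable_fibers_omega N)
  (@measurable_fibers_tree_counts V) (B := 1) (B' := 1)) => //.
- by move=> w; apply: normc_prod_le1 => n _.
- move=> w w' /eq_in_map ww'; apply: eq_bigr => n _; rewrite ww'//.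
  by rewrite mem_iota /= add0n.
move=> w0 _ j.
(* The joint fiber of the first [N] counts and of the next one becomes a fiber of the first [N.+1]
   counts. *)
pose y n := if (n < N)%N then tree_counts (omega n w0) else j.
have yE : [seq y n | n <- iota 0 N] = Y w0.
  apply/eq_in_map => n; rewrite mem_iota/= add0n /y => ->//.
have iotaS : iota 0 N.+1 = iota 0 N ++ [:: N] by rewrite -addn1 iotaD add0n.
have -> : [set w | Y w = Y w0] `&` [set w | tree_counts (omega N w) = j] =
    [set w | [seq tree_counts (omega n w) | n <- iota 0 N.+1] = [seq y n | n <- iota 0 N.+1]].
  have yN : y N = j by rewrite /y ltnn.
  rewrite iotaS; apply/seteqP; split=> w /=; rewrite !map_cat yE /= yN.
    by move=> [Yw ->]; rewrite -/(Y w) Yw.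
  by move=> /eqP; rewrite eqseq_cat ?size_map ?size_iota// => /andP[/eqP Yw /eqP[->]].
rewrite iid_fiber -yE iid_fiber iotaS big_cat big_seq1.
by rewrite /y ltnn.
Qed.

End IidProduct.

Section LaplaceLimit.
Variables (R : realType) (V : nat) (p : 'I_V.+1 -> offspring V -> R).
Hypothesis hp : forall k, is_pmf (p k).
Hypothesis hM : forall k l, (emean p k l < +oo)%E.
Hypothesis hirr : irreducible (mean_matrix p).
Variable Ptree : 'I_V.+1 -> probability (measurable_tree V) R.
Hypothesis hlaw : forall k, is_GW_law p k (Ptree k).
Hypothesis hfin : forall k, {ae Ptree k, forall w, finite_set (particles w)}.
Variables (v u : 'rV[R]_V.+1).
Hypotheses (hv0 : forall s, 0 < v 0 s) (hu0 : forall s, 0 < u 0 s).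
Hypotheses (hv : v *m mean_matrix p = v) (hu : mean_matrix p *m u^T = u^T).
Hypotheses (hv1 : \sum_s v 0 s = 1) (hvu : \sum_s v 0 s * u 0 s = 1).
Hypothesis hvar : (\esum_(n in [set: offspring V])
  (Qmix p v n * (\sum_s (n s)%:R * u 0 s) ^+ 2)%:E < +oo)%E.
Local Notation H := (branching_variance Ptree v u).
Variable k : 'I_V.+1.
Context d (T : measurableType d) (P : probability T R).
Variable omega : nat -> {mfun T >-> measurable_tree V}.
Hypothesis homega : iid P (Ptree k) omega.
Variables (z : 'I_V.+1 -> R[i]) (zeta : R[i]).
Hypothesis hz : forall s, 0 <= complex.Re (z s).
Hypothesis hzeta : zeta ^+ 2 * (H / 2)%:C = \sum_s (v 0 s)%:C * z s.
Hypothesis hzeta0 : zeta = 0 \/ 0 < complex.Re zeta.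

Definition scaled_counts (N : nat) (w : T) : 'rV[R]_V.+1 :=
  (N%:R ^- 2) *: \sum_(n < N) count_vector R (omega n w).

Lemma scaled_countsE N w s : scaled_counts N w 0 s =
  N%:R ^- 2 * \sum_(n < N) (particle_count s (omega n w))%:R.
Proof.
rewrite !mxE summxE; congr (_ * _); apply: eq_bigr => n _.
by rewrite mxE.
Qed.

Lemma cexp_scaled_counts N w :
  cexp (- \sum_s z s * (scaled_counts N w 0 s)%:C) =
  \prod_(n < N) \prod_s scaled_weight z N s ^+ particle_count s (omega n w).
Proof.
rewrite exchange_big -sumrN cexp_sum; apply: eq_bigr => s _.
rewrite scaled_countsE rmorphM rmorph_sum /= mulrA mulr_sumr -sumrN cexp_sum.
apply: eq_bigr => n _; rewrite -mulNr -cexpMn; congr cexp.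
by rewrite rmorph_nat mulr_natr [z s * _]mulrC.
Qed.

(** The limit is written as [b^N] with [b = exp (- x / N)]. Both bases lie in the unit disk, so the
    powers differ by at most [N |g - b|], and [N (g - b)] compares [N h] with [x] up to a term of
    order 1/N. *)
Lemma Laplace_limit :
  (fun N => normc (cexpectation P
     (fun w => cexp (- \sum_s z s * (scaled_counts N w 0 s)%:C)) -
   cexp (- (zeta * (u 0 k)%:C)))) @ \oo --> 0.
Proof.
pose x := zeta * (u 0 k)%:C.
have Rex : 0 <= complex.Re x.
  rewrite complexReM /= mulr0 subr0 mulr_ge0//; last exact: ltW.
  by case: hzeta0 => [->//|/ltW].
pose h N := 1 - count_transform Ptree k (scaled_weight z N).
apply: (@cvg0_le _ _ (fun N => 4 * normc x ^+ 2 * N%:R^-1 + normc (N%:R * h N - x))).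
  have N1 : \forall N \near \oo, (0 < N)%N by exists 1%N.
  apply: filterS N1 => N N1; apply/andP; split; first exact: normc_ge0.
  have N0 : N%:R != 0 :> R by rewrite pnatr_eq0 -lt0n.
  have Ni : 0 <= N%:R^-1 :> R by rewrite invr_ge0.
  under eq_fun do rewrite cexp_scaled_counts.
  rewrite (cexpectation_iid_prod homega); last exact: normc_scaled_weight.
  pose b := cexp (- ((N%:R^-1)%:C * x)).
  have bN : cexp (- x) = b ^+ N.
    rewrite /b -cexpMn; congr cexp; rewrite mulNrn -mulrnAl -mulr_natr -(rmorph_nat (real_complex R)).
    by rewrite -rmorphM mulVf// mul1r.
  have Reb : 0 <= complex.Re ((N%:R^-1)%:C * x).
    by rewrite complexReM /= mul0r subr0 mulr_ge0.
  rewrite bN; apply: (le_trans (normcXB _ _ _)).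
  - by apply: normc_count_transform; exact: normc_scaled_weight.
  - by rewrite normc_cexp_le1// complexReN oppr_le0.
  rewrite -{1}(normc_nat R N) -normcM -/(count_transform Ptree k (scaled_weight z N)).
  have -> : N%:R * (count_transform Ptree k (scaled_weight z N) - b) =
      N%:R * (1 - b - (N%:R^-1)%:C * x) - (N%:R * h N - x).
    have e : (N%:R : R[i]) * (N%:R^-1)%:C = 1.
      by rewrite -(rmorph_nat (real_complex R)) -rmorphM mulfV.
    by rewrite [_ * (1 - b - _)]mulrBr mulrA e mul1r /h; ring.
  apply: (le_trans (normcB _ _)); rewrite lerD2r normcM normc_nat.
  apply: (le_trans (ler_wpM2l (ler0n _ N) (normc_1BcexpB_le Reb))).
  rewrite normcM normc_real ger0_norm//.
  rewrite [leLHS](_ : _ = 4 * normc x ^+ 2 * N%:R^-1)//; field.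
  by [].
have c1 : (fun N : nat => 4 * normc x ^+ 2 * N%:R^-1) @ \oo --> 4 * normc x ^+ 2 * 0.
  by apply: cvgM; [exact: cvg_cst|exact: invn_cvg0].
have c2 : (fun N => normc (N%:R * h N - x)) @ \oo --> 0.
  exact: (survival_asymptotics hp hM hirr hlaw hfin hv0 hu0 hv hu hv1 hvu hvar hz hzeta).
by have := cvgD c1 c2; rewrite mulr0 addr0; apply.
Qed.

End LaplaceLimit.

(** * Continuity theorem for characteristic functions *)

(** Uniform continuity at a compact set: only [x] is confined to [A], while [y] may leave it. *)
Lemma compact_uniform_continuity (R : realType) (X : pseudoMetricType R) (f : X -> R)
    (A : set X) : compact A -> continuous f -> forall e : R, 0 < e ->
  exists2 d : R, 0 < d & forall x y, A x -> ball x d y -> `|f x - f y| < e.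
Proof.
move=> cA cf e e0.
have e2 : 0 < e / 2 by rewrite divr_gt0.
have : \forall d \near (0 : R)^'+,
    A `<=` (fun x => forall y, ball x d y -> `|f x - f y| < e).
  apply: (compact_near_coveringP A).1 => // x Ax.
  have [d d0 dP] : exists2 d : R, 0 < d & forall y, ball x d y -> `|f x - f y| < e / 2.
    move: (cf x) => /cvgrPdist_lt/(_ _ e2) /nbhs_ballP [d d0 dP].
    by exists d.
  have d2 : 0 < d / 2 by rewrite divr_gt0.
  exists (ball x (d / 2), [set t : R | t < d / 2]) => /=.
    split; first exact: nbhsx_ballx.
    exact: nbhs_right_lt.
  move=> [x' t] /= [xx' td] y x'y.
  have h1 := dP x' (le_ball (_ : d / 2 <= d) xx').
  have h2 : ball x d y.
    by rewrite (splitr d); apply: ball_triangle xx' _; apply: le_ball x'y; exact: ltW.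
  have h3 := dP y h2.
  rewrite (_ : f x' - f y = (f x - f y) - (f x - f x')); last by ring.
  apply: (le_lt_trans (ler_normB _ _)).
  have := h1 (ltac:(lra)); lra.
move=> [d0 /= d0_gt0 H]; exists (d0 / 2); first by rewrite divr_gt0.
  move=> x y Ax; apply: (H (d0 / 2)) => //=.
    by rewrite sub0r normrN gtr0_norm ?divr_gt0// ltr_pdivrMr// ltr_pMr// ltr1n.
  by rewrite divr_gt0.
Qed.

(** * Uniform approximation by Bernstein polynomials *)

Section Bernstein.
Variable R : realType.
Implicit Types (phi : nat -> R) (t : R).

(* The Bernstein operator [\sum_j 'C(n, j) t ^+ j (1 - t) ^+ (n - j) phi j], in
   the form of its recursion on [n]. *)
Fixpoint bernstein n phi t : R :=
  if n is m.+1 then t * bernstein m (phi \o S) t + (1 - t) * bernstein m phi t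
  else phi 0.

Lemma bernsteinD n phi psi t :
  bernstein n (fun j => phi j + psi j) t = bernstein n phi t + bernstein n psi t.
Proof.
elim: n phi psi => [//|n IH] phi psi /=.
by rewrite (IH (phi \o S) (psi \o S)) IH; ring.
Qed.

Lemma bernsteinZ n a phi t : bernstein n (fun j => a * phi j) t = a * bernstein n phi t.
Proof.
elim: n phi => [//|n IH] phi /=.
by rewrite (IH (phi \o S)) IH; ring.
Qed.

Lemma bernstein_cst n c t : bernstein n (fun=> c) t = c.
Proof.
elim: n => [//|n IH] /=.
by rewrite (_ : (fun=> c) \o S = fun=> c)// IH; ring.
Qed.

Lemma le_bernstein n phi psi t : 0 <= t <= 1 -> (forall j, phi j <= psi j) ->
  bernstein n phi t <= bernstein n psi t.
Proof.
move=> /andP[t0 t1]; elim: n phi psi => [|n IH] phi psi le_phi /=; first exact: le_phi.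
by apply: lerD; apply: ler_wpM2l => //; try apply: IH => // j; rewrite ?subr_ge0// le_phi.
Qed.

(** The binomial variance plus the square of the shifted mean. The free shift [c] absorbs the
    successor in the recursion. *)
Lemma bernstein_sqr n c t : bernstein n (fun j => (j%:R + c) ^+ 2) t =
  n%:R * t * (1 - t) + (n%:R * t + c) ^+ 2.
Proof.
elim: n c => [|n IH] c /=; first by rewrite !mul0r !add0r.
rewrite (_ : _ \o S = fun j => (j%:R + (1 + c)) ^+ 2); last first.
  by apply/funext => j /=; rewrite -natr1 addrA.
by rewrite !IH -natr1; ring.
Qed.

(** Chebyshev's argument: with [d] from uniform continuity, [|f (j/n) - f t| <= e/2 + K (j/n - t)^2]
    for [K = 2 B / d^2], and the mean of the square is at most [1/n]. The inequality is proved for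
    all natural [j], as monotonicity of the operator is stated for all of them; hence the global
    bound on [f]. *)
Lemma bernstein_approx (f : R -> R) (B e : R) : continuous f -> (forall x, `|f x| <= B) ->
  0 < e -> exists n, forall t, 0 <= t <= 1 ->
    `|bernstein n (fun j => f (j%:R / n%:R)) t - f t| <= e.
Proof.
move=> cf fB e0; have B0 : 0 <= B by exact: le_trans (normr_ge0 _) (fB 0).
have e2 : 0 < e / 2 by rewrite divr_gt0.
have [d d0 dP] := compact_uniform_continuity (@segment_compact R 0 1) cf e2.
pose K := 2 * B / d ^+ 2.
have d2 : 0 < d ^+ 2 by rewrite exprn_gt0.
have K0 : 0 <= K by rewrite divr_ge0 ?mulr_ge0// ltW.
have [n nP] : exists n : nat, 2 * K / e < n%:R.
  by exists (Num.bound (2 * K / e)); apply: archi_boundP; apply: divr_ge0; [exact: mulr_ge0|exact: ltW].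
exists n => t t01; have /andP[t0 t1] := t01.
have n0 : 0 < n%:R :> R by apply: le_lt_trans nP; apply: divr_ge0; [exact: mulr_ge0|exact: ltW].
have key j : `|f (j%:R / n%:R) - f t| <= e / 2 + K / n%:R ^+ 2 * (j%:R + (- (n%:R * t))) ^+ 2.
  have E : K / n%:R ^+ 2 * (j%:R + (- (n%:R * t))) ^+ 2 = K * (j%:R / n%:R - t) ^+ 2.
    by field; rewrite gt_eqF.
  rewrite E; have Kx : 0 <= K * (j%:R / n%:R - t) ^+ 2 by rewrite mulr_ge0// sqr_ge0.
  have [td|td] := ltP `|t - j%:R / n%:R| d.
    rewrite distrC; apply: (@le_trans _ _ (e / 2)); last by rewrite lerDl.
    by apply/ltW/dP => //=; rewrite in_itv/= t0.
  apply: (@le_trans _ _ (2 * B)).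
    by apply: (le_trans (ler_normB _ _)); rewrite (_ : 2 * B = B + B); [exact: lerD|ring].
  apply: (@le_trans _ _ (K * d ^+ 2)); first by rewrite /K mulfVK// gt_eqF.
  apply: (@le_trans _ _ (K * (j%:R / n%:R - t) ^+ 2)); last by rewrite lerDr ltW.
  rewrite ler_wpM2l// -[leRHS]real_normK ?num_real// distrC.
  by rewrite ler_pXn2r// nnegrE// ltW.
have v1 : K / n%:R ^+ 2 * (n%:R * t * (1 - t)) <= e / 2.
  rewrite (_ : _ * _ = K / n%:R * (t * (1 - t))); last by field; rewrite gt_eqF.
  apply: (@le_trans _ _ (K / n%:R)).
    have k1 : 0 <= K / n%:R by apply: divr_ge0 => //; exact: ltW.
    have k2 : t * (1 - t) <= 1 by nra.
    by rewrite ler_piMr.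
  rewrite ler_pdivrMr// mulrC.
  move: nP; rewrite ltr_pdivrMr// => /ltW; lra.
have bE : bernstein n (fun j => e / 2 + K / n%:R ^+ 2 * (j%:R + (- (n%:R * t))) ^+ 2) t <= e.
  rewrite bernsteinD bernstein_cst bernsteinZ bernstein_sqr subrr expr0n addr0.
  lra.
have fE : bernstein n (fun j => f (j%:R / n%:R)) t - f t =
    bernstein n (fun j => f (j%:R / n%:R) + - f t) t.
  by rewrite bernsteinD bernstein_cst.
rewrite fE ler_norml; apply/andP; split.
  rewrite -[leLHS]mulN1r; apply: (@le_trans _ _ (-1 * bernstein n
    (fun j => e / 2 + K / n%:R ^+ 2 * (j%:R + (- (n%:R * t))) ^+ 2) t)).
    by rewrite !mulN1r lerN2.
  rewrite -bernsteinZ; apply: le_bernstein => // j; rewrite mulN1r.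
  by have := key j; rewrite ler_norml => /andP[].
apply: le_trans bE; apply: le_bernstein => // j.
by have := key j; rewrite ler_norml => /andP[].
Qed.

End Bernstein.

Definition tail (R : realType) (K : R) : R -> R := \1_[set x | K < `|x|].

Lemma measurable_tail (R : realType) (K : R) : measurable_fun setT (tail K).
Proof.
apply: measurable_indic; rewrite (_ : [set x | _] = ~` [set` `[- K, K]]).
  by apply: measurableC; exact: measurable_itv.
by apply/seteqP; split=> x /=; rewrite in_itv/= -ler_norml ltNge => /negP.
Qed.

(** * From trigonometric test functions to bounded continuous ones *)

Section CharfunContinuity.
Variable R : realType.
Context d d' (T : measurableType d) (T' : measurableType d').
Variables (P : probability T R) (P' : probability T' R).
Variables (X : nat -> T -> R) (Y : T' -> R).
Hypotheses (mX : forall n, measurable_fun setT (X n)) (mY : measurable_fun setT Y).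

Definition expectation_cvg (f : R -> R) :=
  (fun n => \int[P]_w f (X n w)) @ \oo --> \int[P']_w f (Y w).

Hypothesis hcos : forall t, expectation_cvg (fun x => cos (t * x)).
Hypothesis hsin : forall t, expectation_cvg (fun x => sin (t * x)).
Hypothesis htight : forall e : R, 0 < e -> exists2 K, 0 < K &
  \forall n \near \oo, \int[P]_w tail K (X n w) <= e.

Let bc (f : R -> R) := continuous f /\ exists B, forall x, `|f x| <= B.

Let bc_int f : bc f -> (forall n, P.-integrable setT (EFin \o (fun w => f (X n w)))) /\
  P'.-integrable setT (EFin \o (fun w => f (Y w))).
Proof.
move=> [cf [B fB]].
have mf := continuous_measurable_fun cf.
split=> [n|]; apply: (@bounded_integrable _ _ _ _ _ B) => [|w]; try exact: fB.
  exact: measurableT_comp mf (mX n).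
exact: measurableT_comp mf mY.
Qed.

Let bcD a b f g : bc f -> bc g -> bc (fun x => a * f x + b * g x).
Proof.
move=> [cf [B fB]] [cg [B' gB]]; split.
  by move=> x; apply: cvgD; apply: cvgM; try exact: cvg_cst; [exact: cf|exact: cg].
exists (`|a| * B + `|b| * B') => x; apply: (le_trans (ler_normD _ _)).
by rewrite !normrM lerD// ler_wpM2l.
Qed.

Let cvg_lin a b f g : bc f -> bc g -> expectation_cvg f -> expectation_cvg g ->
  expectation_cvg (fun x => a * f x + b * g x).
Proof.
move=> bf bg; have [if1 if2] := bc_int bf; have [ig1 ig2] := bc_int bg.
move=> cf cg; rewrite /expectation_cvg.
rewrite RintegralD//; try exact: integrable_scaler.
rewrite RintegralZl// RintegralZl//.
have -> : (fun n => \int[P]_w (a * f (X n w) + b * g (X n w))) =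
    (fun n => a * \int[P]_w f (X n w) + b * \int[P]_w g (X n w)).
  apply/funext => n; rewrite RintegralD//; try exact: integrable_scaler.
  by rewrite RintegralZl// RintegralZl.
by apply: cvgD; apply: cvgM => //; exact: cvg_cst.
Qed.

Let bcM f g : bc f -> bc g -> bc (fun x => f x * g x).
Proof.
move=> [cf [B fB]] [cg [B' gB]]; split.
  by move=> x; apply: cvgM; [exact: cf|exact: cg].
by exists (B * B') => x; rewrite normrM ler_pM.
Qed.

Let continuous_mull (t : R) : continuous (fun x : R => t * x).
Proof. by move=> x; apply: cvgM; [exact: cvg_cst|exact: cvg_id]. Qed.

Let bc_cos t : bc (fun x => cos (t * x)).
Proof.
split; last by exists 1 => x; exact: cos_max.
by move=> x; apply: (continuous_comp (@continuous_mull t x)); exact: continuous_cos.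
Qed.

Let bc_sin t : bc (fun x => sin (t * x)).
Proof.
split; last by exists 1 => x; exact: sin_max.
by move=> x; apply: (continuous_comp (@continuous_mull t x)); exact: continuous_sin.
Qed.

(* Closed under linear combinations and under multiplication by [sin (a * x)],
   hence containing all the polynomials in [sin (a * x)]. *)
Let trig_stable (h : R -> R) := bc h /\ forall t,
  expectation_cvg (fun x => h x * cos (t * x)) /\ expectation_cvg (fun x => h x * sin (t * x)).

Let trig_stable_cst c : trig_stable (fun=> c).
Proof.
split=> [|t].
  by split; [move=> x; exact: cvg_cst|exists `|c| => x].
have E (f : R -> R) : (fun x => c * f x) = (fun x => c * f x + 0 * f x).
  by apply/funext => x; rewrite mul0r addr0.
by split; rewrite E; apply: cvg_lin.
Qed.

Let trig_stableD a b f g : trig_stable f -> trig_stable g ->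
  trig_stable (fun x => a * f x + b * g x).
Proof.
move=> [bf cf] [bg cg]; split=> [|t]; first exact: bcD.
have [f1 f2] := cf t; have [g1 g2] := cg t.
have E (k : R -> R) : (fun x => (a * f x + b * g x) * k x) =
    (fun x => a * (f x * k x) + b * (g x * k x)).
  by apply/funext => x; ring.
by split; rewrite E; apply: cvg_lin => //; exact: bcM.
Qed.

(** By the product-to-sum formulas the frequency [t] is replaced by [a + t] and [a - t]; this is why
    [trig_stable] quantifies over all frequencies. *)
Let trig_stable_sin a f : trig_stable f -> trig_stable (fun x => sin (a * x) * f x).
Proof.
move=> [bf cf]; split=> [|t]; first exact: bcM.
have [f1 f2] := cf (a + t); have [g1 g2] := cf (a - t); split.
  rewrite (_ : (fun x => _) = (fun x => 2^-1 * (f x * sin ((a + t) * x)) +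
      2^-1 * (f x * sin ((a - t) * x)))).
    by apply: cvg_lin => //; exact: bcM.
  by apply/funext => x; rewrite (mulrDl a t x) (mulrBl x a t) sinD sinB; field.
rewrite (_ : (fun x => _) = (fun x => 2^-1 * (f x * cos ((a - t) * x)) +
    (- 2^-1) * (f x * cos ((a + t) * x)))).
  by apply: cvg_lin => //; exact: bcM.
by apply/funext => x; rewrite (mulrDl a t x) (mulrBl x a t) cosB cosD; field.
Qed.

Let trig_stable_bernstein a n phi :
  trig_stable (fun x => bernstein n phi ((1 + sin (a * x)) / 2)).
Proof.
elim: n phi => [|n IH] phi /=; first exact: trig_stable_cst.
have s1 := IH (phi \o S); have s2 := IH phi.
have := trig_stableD 2^-1 2^-1 (trig_stableD 1 1 s1 s2)
  (trig_stableD 1 (-1) (trig_stable_sin a s1) (trig_stable_sin a s2)).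
congr trig_stable; apply/funext => x.
by field.
Qed.

Let trig_stable_cvg h : trig_stable h -> expectation_cvg h.
Proof.
move=> [_ /(_ 0) []].
rewrite (_ : (fun x => h x * cos (0 * x)) = h)//.
by apply/funext => x; rewrite mul0r cos0 mulr1.
Qed.

Let tail01 (K x : R) : 0 <= tail K x <= 1.
Proof. by rewrite /tail indicE; case: (x \in _); rewrite ?ler01 ?lexx. Qed.

Let le_tail (K K' x : R) : K <= K' -> tail K' x <= tail K x.
Proof.
move=> KK'; rewrite /tail !indicE ler_nat; case: (boolP (x \in _)) => //.
rewrite inE /= => K'x; rewrite mem_set//=; exact: le_lt_trans KK' K'x.
Qed.

Let int_tail (K : R) :
  (forall n, P.-integrable setT (EFin \o (fun w => tail K (X n w)))) /\
  P'.-integrable setT (EFin \o (fun w => tail K (Y w))).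
Proof.
have tail1 x : `|tail K x| <= 1 by have /andP[t0 t1] := tail01 K x; rewrite ger0_norm.
split=> [n|]; apply: (@bounded_integrable _ _ _ _ _ 1) => [|w]; try exact: tail1.
  exact: measurableT_comp (measurable_tail K) (mX n).
exact: measurableT_comp (measurable_tail K) mY.
Qed.

(** For a single real variable the tails vanish pointwise, hence in mean. *)
Let limit_tight (e : R) : 0 < e -> exists2 K, 0 < K & \int[P']_w tail K (Y w) <= e.
Proof.
move=> e0.
have : (fun n : nat => \int[P']_w tail n.+1%:R (Y w)) @ \oo --> 0.
  apply: (@Rintegral_bounded_cvg0 _ _ _ _ _ 1).
  - by move=> n; exact: measurableT_comp (measurable_tail _) mY.
  - apply: aeW => w; apply: cvg_near_cst.
    exists (Num.bound `|Y w|) => // n /= wn.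
    rewrite /tail indicE memNset//= => /ltW; apply/negP; rewrite -ltNge.
    apply: lt_le_trans (archi_boundP (normr_ge0 (Y w))) _.
    by rewrite ler_nat leqW.
  - by move=> n w; have /andP[t0 t1] := tail01 n.+1%:R (Y w); rewrite ger0_norm.
move=> /cvgrPdist_le /(_ e e0) [n0 _ /(_ n0 (leqnn _))]; rewrite sub0r normrN => h.
by exists n0.+1%:R => //; exact: le_trans (ler_norm _) h.
Qed.

(* With [a * K = 1 / 2], [g] is on [[- K, K]] a continuous function of
   [sin (a * x)], approximated by the Bernstein polynomials; these stay bounded
   outside of [[- K, K]], where tightness applies. *)
Lemma charfun_continuity (g : R -> R) : continuous g ->
  (exists B, forall x, `|g x| <= B) -> expectation_cvg g.
Proof.
move=> cg [B gB]; have B0 : 0 <= B by exact: le_trans (normr_ge0 _) (gB 0).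
apply/cvgrPdist_le => e0 e0_gt0.
(* The total error is twice [e + (2 * B + e) * e], plus [e]; with [e <= 1] this is at most
   [(4 * B + 5) * e]. *)
pose e := Num.min 1 (e0 / (4 * B + 5)).
have D0 : 0 < 4 * B + 5 by lra.
have e_gt0 : 0 < e by rewrite lt_min ltr01 divr_gt0.
have e_le1 : e <= 1 by rewrite ge_min lexx.
have e_le : e * (4 * B + 5) <= e0 by rewrite -ler_pdivlMr// ge_min lexx orbT.
have [K1 K1_gt0 K1P] := htight e_gt0.
have [K2 K2_gt0 K2P] := limit_tight e_gt0.
pose K := Num.max K1 K2.
have K1K : K1 <= K by rewrite le_max lexx.
have K2K : K2 <= K by rewrite le_max lexx orbT.
have K_gt0 : 0 < K by exact: lt_le_trans K1_gt0 K1K.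
pose a := (2 * K)^-1.
have a_gt0 : 0 < a by rewrite invr_gt0 mulr_gt0.
have aK : a * K = 2^-1 by rewrite /a; field; rewrite gt_eqF.
(* Keeps the argument of [asin] away from the endpoints, so that [F] is continuous on the whole
   line; for [|x| <= K] one has [|sin (a * x)| <= 1/2] and nothing is clipped. *)
pose clip (y : R) := Num.max (- 2^-1) (Num.min 2^-1 y).
have clip_bnd y : - 2^-1 <= clip y <= 2^-1.
  rewrite /clip le_max lexx/= ge_max ge_min lexx/= andbT; lra.
have clip_id y : - 2^-1 <= y <= 2^-1 -> clip y = y.
  by move=> /andP[y1 y2]; rewrite /clip (min_idPr y2) (max_idPr y1).
pose F (y : R) := g (asin (clip y) / a).
(* Moves the interval [[-1, 1]] of the sine to [[0, 1]], where the Bernstein polynomials live. *)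
pose G (t : R) := F (2 * t - 1).
have cclip : continuous clip.
  move=> x; apply: (@continuous_max R R (fun=> - 2^-1) (fun y => Num.min 2^-1 y)).
    exact: cvg_cst.
  by apply: (@continuous_min R R (fun=> 2^-1) id); [exact: cvg_cst|exact: cvg_id].
have cF : continuous F.
  move=> y; apply: (@continuous_comp _ _ _ (fun y => asin (clip y) / a) g); last exact: cg.
  apply: cvgM; last exact: cvg_cst.
  apply: (@continuous_comp _ _ _ clip asin); first exact: cclip.
  apply: continuous_asin; have := clip_bnd y; lra.
have cG : continuous G.
  move=> t; apply: (@continuous_comp R R R (fun t : R => 2 * t - 1) F); last exact: cF.
  by apply: cvgB; [exact: continuous_mull|exact: cvg_cst].
have GB t : `|G t| <= B by exact: gB.
have [n nP] := bernstein_approx cG GB e_gt0.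
pose h x := bernstein n (fun j => G (j%:R / n%:R)) ((1 + sin (a * x)) / 2).
have hG x : `|h x - F (sin (a * x))| <= e.
  have -> : F (sin (a * x)) = G ((1 + sin (a * x)) / 2).
    by rewrite /G; congr F; field.
  by apply: nP; have := sin_le1 (a * x); have := sin_geN1 (a * x); lra.
have gh x : `|g x - h x| <= e + (2 * B + e) * tail K x.
  have /andP[t0 t1] := tail01 K x.
  have [xK|xK] := leP `|x| K.
    apply: (@le_trans _ _ e); last first.
      by rewrite lerDl mulr_ge0// addr_ge0 ?mulr_ge0// ltW.
    have ax : `|a * x| <= 2^-1.
      by rewrite normrM (gtr0_norm a_gt0) -aK ler_wpM2l// ltW.
    have sx : `|sin (a * x)| <= 2^-1 by exact: le_trans (normr_sin_le _) ax.
    have -> : g x = F (sin (a * x)).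
      rewrite /F clip_id -?ler_norml// sinK; last first.
        rewrite in_itv/=; have := @pihalf_ge1 R; move: ax; rewrite ler_norml; lra.
      by congr g; field; rewrite gt_eqF.
    by rewrite distrC.
  have -> : tail K x = 1 by rewrite /tail indicE mem_set.
  have h1 : `|g x - h x| <= `|g x - F (sin (a * x))| + `|h x - F (sin (a * x))|.
    rewrite (_ : g x - h x = (g x - F (sin (a * x))) - (h x - F (sin (a * x)))); last by ring.
    exact: ler_normB.
  apply: (le_trans h1); rewrite addrC; apply: lerD; first exact: hG.
  rewrite mulr1; apply: (le_trans (ler_normB _ _)).
  by have := gB x; have := GB ((1 + sin (a * x)) / 2); have := gB (asin (clip (sin (a * x))) / a);
    rewrite -/(F _); lra.
have bg : bc g by split=> //; exists B.
have sh : trig_stable h by exact: trig_stable_bernstein.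
have bh := sh.1.
have [ig1 ig2] := bc_int bg; have [ih1 ih2] := bc_int bh.
have [it1 it2] := int_tail K.
have step d0 (T0 : measurableType d0) (P0 : probability T0 R) (Z : T0 -> R) :
    P0.-integrable setT (EFin \o (fun w => g (Z w))) ->
    P0.-integrable setT (EFin \o (fun w => h (Z w))) ->
    P0.-integrable setT (EFin \o (fun w => tail K (Z w))) ->
    \int[P0]_w tail K (Z w) <= e ->
    `|\int[P0]_w g (Z w) - \int[P0]_w h (Z w)| <= e + (2 * B + e) * e.
  move=> ig ih it tl; rewrite -RintegralB//.
  have igh : P0.-integrable setT (EFin \o (fun w => g (Z w) - h (Z w))).
    under eq_fun do rewrite -mulN1r.
    by apply: integrable_addr => //; exact: integrable_scaler.
  have ie : P0.-integrable setT (EFin \o (fun=> e)).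
    exact: finite_measure_integrable_cst.
  apply: (le_trans (le_normr_Rintegral measurableT igh)).
  apply: (@le_trans _ _ (\int[P0]_w (e + (2 * B + e) * tail K (Z w)))).
    apply: le_Rintegral => //; first exact: integrable_norm.
    by apply: integrable_addr => //; exact: integrable_scaler.
  rewrite RintegralD//; last exact: integrable_scaler.
  rewrite RintegralZl// Rintegral_cst// [X in _ * fine X]probability_setT mulr1 lerD2l.
  by rewrite ler_wpM2l// addr_ge0 ?mulr_ge0// ltW.
have sY : `|\int[P']_w g (Y w) - \int[P']_w h (Y w)| <= e + (2 * B + e) * e.
  apply: step => //; apply: le_trans K2P; apply: le_Rintegral => //.
    exact: (int_tail K2).2.
  by move=> w _; exact: le_tail.
have hcv : \forall n \near \oo, `|\int[P']_w h (Y w) - \int[P]_w h (X n w)| <= e.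
  by move/cvgrPdist_le: (trig_stable_cvg sh) => /(_ _ e_gt0).
apply: filterS2 K1P hcv => m K1m hm.
have sX : `|\int[P]_w g (X m w) - \int[P]_w h (X m w)| <= e + (2 * B + e) * e.
  apply: step => //; apply: le_trans K1m; apply: le_Rintegral => //.
    exact: (int_tail K1).1.
  by move=> w _; exact: le_tail.
move: sX sY hm; set gX := \int[P]_w g _; set hX := \int[P]_w h _.
set gY := \int[P']_w g _; set hY := \int[P']_w h _ => sX sY hm.
rewrite (_ : gY - gX = (gY - hY) + (hY - hX) - (gX - hX)); last by ring.
apply: (le_trans (ler_normB _ _)); apply: (le_trans (lerD (ler_normD _ _) (lexx _))).
have : e * e <= e by rewrite ler_piMr// ltW.
lra.
Qed.

End CharfunContinuity.

(** * The limit law *)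

Lemma cvg_complex_parts (R : realType) (f : nat -> R[i]) (l : R[i]) :
  (fun n => normc (f n - l)) @ \oo --> 0 ->
  (fun n => complex.Re (f n)) @ \oo --> complex.Re l /\
  (fun n => complex.Im (f n)) @ \oo --> complex.Im l.
Proof.
move=> fl; split; apply/cvgrPdist_le => e e0; move/cvgrPdist_le: fl => /(_ e e0);
  apply: filterS => n; rewrite sub0r normrN ger0_norm ?normc_ge0//; apply: le_trans;
  rewrite distrC.
  by rewrite -complexReN -complexReD normr_Re_le.
by rewrite -complexImN -complexImD normr_Im_le.
Qed.

Lemma cexp_real (R : realType) (x : R) : cexp x%:C = (expR x)%:C.
Proof. by apply: complex_ext; rewrite /= ?cos0 ?sin0 ?mulr1 ?mulr0. Qed.

Lemma cexp_imaginary (R : realType) (x : R) : cexp (0 +i* x) = cos x +i* sin x.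
Proof. by apply: complex_ext; rewrite /= expR0 mul1r. Qed.

Section LimitLaw.
Variables (R : realType) (V : nat) (p : 'I_V.+1 -> offspring V -> R).
Hypothesis hp : forall k, is_pmf (p k).
Hypothesis hM : forall k l, (emean p k l < +oo)%E.
Hypothesis hirr : irreducible (mean_matrix p).
Variable Ptree : 'I_V.+1 -> probability (measurable_tree V) R.
Hypothesis hlaw : forall k, is_GW_law p k (Ptree k).
Hypothesis hfin : forall k, {ae Ptree k, forall w, finite_set (particles w)}.
Variables (v u : 'rV[R]_V.+1).
Hypotheses (hv0 : forall s, 0 < v 0 s) (hu0 : forall s, 0 < u 0 s).
Hypotheses (hv : v *m mean_matrix p = v) (hu : mean_matrix p *m u^T = u^T).
Hypotheses (hv1 : \sum_s v 0 s = 1) (hvu : \sum_s v 0 s * u 0 s = 1).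
Hypothesis hvar : (\esum_(n in [set: offspring V])
  (Qmix p v n * (\sum_s (n s)%:R * u 0 s) ^+ 2)%:E < +oo)%E.
Local Notation H := (branching_variance Ptree v u).
Variable k : 'I_V.+1.
Context d (T : measurableType d) (P : probability T R).
Variable omega : nat -> {mfun T >-> measurable_tree V}.
Hypothesis homega : iid P (Ptree k) omega.

Let S := scaled_counts R omega : nat -> T -> 'rV[R]_V.+1.
Let tot N w := \sum_s S N w 0 s.
Let dev i N w := S N w 0 i - v 0 i * tot N w.

Let H_gt0 : 0 < H.
Proof. exact: (branching_variance_gt0 hp hM hlaw hfin hv0 hu0 hu hvar). Qed.

Let limit z zeta := Laplace_limit hp hM hirr hlaw hfin hv0 hu0 hv hu hv1 hvu hvar homega
  (z := z) (zeta := zeta).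

(** The scaled counts factor through the countable type of lists of count vectors, so any [F] may be
    composed with them. *)
Lemma measurable_scaled_counts d0 (T0 : measurableType d0) (F : 'rV[R]_V.+1 -> T0) N :
  measurable_fun setT (fun w => F (scaled_counts R omega N w)).
Proof.
pose Y w := [seq tree_counts (omega n w) | n <- iota 0 N].
have mY : measurable_fibers Y.
  exact: (@measurable_fibers_map _ _ _ _ (fun n w => tree_counts (omega n w)) _
    (measurable_fibers_omega omega)).
pose Phi (l : seq (offspring V)) : 'rV[R]_V.+1 :=
  N%:R ^- 2 *: \sum_(n < N) \row_s (nth [ffun=> 0%N] l n s)%:R.
rewrite (_ : (fun w => _) = F \o Phi \o Y); first exact: (measurable_fibers_fun (F \o Phi) mY).
apply/funext => w /=; congr F; rewrite /scaled_counts /Phi; congr (_ *: _).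
apply: eq_bigr => n _; apply/rowP => s; rewrite !mxE.
rewrite (nth_map 0%N) ?size_iota// nth_iota// add0n.
by rewrite ffunE.
Qed.

Let S_ge0 N w s : 0 <= S N w 0 s.
Proof.
rewrite /S scaled_countsE; apply: mulr_ge0; last exact: sumr_ge0.
by rewrite invr_ge0 exprn_ge0.
Qed.

Let tot_ge0 N w : 0 <= tot N w.
Proof. exact: sumr_ge0. Qed.

Let S_le_tot N w s : S N w 0 s <= tot N w.
Proof. by rewrite /tot (bigD1 s)//= lerDl; apply: sumr_ge0 => j _; exact: S_ge0. Qed.

Let mtot d0 (T0 : measurableType d0) (F : R -> T0) N :
  measurable_fun setT (fun w => F (tot N w)).
Proof. exact: (measurable_scaled_counts (fun x : 'rV[R]_V.+1 => F (\sum_s x 0 s))). Qed.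

(** The real argument [eta^2 H / 2], the same for all types, has [eta] as its root [zeta] because
    [v] sums to 1. Tightness rests on this limit. *)
Let tot_Laplace (eta : R) : 0 < eta ->
  (fun N => \int[P]_w expR (- (eta ^+ 2 * (H / 2) * tot N w))) @ \oo -->
  expR (- (eta * u 0 k)).
Proof.
move=> eta0; pose lam := eta ^+ 2 * (H / 2).
have lam0 : 0 < lam by rewrite mulr_gt0 ?exprn_gt0// divr_gt0.
have /cvg_complex_parts [h _] : (fun N => normc
    ((\int[P]_w expR (- (lam * tot N w)))%:C - (expR (- (eta * u 0 k)))%:C)) @ \oo --> 0.
  have h := @limit (fun=> lam%:C) eta%:C _ _ _.
  rewrite -cexp_real rmorphN rmorphM.
  rewrite (_ : (fun N => _) = (fun N => normc (cexpectation P (fun w =>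
    cexp (- \sum_s lam%:C * (S N w 0 s)%:C)) - cexp (- (eta%:C * (u 0 k)%:C))))); last first.
    apply/funext => N; rewrite -cexpectation_real; congr (normc (cexpectation _ _ - _)).
    by apply/funext => w; rewrite -cexp_real rmorphN rmorphM rmorph_sum mulr_sumr.
  apply: h.
  - by move=> s; exact: ltW.
  - by rewrite -mulr_suml -rmorph_sum hv1 rmorph1 mul1r /lam [RHS]rmorphM rmorphXn.
  - by right.
exact: h.
Qed.

(** For [t > K] one has [exp (- t / K) <= 1 / (1 + t / K) <= 1/2]. *)
Let tail_le (t : R) (K : R) : 0 < K -> 0 <= t -> tail K t <= 2 * (1 - expR (- (K^-1 * t))).
Proof.
move=> K0 t0; rewrite /tail indicE.
have e1 : expR (- (K^-1 * t)) <= 1.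
  by rewrite -expR0 ler_expR oppr_le0 mulr_ge0// invr_ge0 ltW.
case: (boolP (t \in _)) => [|_] /=; last by lra.
rewrite inE /= ger0_norm// => Kt.
have : expR (- (K^-1 * t)) <= 2^-1; last by lra.
rewrite expRN lef_pV2 ?posrE ?expR_gt0//.
have h : 1 <= K^-1 * t by rewrite mulrC ler_pdivlMr// mul1r ltW.
by have := expR_ge1Dx (K^-1 * t); lra.
Qed.

Let tot_tight (e : R) : 0 < e -> exists2 K, 0 < K &
  \forall N \near \oo, \int[P]_w tail K (tot N w) <= e.
Proof.
(* The limit of the Laplace transform is then at least [1 - e/4]; another [e/4] pays for the
   convergence, and [tail_le] doubles the sum. *)
move=> e0; pose eta := e / (4 * u 0 k).
have uk := hu0 k.
have eta0 : 0 < eta by rewrite divr_gt0// mulr_gt0.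
pose lam := eta ^+ 2 * (H / 2).
have lam0 : 0 < lam by rewrite mulr_gt0 ?exprn_gt0// divr_gt0.
exists lam^-1; first by rewrite invr_gt0.
have e4 : 0 < e / 4 by rewrite divr_gt0.
have /cvgrPdist_le/(_ _ e4) := tot_Laplace eta0.
apply: filterS => N hN.
have ie : P.-integrable setT (EFin \o (fun w => expR (- (lam * tot N w)))).
  apply: (@bounded_integrable _ _ _ _ _ 1); first exact: (mtot (fun t => expR (- (lam * t)))).
  move=> w; rewrite ger0_norm ?expR_ge0// -expR0 ler_expR oppr_le0 mulr_ge0//.
  exact: ltW.
have i1 : P.-integrable setT (EFin \o (fun=> 1 : R)) by exact: finite_measure_integrable_cst.
have ii : P.-integrable setT (EFin \o (fun w => 1 - expR (- (lam * tot N w)))).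
  under eq_fun do rewrite -mulN1r.
  by apply: integrable_addr => //; exact: integrable_scaler.
apply: (@le_trans _ _ (\int[P]_w (2 * (1 - expR (- (lam * tot N w)))))).
  apply: le_Rintegral => //.
  - apply: (@bounded_integrable _ _ _ _ _ 1); first exact: (mtot (tail lam^-1)).
    by move=> w; rewrite /tail indicE; case: (_ \in _); rewrite ?normr1 ?normr0 ?ler01.
  - exact: integrable_scaler.
  - move=> w _; have := @tail_le (tot N w) lam^-1 _ (tot_ge0 N w).
    by rewrite invrK; apply; rewrite invr_gt0.
rewrite RintegralZl// RintegralB// Rintegral_cst// [X in _ * fine X]probability_setT mulr1.
have := expR_ge1Dx (- (eta * u 0 k)).
have -> : eta * u 0 k = e / 4 by rewrite /eta; field; rewrite gt_eqF.
move: hN; rewrite ler_norml => /andP[_]; rewrite -/lam.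
have -> : eta * u 0 k = e / 4 by rewrite /eta; field; rewrite gt_eqF.
by set I := \int[P]_w _; lra.
Qed.

(** The transform at imaginary arguments gives the characteristic function of a linear combination
    of the coordinates; it is applied to the total and to the deviations. *)
Let charfun_limit (b : 'I_V.+1 -> R) (t : R) (zeta : R[i]) :
  zeta ^+ 2 * (H / 2)%:C = 0 -i* (t * \sum_s v 0 s * b s) ->
  zeta = 0 \/ 0 < complex.Re zeta ->
  (fun N => \int[P]_w cos (t * \sum_s b s * S N w 0 s)) @ \oo -->
    complex.Re (cexp (- (zeta * (u 0 k)%:C))) /\
  (fun N => \int[P]_w sin (t * \sum_s b s * S N w 0 s)) @ \oo -->
    complex.Im (cexp (- (zeta * (u 0 k)%:C))).
Proof.
move=> hz hz0; pose z s : R[i] := 0 -i* (t * b s).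
have E N w : cexp (- \sum_s z s * (S N w 0 s)%:C) =
    cexp (0 +i* (t * \sum_s b s * S N w 0 s)).
  congr cexp; apply: complex_ext.
    rewrite complexReN complexRe_sum big1 ?oppr0// => s _.
    by rewrite complexReM /= mulr0 mul0r subr0.
  rewrite complexImN complexIm_sum /= mulr_sumr -sumrN; apply: eq_bigr => s _.
  by rewrite /=; ring.
have /cvg_complex_parts [h1 h2] : (fun N => normc (cexpectation P (fun w =>
    cos (t * \sum_s b s * S N w 0 s) +i* sin (t * \sum_s b s * S N w 0 s)) -
    cexp (- (zeta * (u 0 k)%:C)))) @ \oo --> 0.
  have h := @limit z zeta _ _ hz0.
  rewrite (_ : (fun N => _) = (fun N => normc (cexpectation P (fun w =>
    cexp (- \sum_s z s * (S N w 0 s)%:C)) - cexp (- (zeta * (u 0 k)%:C))))); last first.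
    apply/funext => N; congr (normc (cexpectation _ _ - _)).
    by apply/funext => w; rewrite E cexp_imaginary.
  apply: h => //; rewrite hz; apply: complex_ext.
    rewrite /= complexRe_sum [RHS]big1// => s _.
    by rewrite /=; ring.
  rewrite complexIm_sum /= mulr_sumr -sumrN; apply: eq_bigr => s _.
  by rewrite /=; ring.
by split; [exact: h1|exact: h2].
Qed.

(** * Identification of the stable limit and convergence of the vectors *)

Section StableLimit.
Context d' (T' : measurableType d') (P' : probability T' R).
Variable xi : {RV P' >-> R}.
Hypothesis hxi : forall t : R,
  charfun P' xi t = cexp (- ((1 -i* Num.sg t) * (Num.sqrt `|t|)%:C)).

Let Y w := u 0 k ^+ 2 * xi w / H.

(** As [(1 - i sign t)^2 = - 2 i sign t], the square of [zeta] times [H / 2] is [- i t], and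
    [Re zeta > 0] unless t = 0. The factor [u_k^2 / H] in front of [xi] passes through the square
    root as [u_k / sqrt H]. *)
Let charfun_Y t : let zeta := (1 -i* Num.sg t) * (Num.sqrt (`|t| / H))%:C in
  [/\ zeta ^+ 2 * (H / 2)%:C = 0 -i* (t * \sum_s v 0 s * 1),
      zeta = 0 \/ 0 < complex.Re zeta,
      complex.Re (cexp (- (zeta * (u 0 k)%:C))) = \int[P']_w cos (t * Y w) &
      complex.Im (cexp (- (zeta * (u 0 k)%:C))) = \int[P']_w sin (t * Y w)].
Proof.
move=> zeta.
have tH0 : 0 <= `|t| / H by rewrite divr_ge0// ltW.
have Hn0 : H != 0 by rewrite gt_eqF.
have c0 : 0 < u 0 k ^+ 2 / H by rewrite divr_gt0// exprn_gt0.
have E : cexp (- (zeta * (u 0 k)%:C)) = charfun P' xi (t * (u 0 k ^+ 2 / H)).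
  rewrite hxi; congr (cexp (- _)); rewrite /zeta -mulrA -rmorphM.
  rewrite sgrM (gtr0_sg c0) mulr1 normrM (gtr0_norm c0).
  congr (_ * _%:C); rewrite -[X in _ * X](gtr0_norm (hu0 k)) -(sqrtr_sqr (u 0 k)) -sqrtrM//.
  by congr Num.sqrt; field.
have Yt w : t * (u 0 k ^+ 2 / H) * xi w = t * Y w by rewrite /Y; field.
split.
- under eq_bigr do rewrite mulr1.
  rewrite hv1 mulr1 /zeta exprMn -rmorphXn sqr_sqrtr// -mulrA -rmorphM.
  rewrite (_ : `|t| / H * (H / 2) = `|t| / 2); last by field.
  have st : t = Num.sg t * `|t| := numEsg t.
  have [t0|t0] := eqVneq t 0.
    by rewrite t0 normr0 mul0r rmorph0 mulr0; apply: complex_ext; rewrite /= ?oppr0.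
  have s2 : Num.sg t ^+ 2 = 1 by rewrite sqr_sg t0.
  have -> : (1 -i* Num.sg t : R[i]) ^+ 2 = 0 -i* (2 * Num.sg t).
    rewrite expr2; apply: complex_ext; rewrite ?complexReM ?complexImM /=; last by ring.
    by rewrite mulr1 mulrNN -expr2 s2 subrr.
  apply: complex_ext; rewrite ?complexReM ?complexImM /=; first by ring.
  by rewrite [in RHS]st; field.
- have [t0|t0] := eqVneq t 0.
    by left; rewrite /zeta t0 normr0 mul0r sqrtr0 rmorph0 mulr0.
  right; rewrite /zeta complexReM /= mul1r mulr0 subr0 sqrtr_gt0.
  by rewrite divr_gt0// normr_gt0.
- rewrite E /= ; apply: eq_Rintegral => w _.
  by rewrite expR0 mul1r Yt.
- rewrite E /= ; apply: eq_Rintegral => w _.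
  by rewrite expR0 mul1r Yt.
Qed.

Let totE N w : \sum_s 1 * S N w 0 s = tot N w.
Proof. by apply: eq_bigr => s _; rewrite mul1r. Qed.

Lemma total_cvg_in_distribution (g : R -> R) : continuous g ->
  (exists B, forall x, `|g x| <= B) ->
  (fun N => \int[P]_w g (tot N w)) @ \oo --> \int[P']_w g (Y w).
Proof.
move=> cg bg; apply: (@charfun_continuity R _ _ T T' P P' tot Y) => //.
- by move=> N; exact: (mtot id).
- apply: measurable_funM; last exact: measurable_cst.
  by apply: measurable_funM; [exact: measurable_cst|exact: measurable_funP].
- move=> t; rewrite /expectation_cvg; have [h1 h2 <- _] := charfun_Y t.
  have [+ _] := charfun_limit h1 h2.
  by under eq_fun do under eq_Rintegral do rewrite totE.
- move=> t; rewrite /expectation_cvg; have [h1 h2 _ <-] := charfun_Y t.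
  have [_ +] := charfun_limit h1 h2.
  by under eq_fun do under eq_Rintegral do rewrite totE.
Qed.

Let devE i N w : \sum_s ((s == i)%:R - v 0 i) * S N w 0 s = dev i N w.
Proof.
rewrite /dev /tot mulr_sumr; under eq_bigr do rewrite mulrBl.
rewrite sumrB; congr (_ - _); rewrite (bigD1 i)//= eqxx mul1r big1 ?addr0//.
by move=> s /negbTE ->; rewrite mul0r.
Qed.

Let dev_le i N w : `|dev i N w| <= 2 * tot N w.
Proof.
have v1 : v 0 i <= 1.
  by rewrite -hv1 (bigD1 i)//= lerDl; apply: sumr_ge0 => j _; exact: ltW.
apply: (le_trans (ler_normB _ _)); rewrite mulr_natl mulr2n lerD//.
  by rewrite ger0_norm.
by rewrite normrM (ger0_norm (ltW (hv0 i))) (ger0_norm (tot_ge0 N w)) ler_piMl.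
Qed.

(** The characteristic functions tend to 1, that of the constant 0, and tightness is inherited from
    the total. The test function [min 1 |x|] is bounded and continuous and expresses convergence in
    probability. *)
Lemma deviation_cvg0 i :
  (fun N => \int[P]_w Num.min 1 `|dev i N w|) @ \oo --> 0.
Proof.
have mdev d0 (T0 : measurableType d0) (F : R -> T0) N :
    measurable_fun setT (fun w => F (dev i N w)).
  exact: (measurable_scaled_counts (fun x : 'rV[R]_V.+1 => F (x 0 i - v 0 i * \sum_s x 0 s))).
have hz (t : R) : (0 : R[i]) ^+ 2 * (H / 2)%:C =
    0 -i* (t * \sum_s v 0 s * ((s == i)%:R - v 0 i)).
  have -> : \sum_s v 0 s * ((s == i)%:R - v 0 i) = 0.
    under eq_bigr do rewrite mulrBr.
    rewrite sumrB -mulr_suml hv1 mul1r (bigD1 i)//= eqxx mulr1 big1 ?addr0 ?subrr//.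
    by move=> s /negbTE ->; rewrite mulr0.
  by rewrite expr0n /= mul0r mulr0 oppr0.
have e0 : cexp (- ((0 : R[i]) * (u 0 k)%:C)) = 1 by rewrite mul0r oppr0 cexp0.
have lim0 t := charfun_limit (hz t) (or_introl erefl).
have -> : (0 : R) = \int[P']_w Num.min 1 `|(cst 0 w : R)|.
  rewrite (eq_Rintegral _ (g := cst 0)) ?Rintegral_cst ?mul0r// => w _.
  by rewrite /= normr0 (min_idPr ler01).
apply: (@charfun_continuity R _ _ T T' P P' (dev i) (cst 0) _ _ _ _ _ (fun x => Num.min 1 `|x|)) => //.
- by move=> N; exact: (mdev _ _ id).
- move=> t; have [+ _] := lim0 t; rewrite e0.
  under eq_fun do under eq_Rintegral do rewrite devE.
  rewrite /expectation_cvg (eq_Rintegral _ (g := cst 1)); last first.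
    by move=> w _; rewrite /= mulr0 cos0.
  by rewrite Rintegral_cst// [X in _ * fine X]probability_setT mulr1.
- move=> t; have [_ +] := lim0 t; rewrite e0.
  under eq_fun do under eq_Rintegral do rewrite devE.
  rewrite /expectation_cvg (eq_Rintegral _ (g := cst 0)); last first.
    by move=> w _; rewrite /= mulr0 sin0.
  by rewrite Rintegral_cst// mul0r.
- move=> e e_gt0; have [K K0 KP] := tot_tight e_gt0.
  exists (2 * K); first by rewrite mulr_gt0.
  apply: filterS KP => N; apply: le_trans.
  have tail1 K' x : `|tail K' x| <= 1 :> R.
    by rewrite /tail indicE; case: (_ \in _); rewrite ?normr1 ?normr0 ?ler01.
  apply: le_Rintegral => //.
  + by apply: (@bounded_integrable _ _ _ _ _ 1) => //; exact: (mdev _ _ (tail (2 * K))).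
  + by apply: (@bounded_integrable _ _ _ _ _ 1) => //; exact: (mtot (tail K)).
  + move=> w _; rewrite /tail !indicE ler_nat.
    case: (boolP (dev i N w \in _)) => //; rewrite inE /= => hd.
    rewrite mem_set//= ger0_norm//.
    by have := dev_le i N w; lra.
- move=> x; apply: (@continuous_min R R (fun=> 1) (fun y : R => `|y|)).
    exact: cvg_cst.
  exact: norm_continuous.
- by exists 1 => x; rewrite ger0_norm ?ge_min ?lexx// le_min ler01 normr_ge0.
Qed.

(** [g (S N w)] is compared with [g (tot N w *: v)] in three cases: the total exceeds [K], some
    deviation is at least [del], or both points are close and the second lies in a compact box. *)
Lemma scaled_counts_cvg_in_distribution :
  cvg_in_distribution P P' S (fun w => Y w *: v).
Proof.
move=> g cg [B gB]; have B0 : 0 <= B by exact: le_trans (normr_ge0 _) (gB 0).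
have cgv : continuous (fun x : R => g (x *: v)).
  move=> x; apply: (@continuous_comp _ _ _ (fun x : R => x *: v) g); last exact: cg.
  exact: scalel_continuous.
have main := total_cvg_in_distribution cgv (ex_intro _ B (fun x => gB (x *: v))).
suff diff : (fun N => \int[P]_w g (S N w) - \int[P]_w g (tot N w *: v)) @ \oo --> 0.
  rewrite (_ : (fun N => \int[P]_w g (S N w)) =
      (fun N => (\int[P]_w g (S N w) - \int[P]_w g (tot N w *: v)) +
        \int[P]_w g (tot N w *: v))); last by apply/funext => N; rewrite subrK.
  by rewrite -[X in _ --> X]add0r; exact: (cvgD diff main).
pose W N := \sum_i \int[P]_w Num.min 1 `|dev i N w|.
have W0 : W @ \oo --> 0.
  rewrite [X in _ --> X](_ : 0 = \sum_(i < V.+1) 0 :> R); last by rewrite big1.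
  by apply: cvgr_sum => i; exact: deviation_cvg0.
apply/cvgrPdist_le => e0 e0_gt0.
(* The oscillation of [g] is at most [2 * B], so this tail costs at most [e0 / 3]. *)
have B1 : 0 < 6 * (B + 1) by lra.
have [K K_gt0 KP] := tot_tight (divr_gt0 e0_gt0 B1).
pose A := [set x : 'rV[R]_V.+1 | forall i, [set` `[- K, K]] (x ord0 i)].
have cA : compact A by apply: (@rV_compact _ _ (fun=> `[- K, K]%classic)) => _; exact: segment_compact.
have e3 : 0 < e0 / 3 by rewrite divr_gt0.
have [del0 del0_gt0 gdel] := compact_uniform_continuity cA cg e3.
(* With [del <= 1], a deviation of at least [del] makes [min 1 |dev|] at least [del]; the constant
   [C = 2 B / del] below is then that of Markov's inequality. *)
pose del := Num.min 1 del0.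
have del_gt0 : 0 < del by rewrite lt_min ltr01.
have min_ge0 i N w : 0 <= Num.min 1 `|dev i N w| by rewrite le_min ler01 normr_ge0.
pose C := 2 * B / del.
have C0 : 0 <= C by rewrite divr_ge0 ?mulr_ge0// ltW.
have pointwise N w : `|g (S N w) - g (tot N w *: v)| <=
    e0 / 3 + (2 * B * tail K (tot N w) + C * \sum_i Num.min 1 `|dev i N w|).
  have t0 : 0 <= tail K (tot N w) by rewrite /tail indicE.
  have g2 : `|g (S N w) - g (tot N w *: v)| <= 2 * B.
    by apply: (le_trans (ler_normB _ _)); rewrite (_ : 2 * B = B + B) ?lerD//; ring.
  have sum0 : 0 <= \sum_i Num.min 1 `|dev i N w| by exact: sumr_ge0.
  have q1 : 0 <= 2 * B * tail K (tot N w) by rewrite mulr_ge0 ?mulr_ge0.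
  have q2 : 0 <= C * \sum_i Num.min 1 `|dev i N w| by rewrite mulr_ge0.
  have [totK|totK] := leP (tot N w) K; last first.
    have : tail K (tot N w) = 1 by rewrite /tail indicE mem_set//= ger0_norm.
    by move=> ->; rewrite mulr1; lra.
  have [small|/existsNP[i /negP]] := pselect (forall i, `|dev i N w| < del); last first.
    rewrite -leNgt => hi.
    suff : 2 * B <= C * \sum_i Num.min 1 `|dev i N w| by lra.
    apply: (@le_trans _ _ (C * del)); first by rewrite /C mulfVK// gt_eqF.
    rewrite ler_wpM2l// (bigD1 i)//= ler_wpDr//; first exact: sumr_ge0.
    by rewrite le_min hi andbT ge_min lexx.
  suff : `|g (tot N w *: v) - g (S N w)| < e0 / 3.
    by rewrite distrC => /ltW; lra.
  apply: gdel.
    move=> i /=; rewrite mxE in_itv/= -ler_norml ger0_norm; last first.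
      by rewrite mulr_ge0// ltW.
    apply: le_trans totK; rewrite ler_piMr// -hv1 (bigD1 i)//= lerDl.
    by apply: sumr_ge0 => j _; exact: ltW.
  split=> // i j; rewrite ord1 /ball/= mxE distrC mulrC.
  by apply: lt_le_trans (small j) _; rewrite ge_min lexx orbT.
have im i N : P.-integrable setT (EFin \o (fun w => Num.min 1 `|dev i N w|)).
  apply: (@bounded_integrable _ _ _ _ _ 1).
    exact: (measurable_scaled_counts (fun x : 'rV[R]_V.+1 =>
      Num.min 1 `|x 0 i - v 0 i * \sum_s x 0 s|)).
  by move=> w; rewrite ger0_norm// ge_min lexx.
have it N : P.-integrable setT (EFin \o (fun w => tail K (tot N w))).
  apply: (@bounded_integrable _ _ _ _ _ 1); first exact: (mtot (tail K)).
  by move=> w; rewrite /tail indicE; case: (_ \in _); rewrite ?normr1 ?normr0 ?ler01.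
have ig1 N : P.-integrable setT (EFin \o (fun w => g (S N w))).
  by apply: (@bounded_integrable _ _ _ _ _ B) => [|w]; [exact: measurable_scaled_counts|exact: gB].
have ig2 N : P.-integrable setT (EFin \o (fun w => g (tot N w *: v))).
  by apply: (@bounded_integrable _ _ _ _ _ B) => [|w];
    [exact: (mtot (fun t => g (t *: v)))|exact: gB].
have C1 : 0 < C + 1 by lra.
have e3C : 0 < e0 / (3 * (C + 1)) by rewrite divr_gt0// mulr_gt0.
move/cvgrPdist_le: W0 => /(_ _ e3C).
apply: filterS2 KP => N hK hW.
rewrite sub0r normrN -RintegralB//.
have idiff : P.-integrable setT (EFin \o (fun w => g (S N w) - g (tot N w *: v))).
  under eq_fun do rewrite -mulN1r.
  by apply: integrable_addr => //; exact: integrable_scaler.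
apply: (le_trans (le_normr_Rintegral measurableT idiff)).
have i1 : P.-integrable setT (EFin \o (fun w => 2 * B * tail K (tot N w))).
  exact: integrable_scaler.
have i2 : P.-integrable setT (EFin \o (fun w => \sum_i Num.min 1 `|dev i N w|)).
  by apply: integrable_sumr => i.
have i3 := integrable_scaler C i2.
have i4 := integrable_addr i1 i3.
have i5 : P.-integrable setT (EFin \o (fun=> e0 / 3)) by exact: finite_measure_integrable_cst.
apply: (@le_trans _ _ (\int[P]_w (e0 / 3 +
    (2 * B * tail K (tot N w) + C * \sum_i Num.min 1 `|dev i N w|)))).
  apply: le_Rintegral => //; first exact: integrable_norm.
  exact: integrable_addr.
rewrite RintegralD// RintegralD// RintegralZl// RintegralZl// Rintegral_sumr//.
rewrite Rintegral_cst// [X in _ * fine X]probability_setT mulr1 -/(W N).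
have k1 : 2 * B * \int[P]_w tail K (tot N w) <= e0 / 3.
  apply: (@le_trans _ _ (2 * B * (e0 / (6 * (B + 1))))).
    by rewrite ler_wpM2l// mulr_ge0.
  rewrite [leLHS](_ : _ = e0 / 3 * (B / (B + 1))); last by field; lra.
  by apply: ler_piMr; [exact: ltW|rewrite ler_pdivrMr; lra].
have k2 : C * W N <= e0 / 3.
  apply: (@le_trans _ _ (C * (e0 / (3 * (C + 1))))).
    rewrite ler_wpM2l//; move: hW; rewrite sub0r normrN; apply: le_trans; exact: ler_norm.
  rewrite [leLHS](_ : _ = e0 / 3 * (C / (C + 1))); last by field; lra.
  by apply: ler_piMr; [exact: ltW|rewrite ler_pdivrMr; lra].
lra.
Qed.

End StableLimit.
End LimitLaw.

Theorem theorem1 (R : realType) (V : nat)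
    (p : 'I_V.+1 -> offspring V -> R)
    (hp : forall k, is_pmf (p k))
    (hM : forall k l, (emean p k l < +oo)%E)
    (hirr : irreducible (mean_matrix p))
    (hcrit : critical (mean_matrix p))
    (Ptree : 'I_V.+1 -> probability (measurable_tree V) R)
    (hlaw : forall k, is_GW_law p k (Ptree k))
    (hfin : forall k, {ae Ptree k, forall w, finite_set (particles w)})
    (v u : 'rV[R]_V.+1)
    (hv0 : forall s, 0 < v 0 s) (hu0 : forall s, 0 < u 0 s)
    (hv : v *m mean_matrix p = v) (hu : mean_matrix p *m u^T = u^T)
    (hv1 : \sum_s v 0 s = 1) (hvu : \sum_s v 0 s * u 0 s = 1)
    (hvar : (\esum_(n in [set: offspring V])
               (Qmix p v n * (\sum_s (n s)%:R * u 0 s) ^+ 2)%:E < +oo)%E)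
    (k : 'I_V.+1)
    (d : measure_display) (T : measurableType d) (P : probability T R)
    (omega : nat -> {mfun T >-> measurable_tree V})
    (homega : iid P (Ptree k) omega)
    (d' : measure_display) (T' : measurableType d') (P' : probability T' R)
    (xi : {RV P' >-> R})
    (hxi : forall t : R,
       charfun P' xi t =
       cexp (- ((1 -i* Num.sg t) * (Num.sqrt `|t|)%:C))) :
  0 < Hfun p v (map_mx (real_complex R) u) /\
  cvg_in_distribution P P'
    (fun N w => (N%:R ^- 2) *: \sum_(n < N) count_vector R (omega n w))
    (fun w => (u 0 k ^+ 2 * xi w /
               complex.Re (Hfun p v (map_mx (real_complex R) u))) *: v).

Proof.
have H_gt0 := branching_variance_gt0 hp hM hlaw hfin hv0 hu0 hu hvar.
rewrite (Hfun_branching_variance hp hlaw hv0 hvar); split; first by rewrite ltcR.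
exact: (scaled_counts_cvg_in_distribution hp hM hirr hlaw hfin hv0 hu0 hv hu hv1 hvu
  hvar homega hxi).
Qed.
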